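(* Let $(K,R)\in\mathcal K\times\mathcal R$ satisfy (R1), (R2), (R3) and the robust no-arbitrage property $NA^r(K,R)$. Let $(U_t)_{t\in\mathbb T}$ be concave maps $U_t:\mathbb R_+^d\to\mathbb R\cup\{-\infty\}$ such that for every $t\in\mathbb T$: (U1) $\mathrm{cl}(\mathrm{dom}(U_t))=\mathbb R_+^d$; (U2) $U_t(x)\ge U_t(y)$ whenever $x,y\in\mathbb R^d_+$ and $x-y\in\mathbb R_+^d$; (U3) $\mathrm{int}(\mathbb R_+^d)\subset\mathrm{dom}(\tilde U_t)$; (U4) for every $\lambda\in(0,1)$ there is a finite constant $C_t^\lambda\ge 0$ with $\tilde U_t(\lambda y)\le C_t^\lambda(1+\tilde U_t(y)^+)$ for all $y\in\mathrm{dom}(\tilde U_t)$. Assume further that $u(x)<\infty$ for some $x\in\mathrm{int}(K_0)$ (with $x$ in the domain $\mathbb R^d\times\mathbb R_+^N$ of $u$). Then: (i) $u(x)<\infty$ for all $x\in\mathbb R^d\times\mathbb R_+^N$; (ii) for every $x\in\mathbb R^d\times\mathbb R_+^N$ such that $\mathcal C_T^U(x;K,R)\ne\varnothing$, there is some $c^*\in\mathcal C_T^U(x;K,R)$ such that $u(x)=\mathbb E\big[\sum_{t\in\mathbb T}U_t(c_t^* )\big]$.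
   Context: Fix integers $T,d,N\ge1$, $\mathbb T=\{0,\dots,T\}$, and a probability space $(\Omega,\mathcal F,\mathbb P)$ with filtration $\mathbb F=(\mathcal F_t)_{t\in\mathbb T}$, $\mathcal F_T=\mathcal F$, $\mathcal F_0$ trivial. Vectors $x\in\mathbb R^{d+N}$ are written $x=(x^F,x^I)$ with $x^F\in\mathbb R^d$, $x^I\in\mathbb R^N$; $0_p$ is the zero of $\mathbb R^p$. For a (possibly random) set $E$, $L^0(E;\mathcal F_t)$ is the set of $\mathcal F_t$-measurable random variables with values in $E$ a.s. ($\mathcal F_T$ when omitted), and $L^0(E;\mathbb F)$ the set of $\mathbb F$-adapted processes indexed by $\mathbb T$ with values in $E$; $\mathrm{ri}$ denotes relative interior. $\mathcal K$: the set of $K=(K_t)_{t\in\mathbb T}$ for which there is a countable sequence of $\mathbb R^{d+N}$-valued processes $X^n=(X^n_t)_{t\in\mathbb T}$ such that for every $t\in\mathbb T$, a.s. only a finite but nonzero number of the $X^n_t$ are different from zero, $K_t$ is the (polyhedral) convex cone generated by $\{X_t^n,n\in\mathbb N\}$, and $\mathbb R_+^{d+N}\setminus\{0\}\subset\mathrm{int}(K_t)$ a.s. ($K_0$ is regarded as deterministic, $\mathcal F_0$ being trivial.) Write $\underline K_t=K_t\cap(\mathbb R^d\times\{0_N\})$ and $\underline K^0_t=\underline K_t\cap(-\underline K_t)$, and similarly for $\tilde K$. $\mathcal R$: the set of adapted processes $R=(R_t)_{t\in\mathbb T}$ with values in the set of mappings from $\mathbb R_+^N$ into $\mathbb R^d\times\{0_N\}$,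 i.e. $R_t(x)$ is $\mathcal F_t$-measurable for all $x\in\mathbb R_+^N$. Strategies and claims: for $\xi\in L^0(\mathbb R^{d+N};\mathbb F)$, $I(\xi)_t:=\big(\sum_{s=0}^t\xi_s^{d+i}\big)_{1\le i\le N}$. For $x\in\mathbb R^d\times\mathbb R_+^N$, $\mathcal A(x;K)$ is the set of $\xi\in L^0(\mathbb R^{d+N};\mathbb F)$ with $\xi_t\in-K_t$ and $I(\xi)_t+x^I\in\mathbb R_+^N$ a.s. for all $t\in\mathbb T$, and $$A_T(x;K,R)=\Big\{x+\sum_{t=0}^T\xi_t+\sum_{t=0}^{T-1}R_{t+1}(x^I+I(\xi)_t):\ \xi\in\mathcal A(x;K)\Big\},\qquad A_T(K,R):=A_T(0;K,R).$$ Consumption: $\mathcal C_T(x;K,R)=\{c\in L^0(\mathbb R_+^d;\mathbb F):(\sum_{t\in\mathbb T}c_t,0_N)\in A_T(x;K,R)\}$. Conditions on $(K,R)$, a.s. for each $t\in\mathbb T$: (R1) $R_t(0)=0$ and $R_t$ is continuous. (R2) For $\lambda\in[0,1]$ and $\alpha,\beta\in L^0(\mathbb R_+^N)$, $\lambda R_t(\alpha)+(1-\lambda)R_t(\beta)-R_t(\lambda\alpha+(1-\lambda)\beta)\in-\underline K_t$. (R3) There are $a_t\in L^0(\mathbb R^{d+N})$ and $L\in\mathcal R$ such that $\lambda L_t(\alpha)=L_t(\lambda\alpha)$ a.s. and $R_t(\alpha)+a_t+L_t(\alpha)\in L^0(\mathbb R_+^{d+N})$ for all $(\lambda,\alpha)\in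 L^0(\mathbb R_+\times\mathbb R_+^N)$. No-arbitrage: $NA(K,R)$ means $A_T(K,R)\cap L^0(\mathbb R_+^{d+N})=\{0\}$. $(\tilde K,\tilde R)\in\mathcal K\times\mathcal R$ dominates $(K,R)$ if, for each $t\in\mathbb T$: (D1) $\underline K_t\setminus\underline K_t^0\subset\mathrm{ri}(\underline{\tilde K}_t)$ and $K_t\subset\tilde K_t$; (D2) $\tilde R_t(0)\in\underline K_t$ and $\tilde R_t(\alpha)-R_t(\alpha)\in\mathrm{ri}(\underline K_t)$ for all $\alpha\in\mathbb R_+^N\setminus\{0\}$. $NA^r(K,R)$ means that $NA(\tilde K,\tilde R)$ holds for some $(\tilde K,\tilde R)$ dominating $(K,R)$. Utility: $\mathrm{dom}(f)$ is the set of points where $f$ is finite, and $\tilde U_t(y)=\sup_{x\in\mathbb R_+^d}[U_t(x)-x\cdot y]$ for $y\in\mathbb R_+^d$. Set $\mathcal C_T^U(x;K,R)=\{c\in\mathcal C_T(x;K,R):(\sum_{t\in\mathbb T}U_t(c_t))^-\in L^1(\mathbb P)\}$ and $u(x)=\sup_{c\in\mathcal C_T^U(x;K,R)}\mathbb E[\sum_{t\in\mathbb T}U_t(c_t)]$ for $x\in\mathbb R^d\times\mathbb R_+^N$ (with the usual $\sup\varnothing=-\infty$).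
   Formalization: In (ii) each U_t is also assumed upper semicontinuous on the orthant, since attainment can fail when U_t jumps at the boundary; in NA^r the dominating return R~ must give an F_t-measurable variable at every F_t-measurable random argument, so that A_T(K~,R~) consists of random variables. *)

(* Defs.v *)
From HB Require Import structures.
From mathcomp Require Import all_boot all_order all_algebra.
From mathcomp Require Import all_classical all_reals all_analysis.

Set Implicit Arguments.
Unset Strict Implicit.
Unset Printing Implicit Defensive.

Import Order.TTheory GRing.Theory Num.Theory.
Import numFieldNormedType.Exports.

Local Open Scope classical_set_scope.
Local Open Scope ring_scope.

Section convex_geometry.
Context {R : realType}.

Definition orthant (n : nat) : set 'rV[R]_n :=
  [set x | forall i, 0 <= x ord0 i].

Definition cone_gen (n : nat) (X : nat -> 'rV[R]_n) : set 'rV[R]_n :=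
  [set v | exists m (c : nat -> R),
     (forall k, 0 <= c k) /\ v = \sum_(k < m) c k *: X k].

Definition aff_hull (n : nat) (C : set 'rV[R]_n) : set 'rV[R]_n :=
  [set v | exists m (p : 'I_m -> 'rV[R]_n) (c : 'I_m -> R),
     [/\ forall k, C (p k), \sum_k c k = 1 & v = \sum_k c k *: p k]].

Definition rel_int (n : nat) (C : set 'rV[R]_n) : set 'rV[R]_n :=
  [set v | C v /\ exists2 e : R, 0 < e & ball v e `&` aff_hull C `<=` C].

End convex_geometry.

Section market.
Context {R : realType} {disp : measure_display} {Omega : measurableType disp}.
Variables (P : probability Omega R) (T dF dI : nat).
Variable F : nat -> set (set Omega).

(* Vectors of R^(dF+dI) are row vectors x with x^F = lsubmx x and
   x^I = rsubmx x.  A process is indexed by nat; only its values at the dates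
   t <= T are ever used. *)
Local Notation vec := 'rV[R]_(dF + dI).

(* F_0 is trivial up to P, so that it may contain P-null sets. *)
Definition filtration : Prop :=
  [/\ forall t, (t <= T)%N -> sigma_algebra [set: Omega] (F t),
      forall s t, (s <= t)%N -> (t <= T)%N -> F s `<=` F t,
      F T = @measurable _ Omega
    & forall A, F 0 A -> P A = 0%E \/ P A = 1%E].

Definition measurable_wrt (G : set (set Omega)) (n : nat)
    (X : Omega -> 'rV[R]_n) : Prop :=
  forall i, measurable_fun [set: g_sigma_algebraType G]
              (fun w : g_sigma_algebraType G => X w ord0 i).

Definition L0 (G : set (set Omega)) (n : nat) (E : Omega -> set 'rV[R]_n) :
    set (Omega -> 'rV[R]_n) :=
  [set X | measurable_wrt G X /\ \forall w \ae P, E w (X w)].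

(* The maps whose class modulo P-a.s. equality belongs to L0 G E. *)
Definition L0_class (G : set (set Omega)) (n : nat)
    (E : Omega -> set 'rV[R]_n) : set (Omega -> 'rV[R]_n) :=
  [set X | exists2 Y, L0 G E Y & \forall w \ae P, X w = Y w].

Definition adaptedL0 (n : nat) (E : nat -> Omega -> set 'rV[R]_n) :
    set (nat -> Omega -> 'rV[R]_n) :=
  [set X | forall t, (t <= T)%N -> L0 (F t) (E t) (X t)].

(* The class of cone-valued processes.  The generators are adapted: this is
   what makes K_0 a.s. deterministic. *)
Definition cone_process : set (nat -> Omega -> set vec) :=
  [set K | exists2 X : nat -> nat -> Omega -> vec,
     forall n, adaptedL0 (fun _ _ => setT) (X n) &
     forall t, (t <= T)%N -> \forall w \ae P,
       [/\ finite_set [set n | X n t w != 0],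
           [set n | X n t w != 0] !=set0,
           K t w = cone_gen (fun n => X n t w)
         & @orthant R (dF + dI) `\ 0 `<=` (K t w)°]].

Definition ucone (C : set vec) : set vec := C `&` [set x | rsubmx x = 0].

Definition ucone0 (C : set vec) : set vec :=
  ucone C `&` [set x | ucone C (- x)].

(* Return functions are total maps on 'rV_dI; only their values on the orthant
   are relevant. *)
Definition return_process : set (nat -> Omega -> 'rV[R]_dI -> vec) :=
  [set Rp | forall t, (t <= T)%N -> forall x, orthant x ->
     (forall w, rsubmx (Rp t w x) = 0) /\
     measurable_wrt (F t) (fun w => Rp t w x)].

(* Evaluating the return at a random point yields a random variable of the same
   date.  For R_t a.s. continuous on the orthant this follows from membership in
   return_process; it has to be required for the processes dominating R, which
   need not be continuous, for their wealth to be a random variable. *)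
Definition superposable (Rp : nat -> Omega -> 'rV[R]_dI -> vec) : Prop :=
  forall t, (t <= T)%N -> forall alpha : Omega -> 'rV[R]_dI,
    L0 (F t) (fun _ => @orthant R dI) alpha ->
    L0_class (F t) (fun _ => setT) (fun w => Rp t w (alpha w)).

Definition invest (xi : nat -> Omega -> vec) (t : nat) (w : Omega) :
    'rV[R]_dI :=
  \sum_(s < t.+1) rsubmx (xi s w).

Definition strategies (x : vec) (K : nat -> Omega -> set vec) :
    set (nat -> Omega -> vec) :=
  [set xi | adaptedL0 (fun t w => [set v | K t w (- v)]) xi /\
     forall t, (t <= T)%N ->
       \forall w \ae P, orthant (invest xi t w + rsubmx x)].

(* A set of random variables, closed under P-a.s. equality. *)
Definition claims (x : vec) (K : nat -> Omega -> set vec)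
    (Rp : nat -> Omega -> 'rV[R]_dI -> vec) : set (Omega -> vec) :=
  [set g | measurable_wrt (F T) g /\
     exists2 xi, strategies x K xi &
       \forall w \ae P, g w = x + \sum_(t < T.+1) xi t w +
         \sum_(t < T) Rp t.+1 w (rsubmx x + invest xi t w)].

Definition consumptions (x : vec) (K : nat -> Omega -> set vec)
    (Rp : nat -> Omega -> 'rV[R]_dI -> vec) : set (nat -> Omega -> 'rV[R]_dF) :=
  [set c | adaptedL0 (fun _ _ => @orthant R dF) c /\
     claims x K Rp (fun w => row_mx (\sum_(t < T.+1) c t w) 0)].

Definition R1 (Rp : nat -> Omega -> 'rV[R]_dI -> vec) : Prop :=
  forall t, (t <= T)%N -> \forall w \ae P,
    Rp t w 0 = 0 /\ {within @orthant R dI, continuous (Rp t w)}.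

Definition R2 (K : nat -> Omega -> set vec)
    (Rp : nat -> Omega -> 'rV[R]_dI -> vec) : Prop :=
  forall t, (t <= T)%N -> forall (l : R) (alpha beta : Omega -> 'rV[R]_dI),
    0 <= l <= 1 ->
    L0 (F T) (fun _ => @orthant R dI) alpha ->
    L0 (F T) (fun _ => @orthant R dI) beta ->
    \forall w \ae P, ucone (K t w)
      (- (l *: Rp t w (alpha w) + (1 - l) *: Rp t w (beta w)
          - Rp t w (l *: alpha w + (1 - l) *: beta w))).

Definition R3 (Rp : nat -> Omega -> 'rV[R]_dI -> vec) : Prop :=
  exists (a : nat -> Omega -> vec) (L : nat -> Omega -> 'rV[R]_dI -> vec),
    [/\ forall t, (t <= T)%N -> L0 (F T) (fun _ => setT) (a t),
        return_process L &
        forall t, (t <= T)%N ->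
        forall (l : Omega -> R) (alpha : Omega -> 'rV[R]_dI),
          measurable_fun setT l -> (\forall w \ae P, 0 <= l w) ->
          L0 (F T) (fun _ => @orthant R dI) alpha ->
          (\forall w \ae P, l w *: L t w (alpha w) = L t w (l w *: alpha w)) /\
          L0_class (F T) (fun _ => @orthant R (dF + dI))
            (fun w => Rp t w (alpha w) + a t w + L t w (alpha w))].

Definition NA (K : nat -> Omega -> set vec)
    (Rp : nat -> Omega -> 'rV[R]_dI -> vec) : Prop :=
  claims 0 K Rp `&` L0 (F T) (fun _ => @orthant R (dF + dI)) =
  L0 (F T) (fun _ => [set 0]).

Definition dominates (K' : nat -> Omega -> set vec)
    (R' : nat -> Omega -> 'rV[R]_dI -> vec) (K : nat -> Omega -> set vec)
    (Rp : nat -> Omega -> 'rV[R]_dI -> vec) : Prop :=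
  forall t, (t <= T)%N -> \forall w \ae P,
    [/\ ucone (K t w) `\` ucone0 (K t w) `<=` rel_int (ucone (K' t w)),
        K t w `<=` K' t w,
        ucone (K t w) (R' t w 0)
      & forall alpha, orthant alpha -> alpha != 0 ->
          rel_int (ucone (K t w)) (R' t w alpha - Rp t w alpha)].

Definition NAr (K : nat -> Omega -> set vec)
    (Rp : nat -> Omega -> 'rV[R]_dI -> vec) : Prop :=
  exists K' R', [/\ cone_process K', return_process R', superposable R',
                    dominates K' R' K Rp & NA K' R'].

Local Open Scope ereal_scope.

Definition edom (n : nat) (f : 'rV[R]_n -> \bar R) : set 'rV[R]_n :=
  [set x | orthant x /\ f x \is a fin_num].

Definition concave_on_orthant (n : nat) (f : 'rV[R]_n -> \bar R) : Prop :=
  forall (x y : 'rV[R]_n) (l : R), orthant x -> orthant y -> (0 <= l <= 1)%R ->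
    l%:E * f x + (1 - l)%:E * f y <= f (l *: x + (1 - l) *: y)%R.

(* Concavity allows f to jump down on the boundary of the orthant.  Without
   upper semicontinuity the optimum need not be attained: with d = 1, T = 1,
   U_0 z = min z 10, U_1 z = 1 if 0 < z and U_1 0 = 0, and consumption
   constrained by c_0 + c_1 <= 1, the supremum 2 is not reached. *)
Definition usc_on_orthant (n : nat) (f : 'rV[R]_n -> \bar R) : Prop :=
  forall a : R, closed [set x | orthant x /\ a%:E <= f x].

Definition conjugate (n : nat) (f : 'rV[R]_n -> \bar R) (y : 'rV[R]_n) :
    \bar R :=
  ereal_sup [set f x - (\sum_i x ord0 i * y ord0 i)%:E | x in @orthant R n].

Definition U1 (n : nat) (f : 'rV[R]_n -> \bar R) : Prop :=
  closure (edom f) = @orthant R n.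

Definition U2 (n : nat) (f : 'rV[R]_n -> \bar R) : Prop :=
  forall x y, orthant x -> orthant y -> orthant (x - y)%R -> f y <= f x.

Definition U3 (n : nat) (f : 'rV[R]_n -> \bar R) : Prop :=
  (@orthant R n)° `<=` edom (conjugate f).

Definition U4 (n : nat) (f : 'rV[R]_n -> \bar R) : Prop :=
  forall l : R, (0 < l < 1)%R -> exists2 C : R, (0 <= C)%R &
    forall y, edom (conjugate f) y ->
      conjugate f (l *: y)%R <= C%:E * (1 + maxe (conjugate f y) 0).

(* Restricting U_t to the orthant (by 0 elsewhere) only affects the P-null set
   on which c_t leaves it. *)
Definition total_utility (U : nat -> 'rV[R]_dF -> \bar R)
    (c : nat -> Omega -> 'rV[R]_dF) (w : Omega) : \bar R :=
  \sum_(t < T.+1) (U t \_ (@orthant R dF)) (c t w).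

Definition consumptionsU (U : nat -> 'rV[R]_dF -> \bar R) (x : vec)
    (K : nat -> Omega -> set vec) (Rp : nat -> Omega -> 'rV[R]_dI -> vec) :
    set (nat -> Omega -> 'rV[R]_dF) :=
  [set c | consumptions x K Rp c /\
     P.-integrable setT (fun w => (total_utility U c)^\- w)].

Definition expected_utility (U : nat -> 'rV[R]_dF -> \bar R)
    (c : nat -> Omega -> 'rV[R]_dF) : \bar R :=
  \int[P]_w total_utility U c w.

Definition value (U : nat -> 'rV[R]_dF -> \bar R) (x : vec)
    (K : nat -> Omega -> set vec) (Rp : nat -> Omega -> 'rV[R]_dI -> vec) :
    \bar R :=
  ereal_sup [set expected_utility U c | c in consumptionsU U x K Rp].

End market.

(* Main.v *)
(* The consumptions financed from [x] are the adapted processes whose total is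
   attainable, and attainability is described by backward recursion over the
   trading dates.  Robust no-arbitrage makes attainable sets closed
   under a.s. limits: either the first trades stay bounded along a random
   subsequence, or their normalisations converge to a trade of zero cost and zero
   gain, which the dominating market forces to be reversible, so that a
   coordinate of the trades can be removed.  The same closedness bounds the
   consumptions in probability.

   Finiteness of [u] propagates from one interior point by concavity, mixing with
   a small constant consumption.

   For attainment, a near-minimiser of [E exp(-c)] among near-maximisers of the
   utility gives, through the parallelogram identity, an a.s. convergent
   sequence.  Its limit is admissible, and optimal by Fatou's lemma once the
   positive parts of the utilities are controlled.  At a supergradient of [U_t]
   condition (U4) reads [U_t(2 z) <= (1 + gamma) U_t(z)^+ + C] with [gamma < 1]
   away from the boundary, so that expected utilities of [2 ^ j] times a
   consumption are [o(2 ^ j)]; since sums of [2 ^ j] consumptions are of this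
   form, no utility can escape to infinity. *)

(* Returns are only concave in the industrial position, so strategies cannot be subtracted from one
   another as in a linear market: beyond convex mixing, the only correction available is to add
   trades that leave every industrial position unchanged. Hence trades of zero cost and zero gain
   must be shown to be purely financial as well as reversible. The two strict inclusions of
   domination provide this: (D2) leaves a spare gain as soon as a position is held, (D1) as soon as
   a financial trade is irreversible. After one date the position is random, so attainability is
   stated for random positions, with equality; the surplus created by concavity is disposed of at
   the next date. Limits are taken along subsequences with measurable random indices, so attainable
   pairs have to be stable under measurable choice among countably many of them. For the utilities,
   upper semicontinuity leaves a single inequality in the limit. It suits Fatou's lemma on the
   negative parts, while the positive parts need the bound in mean obtained from (U4). *)
Require Import Defs.
From mathcomp Require Import all_boot all_order all_algebra.
From mathcomp Require Import all_classical all_reals all_analysis.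
From mathcomp Require Import measurable_realfun zify ring lra.

Set Implicit Arguments.
Unset Strict Implicit.
Unset Printing Implicit Defensive.

Import Order.TTheory GRing.Theory Num.Theory.
Import numFieldNormedType.Exports.

Local Open Scope classical_set_scope.
Local Open Scope ring_scope.

(** * Coordinatewise convergence and finitely generated cones *)

Section coordinates.
Context {R : realType}.
Implicit Types n : nat.

(** Convergence is coordinatewise so that limits and their measurability reduce to real sequences
    and their limits superior. *)
Definition vcvg n (x : nat -> 'rV[R]_n) (l : 'rV[R]_n) : Prop :=
  forall i, (fun k => x k ord0 i) @ \oo --> l ord0 i.

Definition seqclosed n (C : set 'rV[R]_n) : Prop :=
  forall x l, (forall k, C (x k)) -> vcvg x l -> C l.

Lemma vcvg_cst n (l : 'rV[R]_n) : vcvg (fun=> l) l.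
Proof. by move=> i; exact: cvg_cst. Qed.

Lemma vcvgD n (x y : nat -> 'rV[R]_n) l m :
  vcvg x l -> vcvg y m -> vcvg (fun k => x k + y k) (l + m).
Proof.
move=> xl ym i; rewrite mxE; under eq_fun do rewrite mxE.
exact: cvgD.
Qed.

Lemma vcvgZ n (a : nat -> R) (x : nat -> 'rV[R]_n) b l :
  a @ \oo --> (b : R) -> vcvg x l -> vcvg (fun k => a k *: x k) (b *: l).
Proof.
move=> ab xl i; rewrite mxE; under eq_fun do rewrite mxE.
exact: cvgM.
Qed.

Lemma vcvgN n (x : nat -> 'rV[R]_n) l : vcvg x l -> vcvg (fun k => - x k) (- l).
Proof.
move=> xl i; rewrite mxE; under eq_fun do rewrite mxE.
exact: cvgN.
Qed.

Lemma vcvgB n (x y : nat -> 'rV[R]_n) l m :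
  vcvg x l -> vcvg y m -> vcvg (fun k => x k - y k) (l - m).
Proof. by move=> xl ym; apply: vcvgD => //; exact: vcvgN. Qed.

Lemma vcvg_rsub n1 n2 (x : nat -> 'rV[R]_(n1 + n2)) l :
  vcvg x l -> vcvg (fun k => rsubmx (x k)) (rsubmx l).
Proof. by move=> xl i; rewrite mxE; under eq_fun do rewrite mxE; exact: xl. Qed.

Lemma vcvg_unique n (x : nat -> 'rV[R]_n) l m : vcvg x l -> vcvg x m -> l = m.
Proof.
move=> xl xm; apply/rowP => i; exact: (cvg_unique _ (xl i) (xm i)).
Qed.

(** Only [k <= t k] is asked of a reindexing: this suffices for limits, and measurable selections
    produce such indices without any monotonicity. *)
Lemma cvg_reindex (u : nat -> R) (l : R) (t : nat -> nat) :
  (forall k, (k <= t k)%N) -> u @ \oo --> l -> (u \o t) @ \oo --> l.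
Proof.
move=> kt /cvgrPdist_lt ul; apply/cvgrPdist_lt => e e0.
have [N _ HN] := ul e e0; exists N => // k /= Nk; apply: HN.
exact: leq_trans Nk (kt k).
Qed.

Lemma vcvg_reindex n (x : nat -> 'rV[R]_n) l (t : nat -> nat) :
  (forall k, (k <= t k)%N) -> vcvg x l -> vcvg (fun k => x (t k)) l.
Proof. by move=> kt xl i; exact: (cvg_reindex kt (xl i)). Qed.

Lemma vcvg_near n (x y : nat -> 'rV[R]_n) l :
  (\forall k \near \oo, x k = y k) -> vcvg x l -> vcvg y l.
Proof.
move=> xy xl i; apply: cvg_trans (xl i); apply: near_eq_cvg.
by apply: filterS xy => k ->.
Qed.

Lemma orthant_seqclosed n : seqclosed (@orthant R n).
Proof.
move=> x l xp xl i; rewrite -(cvg_lim _ (xl i))//.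
apply: limr_ge; first by apply: cvgP (xl i).
by near=> k; exact: xp.
Unshelve. all: by end_near. Qed.

(** The suprema of the tails decrease to the limit superior; beyond [k] one of them lies within [e]
    of it and is itself approached by a term. The point of this cluster value is that it depends
    measurably on the sequence. *)
Lemma limsup_cluster (u : nat -> R) (M : R) : (forall n, `|u n| <= M) ->
  forall e, 0 < e -> forall k,
  exists2 n, (k <= n)%N & `|u n - fine (limn_esup (EFin \o u))| < e.
Proof.
move=> uM e e0 k.
have bnd n : ((- M)%:E <= esups (EFin \o u) n <= M%:E)%E.
  apply/andP; split.
    apply: (@le_trans _ _ (u n)%:E).
      by rewrite lee_fin; have := uM n; rewrite ler_norml => /andP[].
    by apply: ereal_sup_ubound; exists n => //=.
  apply: ub_ereal_sup => _ [m _ <-] /=.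
  by rewrite lee_fin (le_trans (ler_norm _)).
have cv : esups (EFin \o u) @ \oo --> limn_esup (EFin \o u).
  by rewrite limn_esup_lim; exact: is_cvg_esups.
have lb : ((- M)%:E <= limn_esup (EFin \o u))%E.
  rewrite limn_esup_lim; apply: lime_ge; first exact: is_cvg_esups.
  by near=> n; have /andP[] := bnd n.
have ub : (limn_esup (EFin \o u) <= M%:E)%E.
  rewrite limn_esup_lim; apply: lime_le; first exact: is_cvg_esups.
  by near=> n; have /andP[] := bnd n.
have fl : limn_esup (EFin \o u) \is a fin_num.
  by rewrite fin_numE -ltNye -ltey (lt_le_trans _ lb) ?ltNyr// (le_lt_trans ub) ?ltry.
set l := fine _; have lE : limn_esup (EFin \o u) = l%:E by rewrite fineK.
have [n kn] : exists2 n, (k <= n)%N & (esups (EFin \o u) n < (l + e)%:E)%E.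
  have : \forall n \near \oo, (esups (EFin \o u) n < (l + e)%:E)%E.
    apply: (cv [set y | (y < (l + e)%:E)%E]).
    by apply: open_nbhs_nbhs; split; [exact: open_ereal_lt_ereal|rewrite /= lE lte_fin ltrDl].
  move=> [N _ HN]; exists (maxn N k); first exact: leq_maxr.
  by apply: HN; exact: leq_maxl.
move=> sn.
have ln : (l%:E <= esups (EFin \o u) n)%E.
  rewrite -lE limn_esup_lim; apply: lime_le; first exact: is_cvg_esups.
  exists n => // m /= nm; apply: (nonincreasing_esups _ nm).
have : ((l - e)%:E < esups (EFin \o u) n)%E.
  by apply: lt_le_trans ln; rewrite lte_fin ltrBlDr ltrDl.
move=> /ereal_sup_gt[_ [m /= nm <-]]; rewrite lte_fin => mlb.
exists m; first exact: leq_trans kn nm.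
have : ((u m)%:E <= esups (EFin \o u) n)%E.
  by apply: ereal_sup_ubound; exists m.
move=> /le_lt_trans/(_ sn); rewrite lte_fin => mub.
by rewrite ltr_norml; apply/andP; split; lra.
Unshelve. all: by end_near. Qed.

Lemma cvg_harmonic_bound (u : nat -> R) (l : R) :
  (forall k, `|u k - l| < k.+1%:R^-1) -> u @ \oo --> l.
Proof.
move=> ul; apply/cvgrPdist_lt => e e0.
have := @cvg_harmonic R; move=> /cvgrPdist_lt/(_ e e0)[N _ HN].
exists N => // k /= Nk; rewrite distrC; apply: lt_trans (ul k) _.
by have := HN k Nk; rewrite /harmonic sub0r normrN ger0_norm// invr_ge0.
Qed.

Lemma nonneg_subseq (t : nat -> R) : (forall k, 0 <= t k) ->
  (exists (s : nat -> nat) (l : R), [/\ forall k, (k <= s k)%N, 0 <= l &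
     (t \o s) @ \oo --> l]) \/ t @ \oo --> +oo.
Proof.
move=> t0; have [[M HM]|nB] :=
  pselect (exists M, forall k, exists n, (k <= n)%N /\ t n <= M).
  left; have [s1 Hs1] := choice HM.
  have bnd n : `|(t \o s1) n| <= M by rewrite ger0_norm ?t0//; have [] := Hs1 n.
  have cl k : exists n, (k <= n)%N /\
      `|t (s1 n) - fine (limn_esup (EFin \o (t \o s1)))| < k.+1%:R^-1.
    have [|n kn Hn] := limsup_cluster bnd (e := k.+1%:R^-1) _ k; last by exists n.
    by rewrite invr_gt0.
  have [s2 Hs2] := choice cl.
  have cv : (t \o (s1 \o s2)) @ \oo --> fine (limn_esup (EFin \o (t \o s1))).
    by apply: cvg_harmonic_bound => k; have [] := Hs2 k.
  exists (s1 \o s2), (fine (limn_esup (EFin \o (t \o s1)))); split => //.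
    move=> k /=; have [h1 _] := Hs2 k; have [h2 _] := Hs1 (s2 k).
    exact: leq_trans h1 h2.
  rewrite -(cvg_lim _ cv)//; apply: limr_ge; first exact: cvgP cv.
  by near=> k; exact: t0.
right; apply/cvgryPgt => M; apply: contrapT => H; apply: nB; exists M => k.
apply: contrapT => H2; apply: H; exists k => // n /= kn.
by rewrite ltNge; apply/negP => tM; apply: H2; exists n.
Unshelve. all: by end_near. Qed.

End coordinates.

(** * Closedness of finitely generated cones *)

Section cones.
Context {R : realType}.

(** Unlike in [cone_gen], the number of generators is fixed, which makes induction on it
    possible. *)
Definition fincone n m (X : nat -> 'rV[R]_n) : set 'rV[R]_n :=
  [set v | exists c : nat -> R, (forall k, 0 <= c k) /\ v = \sum_(k < m) c k *: X k].

Definition dotv n (x y : 'rV[R]_n) : R := \sum_i x ord0 i * y ord0 i.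

Lemma dotvDl n (x y z : 'rV[R]_n) : dotv (x + y) z = dotv x z + dotv y z.
Proof. by rewrite /dotv -big_split /=; apply: eq_bigr => i _; rewrite mxE mulrDl. Qed.

Lemma dotvZl n a (x z : 'rV[R]_n) : dotv (a *: x) z = a * dotv x z.
Proof. by rewrite /dotv mulr_sumr; apply: eq_bigr => i _; rewrite mxE mulrA. Qed.

Lemma dotvv_eq0 n (x : 'rV[R]_n) : (dotv x x == 0) = (x == 0).
Proof.
apply/idP/eqP => [|->]; last first.
  by rewrite /dotv big1 // => i _; rewrite mxE mul0r.
rewrite psumr_eq0 => [|i _]; last by rewrite -expr2 sqr_ge0.
move=> /allP H; apply/rowP => i; rewrite mxE.
by have := H i (mem_index_enum _); rewrite -expr2 sqrf_eq0 => /eqP.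
Qed.

(** Orthogonal projection along [v]; for [v = 0] it is the identity, as division by 0 gives 0. *)
Definition projv n (v x : 'rV[R]_n) : 'rV[R]_n := x - (dotv x v / dotv v v) *: v.

Lemma projvD n (v x y : 'rV[R]_n) : projv v (x + y) = projv v x + projv v y.
Proof. by rewrite /projv dotvDl mulrDl scalerDl opprD addrACA. Qed.

Lemma projvZ n (v x : 'rV[R]_n) a : projv v (a *: x) = a *: projv v x.
Proof. by rewrite /projv dotvZl scalerBr scalerA mulrA. Qed.

Lemma projv_id n (v : 'rV[R]_n) : v != 0 -> projv v v = 0.
Proof. by move=> v0; rewrite /projv divff ?scale1r ?subrr// dotvv_eq0. Qed.

Lemma projv_sum n m (v : 'rV[R]_n) (X : nat -> 'rV[R]_n) (c : nat -> R) :
  projv v (\sum_(k < m) c k *: X k) = \sum_(k < m) c k *: projv v (X k).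
Proof.
elim: m => [|m IH].
  by rewrite !big_ord0 -(scale0r (0 : 'rV_n)) projvZ scale0r scale0r.
by rewrite !big_ord_recr /= projvD projvZ IH.
Qed.

Lemma cvg_sumr n (f : 'I_n -> nat -> R) (l : 'I_n -> R) :
  (forall i, f i @ \oo --> l i) -> (fun k => \sum_i f i k) @ \oo --> \sum_i l i.
Proof.
elim: n f l => [|n IH] f l fl.
  by rewrite big_ord0; under eq_fun do rewrite big_ord0; exact: cvg_cst.
rewrite big_ord_recr; under eq_fun do rewrite big_ord_recr.
apply: cvgD; [by apply: IH => i; exact: fl|exact: fl].
Qed.

Lemma vcvg_projv n (v : 'rV[R]_n) x l : vcvg x l -> vcvg (fun k => projv v (x k)) (projv v l).
Proof.
move=> xl; apply: vcvgB => //; apply: vcvgZ; last exact: vcvg_cst.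
apply: cvgM; last exact: cvg_cst.
apply: cvg_sumr => i; apply: cvgM; [exact: xl|exact: cvg_cst].
Qed.

(** Induction on the number of generators. If [- X m] lies in the cone of the others, the cone
    contains the line of [X m] and can be projected along it; otherwise the coefficients of [X m]
    have a bounded subsequence, since dividing by exploding ones would exhibit [- X m] as a limit in
    the smaller cone, closed by induction. *)
Lemma fincone_closed n m (X : nat -> 'rV[R]_n) : seqclosed (fincone m X).
Proof.
elim: m X => [|m IH] X x l xC xl.
  suff -> : l = 0 by exists (fun=> 0); rewrite big_ord0.
  apply: (vcvg_unique xl) => i; have -> : (fun k => x k ord0 i) = (fun=> (0 : 'rV[R]_n) ord0 i).
    by apply/funext => k; have [c [_ ->]] := xC k; rewrite big_ord0.
  exact: cvg_cst.
have [v0|v0] := eqVneq (X m) 0.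
  have Xm : fincone m.+1 X `<=` fincone m X.
    by move=> _ [c [c0 ->]]; exists c; split=> //; rewrite big_ord_recr /= v0 scaler0 addr0.
  have [c [c0 ->]] := IH X x l (fun k => Xm _ (xC k)) xl.
  exists (fun k => if (k == m) then 0 else c k); split; first by move=> k; case: ifP.
  rewrite big_ord_recr /= v0 scaler0 addr0; apply: eq_bigr => i _.
  by rewrite ltn_eqF.
have [[c [c0 cE]]|nC] := pselect (fincone m X (- X m)).
  have : fincone m (fun k => projv (X m) (X k)) (projv (X m) l).
    apply: (IH _ (fun k => projv (X m) (x k))); last exact: vcvg_projv.
    move=> k; have [d [d0 ->]] := xC k.
    exists d; split=> //; rewrite projv_sum big_ord_recr /=.
    by rewrite projv_id// scaler0 addr0.
  move=> [d [d0]]; rewrite -projv_sum => E.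
  (* [s] is the coefficient of [X m] lost by the projection; when negative it is rewritten with [c],
     the coefficients of [- X m] on the other generators. *)
  pose s := dotv l (X m) / dotv (X m) (X m) -
    dotv (\sum_(k < m) d k *: X k) (X m) / dotv (X m) (X m).
  have lE : l = \sum_(k < m) d k *: X k + s *: X m.
    move: E; rewrite /projv => /(canRL (subrK _)) ->.
    by rewrite /s scalerBl addrAC addrA.
  have [s0|s0] := leP 0 s.
    exists (fun k => if k == m then s else d k); split; first by move=> k; case: ifP.
    rewrite big_ord_recr /= eqxx lE; congr (_ + _); apply: eq_bigr => i _.
    by rewrite ltn_eqF.
  exists (fun k => if k == m then 0 else d k - s * c k); split.
    by move=> k; case: ifP => // _; rewrite subr_ge0 (le_trans _ (d0 k))// nmulr_rle0.
  rewrite big_ord_recr /= eqxx scale0r addr0 lE.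
  have -> : s *: X m = \sum_(k < m) (- s * c k) *: X k.
    rewrite -[X m]opprK cE scalerN -scaleNr scaler_sumr.
    by apply: eq_bigr => i _; rewrite scalerA.
  rewrite -big_split /=.
  by apply: eq_bigr => i _; rewrite ltn_eqF// -scalerDl mulNr.
have [y Hy] := choice xC.
have y0 k j : 0 <= y k j by have [+ _] := Hy k; exact.
have yE k : x k = \sum_(j < m) y k j *: X j + y k m *: X m.
  by have [_ ->] := Hy k; rewrite big_ord_recr.
have [[s [t [ks t0 st]]]|tp] := nonneg_subseq (fun k => y0 k m).
  have : fincone m X (l - t *: X m).
    apply: (IH X (fun k => x (s k) - y (s k) m *: X m)); last first.
      apply: vcvgB; first exact: vcvg_reindex xl.
      by apply: vcvgZ => //; exact: vcvg_cst.
    by move=> k; rewrite yE addrK; exists (y (s k)).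
  move=> [d [d0 dE]].
  exists (fun k => if k == m then t else d k); split; first by move=> k; case: ifP.
  rewrite big_ord_recr /= eqxx -[LHS](subrK (t *: X m)) dE; congr (_ + _).
  by apply: eq_bigr => i _; rewrite ltn_eqF.
exfalso; apply: nC.
have iv0 : (fun k => (y k m)^-1) @ \oo --> (0 : R).
  apply/gtr0_cvgV0 => //; near=> k; near: k.
  by move/cvgryPgt: tp; exact.
apply: (IH X (fun k => (y k m)^-1 *: \sum_(j < m) y k j *: X j)).
  move=> k; exists (fun j => (y k m)^-1 * y k j); split.
    by move=> j; rewrite mulr_ge0// invr_ge0.
  by rewrite scaler_sumr; apply: eq_bigr => i _; rewrite scalerA.
apply: (@vcvg_near _ _ (fun k => (y k m)^-1 *: x k - X m)).
  near=> k; have yk0 : 0 < y k m by near: k; move/cvgryPgt: tp; exact.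
  by rewrite yE scalerDr scalerA mulVf ?gt_eqF// scale1r addrK.
rewrite -[X in vcvg _ X]add0r -(scale0r l).
by apply: vcvgB; [exact: vcvgZ|exact: vcvg_cst].
Unshelve. all: by end_near. Qed.

Lemma cone_gen_closed n (X : nat -> 'rV[R]_n) :
  finite_set [set k | X k != 0] -> seqclosed (cone_gen X).
Proof.
move=> /finite_setP fX.
have [m Hm] : exists m, forall k, (m <= k)%N -> X k = 0.
  have /finite_fsetP[B HB] : finite_set [set k | X k != 0] by apply/finite_setP.
  exists (\max_(k <- finmap.enum_fset B) k).+1 => k mk; apply/eqP; apply: contrapT => /negP Xk.
  have : [set k | X k != 0] k by [].
  rewrite HB /= => kB; move: mk; rewrite ltnNge => /negP; apply.
  by apply: (leq_bigmax_seq (F := fun k => k)).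
have E : cone_gen X = fincone m X.
  apply/seteqP; split => [v [p [c [c0 ->]]]|v [c [c0 ->]]]; last by exists m, c.
  exists (fun k => if (k < p)%N then c k else 0); split; first by move=> k; case: ifP.
  have [pm|mp] := leqP p m.
    rewrite (big_ord_widen m (fun k => c k *: X k) pm) big_mkcond /=.
    by apply: eq_bigr => i _; case: ifP; rewrite ?scale0r.
  rewrite (big_ord_widen p (fun k => (if (k < p)%N then c k else 0) *: X k) (ltnW mp)).
  rewrite [RHS]big_mkcond /=; apply: eq_bigr => i _; rewrite ltn_ord.
  by case: ltnP => // mi; rewrite Hm// scaler0.
by rewrite E; exact: fincone_closed.
Qed.

Record closed_cone n (C : set 'rV[R]_n) : Prop := ClosedCone {
  cc0 : C 0;
  ccD : forall x y, C x -> C y -> C (x + y);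
  ccZ : forall a x, 0 <= a -> C x -> C (a *: x);
  cc_closed : seqclosed C;
  cc_orthant : forall x, orthant x -> C x }.

Lemma cone_gen_closed_cone n (X : nat -> 'rV[R]_n) :
  finite_set [set k | X k != 0] -> @orthant R n `\ 0 `<=` (cone_gen X)° ->
  closed_cone (cone_gen X).
Proof.
move=> fX oX; have C0 : cone_gen X 0 by exists 0%N, (fun=> 0); rewrite big_ord0.
split=> //.
- move=> _ _ [m [c [c0 ->]]] [p [d [d0 ->]]].
  exists (maxn m p), (fun k => (if (k < m)%N then c k else 0) +
                               (if (k < p)%N then d k else 0)); split.
    by move=> k; apply: addr_ge0; case: ifP.
  rewrite (big_ord_widen _ (fun k => c k *: X k) (leq_maxl m p)).
  rewrite (big_ord_widen _ (fun k => d k *: X k) (leq_maxr m p)).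
  rewrite big_mkcond [X in _ + X]big_mkcond -big_split /=; apply: eq_bigr => i _.
  by rewrite scalerDl; case: ifP; case: ifP; rewrite ?scale0r.
- move=> a _ a0 [m [c [c0 ->]]]; exists m, (fun k => a * c k); split.
    by move=> k; rewrite mulr_ge0.
  by rewrite scaler_sumr; apply: eq_bigr => i _; rewrite scalerA.
- exact: cone_gen_closed.
move=> x xo; have [->//|x0] := eqVneq x 0.
by apply: interior_subset; apply: oX; split => //; exact/eqP.
Qed.

Lemma ucone0_in n1 n2 (C : set 'rV[R]_(n1 + n2)) : closed_cone C -> ucone C 0.
Proof. by move=> CC; split; [exact: cc0|rewrite /= linear0]. Qed.

Lemma uconeZ n1 n2 (C : set 'rV[R]_(n1 + n2)) a x :
  closed_cone C -> 0 <= a -> ucone C x -> ucone C (a *: x).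
Proof.
move=> CC a0 [Cx x0]; split; first exact: ccZ.
by rewrite /= linearZ /= x0 scaler0.
Qed.

Lemma ucone_closed n1 n2 (C : set 'rV[R]_(n1 + n2)) :
  closed_cone C -> seqclosed (ucone C).
Proof.
move=> CC x l xC xl; split; first by apply: (cc_closed CC) xl => k; have [] := xC k.
apply: (vcvg_unique (vcvg_rsub xl)).
apply: (@vcvg_near _ _ (fun=> 0)); last exact: vcvg_cst.
by apply: nearW => k; have [_ ->] := xC k.
Qed.

Lemma ball_row n (x y : 'rV[R]_n) (e : R) :
  (forall i, `|x ord0 i - y ord0 i| < e) -> 0 < e -> ball x e y.
Proof. by move=> H e0; split => // i j; rewrite (ord1 i); exact: H. Qed.

Lemma interior_row n (C : set 'rV[R]_n) (x : 'rV[R]_n) : C° x ->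
  exists2 e : R, 0 < e & forall y : 'rV[R]_n, (forall i, `|x ord0 i - y ord0 i| < e) -> C y.
Proof.
move=> /nbhs_ballP[e e0 He]; exists e => // y Hy.
by apply: He; exact: ball_row.
Qed.

Lemma continuous_orthant_seq n m (f : 'rV[R]_n -> 'rV[R]_m) :
  {within @orthant R n, continuous f} -> forall x l, (forall k, orthant (x k)) ->
  vcvg x l -> vcvg (fun k => f (x k)) (f l).
Proof.
move=> cf x l xo xl; have lo := orthant_seqclosed xo xl.
move/subspace_continuousP : cf => /(_ l lo) cf i.
have xl' : x @ \oo --> l.
  apply/cvg_ballP => e e0.
  have : \forall k \near \oo, forall i, `|l ord0 i - x k ord0 i| < e.
    by apply: filter_forall => j; have /cvgrPdist_lt := xl j; exact.
  by apply: filterS => k Hk; exact: ball_row.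
have xw : x @ \oo --> within (@orthant R n) (nbhs l).
  move=> A /= ; rewrite /within/= => wA; have := xl' _ wA.
  by rewrite /nbhs/=; apply: filterS => k; apply; exact: xo.
have H := @cvg_comp _ _ _ _ _ _ _ _ xw cf.
exact: (@cvg_comp _ _ _ _ _ _ _ _ H (@coord_continuous R _ _ ord0 i (f l))).
Qed.

Lemma small_scale n (u : 'rV[R]_n) (e : R) : 0 < e ->
  exists j : nat, forall i, `|j.+1%:R^-1 * u ord0 i| < e.
Proof.
move=> e0; pose M := \sum_i `|u ord0 i|.
have M1 : 0 < M + 1 by rewrite ltr_wpDl// sumr_ge0.
have [j _ Hj] : \forall j \near \oo, `|0 - @harmonic R j| < e / (M + 1).
  by have /cvgrPdist_lt := @cvg_harmonic R; apply; rewrite divr_gt0.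
exists j => i; have := Hj j (leqnn j); rewrite sub0r normrN normrM => H.
apply: (@le_lt_trans _ _ (`|harmonic j| * (M + 1))); last by rewrite -ltr_pdivlMr.
rewrite ler_wpM2l//.
apply: (@le_trans _ _ M); last by rewrite lerDl.
by rewrite /M (bigD1 i)//= lerDl sumr_ge0.
Qed.

(** The points [v], [u], [0] with weights [1], [-e], [e] show that [v - e u] stays in the affine
    hull, hence in [C] for small [e]. Relative interiors are used in this form: a fraction of [u]
    can be spared. *)
Lemma rel_int_shift n (C : set 'rV[R]_n) v u : C 0 -> C u -> rel_int C v ->
  exists j : nat, C (v - j.+1%:R^-1 *: u).
Proof.
move=> C0 Cu [Cv [e e0 He]].
have [j Hj] := small_scale u e0.
exists j; apply: He; split.
  by apply: ball_row => // i; rewrite !mxE opprB addrCA subrr addr0.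
exists 3, (fun k : 'I_3 => if k == 0%N :> nat then v else if k == 1%N :> nat then u else 0),
  (fun k : 'I_3 => if k == 0%N :> nat then 1 else if k == 1%N :> nat then - j.+1%:R^-1
   else j.+1%:R^-1); split.
- by move=> k; case: ifP => // _; case: ifP.
- by rewrite !big_ord_recl big_ord0 /= addr0 addNr addr0.
- by rewrite !big_ord_recl big_ord0 /= scale1r scaler0 !addr0 scaleNr.
Qed.

End cones.

(** * Measurable selections *)

Section measurability.
Context {R : realType} {disp : measure_display} {Omega : measurableType disp}.
Implicit Types G : set (set Omega).

(** Measurability refers to the sigma-algebra generated by [G], as in [measurable_wrt], so that the
    lemmas on measurable types apply to each date of the filtration. *)
Definition mevent G (A : set Omega) : Prop := @measurable _ (g_sigma_algebraType G) A.

Definition mreal G (f : Omega -> R) : Prop :=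
  measurable_fun [set: g_sigma_algebraType G] (fun w : g_sigma_algebraType G => f w).

Definition mnat G (t : Omega -> nat) : Prop := forall n, mevent G [set w | t w = n].

Lemma meventT G : mevent G setT.
Proof. exact: (@measurableT _ (g_sigma_algebraType G)). Qed.

Lemma mevent0 G : mevent G set0.
Proof. exact: (@measurable0 _ (g_sigma_algebraType G)). Qed.

Lemma meventC G A : mevent G A -> mevent G (~` A).
Proof. exact: (@measurableC _ (g_sigma_algebraType G)). Qed.

Lemma meventI G A B : mevent G A -> mevent G B -> mevent G (A `&` B).
Proof. exact: (@measurableI _ (g_sigma_algebraType G)). Qed.

Lemma meventU G A B : mevent G A -> mevent G B -> mevent G (A `|` B).
Proof. exact: (@measurableU _ (g_sigma_algebraType G)). Qed.

Lemma mevent_exists G (T : countType) (A : T -> set Omega) :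
  (forall n, mevent G (A n)) -> mevent G [set w | exists n, A n w].
Proof.
move=> mA; rewrite (_ : [set w | _] = \bigcup_n A n); last first.
  by apply/seteqP; split => [w [n An]|w [n _ An]]; exists n.
exact: (@countable_bigcupT_measurable _ (g_sigma_algebraType G)).
Qed.

Lemma mevent_forall G (T : countType) (A : T -> set Omega) :
  (forall n, mevent G (A n)) -> mevent G [set w | forall n, A n w].
Proof.
move=> mA; rewrite (_ : [set w | _] = ~` [set w | exists n, (~` A n) w]).
  by apply: meventC; apply: mevent_exists => n; exact: meventC.
apply/seteqP; split => w /= H; first by move=> [n]; apply.
by move=> n; apply: contrapT => An; apply: H; exists n.
Qed.

Lemma mevent_prop G (Q : Prop) : mevent G [set _ | Q].
Proof.
have [q|q] := pselect Q.
  by rewrite (_ : [set _ | Q] = setT); [exact: meventT|apply/seteqP; split].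
by rewrite (_ : [set _ | Q] = set0); [exact: mevent0|apply/seteqP; split].
Qed.

Lemma mevent_sub G G' A : G `<=` G' -> mevent G A -> mevent G' A.
Proof. by move=> GG'; exact: sub_sigma_algebra2. Qed.

Lemma mevent_measurable G A : G `<=` @measurable _ Omega -> mevent G A -> measurable A.
Proof.
move=> /sub_sigma_algebra2 GG' /GG'.
by rewrite sigma_algebra_id//; exact: sigma_algebra_measurable.
Qed.

Lemma mreal_sub G G' f : G `<=` G' -> mreal G f -> mreal G' f.
Proof. by move=> GG' mf _ B mB; apply: (mevent_sub GG'); exact: mf. Qed.

Lemma mreal_measurable G f : G `<=` @measurable _ Omega -> mreal G f ->
  measurable_fun setT f.
Proof.
move=> GG' mf _ B mB; apply: (@mevent_measurable G) => //.
by have := mf (@measurableT _ (g_sigma_algebraType G)) B mB.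
Qed.

Lemma mreal_cst G c : mreal G (fun=> c).
Proof. exact: measurable_cst. Qed.

Lemma mrealD G f g : mreal G f -> mreal G g -> mreal G (fun w => f w + g w).
Proof. exact: measurable_funD. Qed.

Lemma mrealN G f : mreal G f -> mreal G (fun w => - f w).
Proof. exact: measurable_funN. Qed.

Lemma mrealB G f g : mreal G f -> mreal G g -> mreal G (fun w => f w - g w).
Proof. exact: measurable_funB. Qed.

Lemma mrealM G f g : mreal G f -> mreal G g -> mreal G (fun w => f w * g w).
Proof. exact: measurable_funM. Qed.

Lemma mreal_sum G I (s : seq I) (f : I -> Omega -> R) :
  (forall i, mreal G (f i)) -> mreal G (fun w => \sum_(i <- s) f i w).
Proof.
move=> mf; elim: s => [|i s IH].
  by under eq_fun do rewrite big_nil; exact: mreal_cst.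
by under eq_fun do rewrite big_cons; exact: mrealD.
Qed.

Lemma mreal_comp G f (h : R -> R) : measurable_fun setT h -> mreal G f ->
  mreal G (fun w => h (f w)).
Proof. by move=> mh mf; apply: (measurableT_comp mh). Qed.

Lemma mreal_norm G f : mreal G f -> mreal G (fun w => `|f w|).
Proof. by apply: mreal_comp; exact: normr_measurable. Qed.

Lemma mreal_max G f g : mreal G f -> mreal G g -> mreal G (fun w => Num.max (f w) (g w)).
Proof. exact: measurable_maxr. Qed.

Lemma measurable_invr : measurable_fun setT (fun x : R => x^-1).
Proof.
(* This identity also holds at 0, where the inverse is 0; exponential and logarithm are measurable
   on the whole line. *)
rewrite (_ : (fun x => x^-1) = (fun x : R => x * expR (- ln (x ^+ 2)))).
  apply: measurable_funM => //; apply: measurableT_comp => //.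
  by apply: measurable_funN; apply: (measurableT_comp (@measurable_ln R)).
apply/funext => x; have [->|x0] := eqVneq x 0; first by rewrite invr0 mul0r.
rewrite expRN lnK; last by rewrite posrE exprn_even_gt0.
by rewrite expr2 invfM mulrA divff// mul1r.
Qed.

Lemma mrealV G f : mreal G f -> mreal G (fun w => (f w)^-1).
Proof. by apply: mreal_comp; exact: measurable_invr. Qed.

Lemma mevent_lt G f g : mreal G f -> mreal G g -> mevent G [set w | f w < g w].
Proof.
move=> mf mg; have := measurable_fun_ltr mf mg.
move=> /(_ (@measurableT _ (g_sigma_algebraType G)) [set true]).
by rewrite setTI => /(_ _); apply.
Qed.

Lemma mevent_le G f g : mreal G f -> mreal G g -> mevent G [set w | f w <= g w].
Proof.
move=> mf mg; rewrite (_ : [set w | _] = ~` [set w | g w < f w]).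
  by apply: meventC; exact: mevent_lt.
by apply/seteqP; split => w /=; rewrite ltNge => H; [apply/negP; rewrite negbK|apply/negPn/negP].
Qed.

Lemma mevent_eq G f g : mreal G f -> mreal G g -> mevent G [set w | f w = g w].
Proof.
move=> mf mg; rewrite (_ : [set w | _] = [set w | f w <= g w] `&` [set w | g w <= f w]).
  by apply: meventI; exact: mevent_le.
apply/seteqP; split => w /=; first by move=> ->.
by move=> [h1 h2]; apply/eqP; rewrite eq_le h1.
Qed.

Lemma mreal_indic G A : mevent G A -> mreal G (\1_A).
Proof. by move=> mA; exact: (@measurable_indic _ (g_sigma_algebraType G)). Qed.

Lemma mnat_cst G n : mnat G (fun=> n).
Proof. by move=> m; exact: mevent_prop. Qed.

Lemma mreal_pick G (T : countType) (f : T -> Omega -> R) t :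
  (forall n, mreal G (f n)) -> (forall n, mevent G [set w | t w = n]) ->
  mreal G (fun w => f (t w) w).
Proof.
move=> mf mt _ B mB; rewrite setTI.
rewrite (_ : _ @^-1` B = [set w | exists n, ([set w | t w = n] `&` (f n @^-1` B)) w]).
  apply: mevent_exists => n; apply: meventI => //.
  by have := mf n (@measurableT _ (g_sigma_algebraType G)) B mB; rewrite setTI.
by apply/seteqP; split => w /=; [move=> Bw; exists (t w)|move=> [n [-> ]]].
Qed.

Lemma mevent_pick G (A : nat -> set Omega) t : (forall n, mevent G (A n)) -> mnat G t ->
  mevent G [set w | A (t w) w].
Proof.
move=> mA mt.
rewrite (_ : [set w | _] = [set w | exists n, ([set w | t w = n] `&` A n) w]).
  by apply: mevent_exists => n; apply: meventI.
by apply/seteqP; split => w /=; [move=> Bw; exists (t w)|move=> [n [-> ]]].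
Qed.

Lemma mnat_pick G (s : nat -> Omega -> nat) t : (forall n, mnat G (s n)) -> mnat G t ->
  mnat G (fun w => s (t w) w).
Proof. by move=> ms mt n; apply: (mevent_pick (A := fun k => [set w | s k w = n])) => // k; exact: ms. Qed.

(** Measurable selection: the least index at which an event occurs, and 0 where none does, is
    determined by countably many events of [G]. *)
Lemma mnat_first G (A : nat -> set Omega) : (forall n, mevent G (A n)) ->
  exists2 t, mnat G t & forall w, (exists n, A n w) -> A (t w) w.
Proof.
move=> mA.
pose t w := if pselect (exists n, `[< A n w >]) is left h then ex_minn h else 0%N.
have tA w : (exists n, A n w) -> A (t w) w /\ forall n, (n < t w)%N -> ~ A n w.
  move=> [n An]; rewrite /t; case: pselect => [h|[]]; last by exists n; exact/asboolP.
  case: ex_minnP => m /asboolP Am Hm; split => // k km Ak.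
  by have /asboolP/Hm := Ak; rewrite leqNgt km.
exists t; last by move=> w /tA[].
move=> n.
rewrite (_ : [set w | t w = n] =
   (A n `&` [set w | forall k, (~` (A k `&` [set _ | (k < n)%N])) w]) `|`
   ([set w | forall k, (~` A k) w] `&` [set _ | n = 0%N])).
  apply: meventU; apply: meventI => //; last exact: mevent_prop.
    by apply: mevent_forall => k; apply: meventC; apply: meventI => //; exact: mevent_prop.
  by apply: mevent_forall => k; apply: meventC.
apply/seteqP; split => w /=.
  have [ex <-|nex] := pselect (exists n, A n w).
    by have [h1 h2] := tA w ex; left; split => // k [Ak kt]; exact: h2 Ak.
  move=> tn; right; split; first by move=> k Ak; apply: nex; exists k.
  rewrite -tn /t; case: pselect => // h; exfalso; apply: nex.
  by case: h => m /asboolP; exists m.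
move=> [[An H]|[H ->]]; last first.
  rewrite /t; case: pselect => // h; exfalso.
  by case: h => m /asboolP; exact: H.
have [h1 h2] := tA w (ex_intro _ n An).
apply/eqP; rewrite eqn_leq; apply/andP; split.
  by rewrite leqNgt; apply/negP => /h2.
by rewrite leqNgt; apply/negP => tn; apply: (H (t w)).
Qed.

Lemma mreal_limsup G (f : nat -> Omega -> R) : (forall n, mreal G (f n)) ->
  mreal G (fun w => fine (limn_esup (EFin \o f^~ w))).
Proof.
move=> mf; have mL : measurable_fun [set: g_sigma_algebraType G]
    (fun w : g_sigma_algebraType G => limn_esup (fun n => (f n w)%:E)).
  by apply: measurable_fun_limn_esup => n; move/measurable_EFinP : (mf n); exact.
exact: (measurableT_comp (fine_measurable measurableT) mL).
Qed.

Lemma limsupE (u : nat -> R) (l : R) : u @ \oo --> l -> fine (limn_esup (EFin \o u)) = l.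
Proof.
move=> ul; suff /cvg_limn_einf_sup[_ ->] : (EFin \o u) @ \oo --> l%:E by [].
by apply/fine_cvgP; split; [exact: nearW|].
Qed.

Lemma mw_pick G n (X : nat -> Omega -> 'rV[R]_n) t :
  (forall k, measurable_wrt G (X k)) -> mnat G t -> measurable_wrt G (fun w => X (t w) w).
Proof. by move=> mX mt i; apply: (mreal_pick (f := fun k w => X k w ord0 i)) => // k; exact: mX. Qed.

Lemma mw_cst G n (x : 'rV[R]_n) : measurable_wrt G (fun=> x : 'rV[R]_n).
Proof. by move=> i; exact: mreal_cst. Qed.

Lemma mwD G n (X Y : Omega -> 'rV[R]_n) : measurable_wrt G X -> measurable_wrt G Y ->
  measurable_wrt G (fun w => X w + Y w).
Proof.
move=> mX mY i; rewrite (_ : (fun _ => _) = (fun w => X w ord0 i + Y w ord0 i)).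
  exact: mrealD (mX i) (mY i).
by apply/funext => w; rewrite mxE.
Qed.

Lemma mwZ G n a (X : Omega -> 'rV[R]_n) : mreal G a -> measurable_wrt G X ->
  measurable_wrt G (fun w => a w *: X w).
Proof.
move=> ma mX i; rewrite (_ : (fun _ => _) = (fun w => a w * X w ord0 i)).
  exact: mrealM ma (mX i).
by apply/funext => w; rewrite mxE.
Qed.

Lemma mwN G n (X : Omega -> 'rV[R]_n) : measurable_wrt G X ->
  measurable_wrt G (fun w => - X w).
Proof.
move=> mX; rewrite (_ : (fun _ => _) = (fun w => (-1) *: X w)).
  by apply: mwZ => //; exact: mreal_cst.
by apply/funext => w; rewrite scaleN1r.
Qed.

Lemma mwB G n (X Y : Omega -> 'rV[R]_n) : measurable_wrt G X -> measurable_wrt G Y ->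
  measurable_wrt G (fun w => X w - Y w).
Proof. by move=> mX mY; apply: mwD => //; exact: mwN. Qed.

Lemma mw_sum G n I (s : seq I) (X : I -> Omega -> 'rV[R]_n) :
  (forall i, measurable_wrt G (X i)) -> measurable_wrt G (fun w => \sum_(i <- s) X i w).
Proof.
move=> mX; elim: s => [|i s IH].
  by under eq_fun do rewrite big_nil; exact: mw_cst.
by under eq_fun do rewrite big_cons; exact: mwD.
Qed.

Lemma mw_rsub G n1 n2 (X : Omega -> 'rV[R]_(n1 + n2)) : measurable_wrt G X ->
  measurable_wrt G (fun w => rsubmx (X w)).
Proof.
move=> mX i; rewrite (_ : (fun _ => _) = (fun w => X w ord0 (rshift n1 i))).
  exact: mX.
by apply/funext => w; rewrite mxE.
Qed.

Lemma mw_row0 G n1 n2 (X : Omega -> 'rV[R]_n1) : measurable_wrt G X ->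
  measurable_wrt G (fun w => row_mx (X w) 0 : 'rV[R]_(n1 + n2)).
Proof.
move=> mX i; case: (splitP i) => j ij.
  rewrite (_ : (fun _ => _) = (fun w => X w ord0 j)); first exact: mX.
  apply/funext => w; have -> : i = lshift n2 j by apply/val_inj.
  by rewrite row_mxEl.
rewrite (_ : (fun _ => _) = (fun=> 0)); first exact: mreal_cst.
apply/funext => w; have -> : i = rshift n1 j by apply/val_inj.
by rewrite row_mxEr mxE.
Qed.

Lemma mw_sub G G' n (X : Omega -> 'rV[R]_n) : G `<=` G' ->
  measurable_wrt G X -> measurable_wrt G' X.
Proof. by move=> GG' mX i; exact: (mreal_sub GG' (mX i)). Qed.

Lemma mw_indic G n A (X : Omega -> 'rV[R]_n) : mevent G A -> measurable_wrt G X ->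
  measurable_wrt G (fun w => \1_A w *: X w).
Proof. by move=> mA; apply: mwZ; exact: mreal_indic. Qed.

Lemma mevent_eq0 G n (X : Omega -> 'rV[R]_n) : measurable_wrt G X ->
  mevent G [set w | X w = 0].
Proof.
move=> mX; rewrite (_ : [set w | _] = [set w | forall i, X w ord0 i = 0]).
  apply: (mevent_forall (A := fun i => [set w | X w ord0 i = 0])) => i.
  by apply: mevent_eq; [exact: mX|exact: mreal_cst].
apply/seteqP; split => w /=; first by move=> -> i; rewrite mxE.
by move=> H; apply/rowP => i; rewrite mxE.
Qed.

Lemma mevent_orthant G n (X : Omega -> 'rV[R]_n) : measurable_wrt G X ->
  mevent G [set w | orthant (X w)].
Proof.
move=> mX; apply: (mevent_forall (A := fun i => [set w | 0 <= X w ord0 i])) => i.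
by apply: mevent_le; [exact: mreal_cst|exact: mX].
Qed.

(* The coordinates are made convergent one after the other, each time along the
   indices at which the current coordinate approaches its limit superior. *)
Lemma random_subseq_bounded G n (X : nat -> Omega -> 'rV[R]_n) (M : Omega -> R) :
  (forall k, measurable_wrt G (X k)) ->
  (forall w k i, `|X k w ord0 i| <= M w) ->
  exists t : nat -> Omega -> nat, exists Y, [/\ forall k, mnat G (t k),
    forall k w, (k <= t k w)%N, measurable_wrt G Y &
    forall w, vcvg (fun k => X (t k w) w) (Y w)].
Proof.
move=> mX XM.
suff : forall m, exists t : nat -> Omega -> nat, exists Y : Omega -> 'rV[R]_n,
  [/\ forall k, mnat G (t k), forall k w, (k <= t k w)%N, measurable_wrt G Y &
  forall w (i : 'I_n), (i < m)%N -> (fun k => X (t k w) w ord0 i) @ \oo --> Y w ord0 i].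
  move=> /(_ n)[t [Y [h1 h2 h3 h4]]]; exists t, Y; split => // w i.
  exact: h4.
elim=> [|m [t [Y [mt tk mY IH]]]].
  by exists (fun k=> fun=> k), (fun=> 0); split => // k; exact: mnat_cst.
have [mn|nm] := leqP n m.
  exists t, Y; split => // w i _; apply: IH; exact: leq_trans (ltn_ord i) mn.
pose i0 := Ordinal nm.
pose u k w := X (t k w) w ord0 i0.
have mu k : mreal G (u k) by exact: (mw_pick mX (mt k)).
pose l w := fine (limn_esup (EFin \o u^~ w)).
have ml : mreal G l by exact: mreal_limsup.
have /choice[s Hs] : forall k, exists s, mnat G s /\ forall w,
    (k <= s w)%N /\ `|u (s w) w - l w| < k.+1%:R^-1.
  move=> k; have [|s ms Hs] := @mnat_first G
    (fun n => [set w | (k <= n)%N] `&` [set w | `|u n w - l w| < k.+1%:R^-1]).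
    move=> p; apply: meventI; first exact: mevent_prop.
    by apply: mevent_lt; [apply: mreal_norm; exact: mrealB|exact: mreal_cst].
  exists s; split => // w; apply: (Hs w).
  have [||p kp Hp] := @limsup_cluster R (u^~ w) (M w) _ k.+1%:R^-1 _ k.
  - by move=> p; exact: XM.
  - by rewrite invr_gt0.
  by exists p.
have ks k w : (k <= s k w)%N by have [_ /(_ w)[]] := Hs k.
have ul w : (fun k => u (s k w) w) @ \oo --> l w.
  by apply: cvg_harmonic_bound => k; have [_ /(_ w)[]] := Hs k.
exists (fun k w => t (s k w) w).
exists (fun w => \row_i (if i == i0 then l w else Y w ord0 i)); split.
- by move=> k; apply: mnat_pick => //; have [] := Hs k.
- by move=> k w; exact: leq_trans (ks k w) (tk _ _).
- move=> i; under eq_fun do rewrite mxE.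
  by case: (i == i0); [exact: ml|exact: mY].
move=> w i im; rewrite mxE; case: eqP => [->|/eqP ii0]; first exact: ul.
have im' : (i < m)%N.
  by move: im; rewrite ltnS leq_eqVlt => /orP[/eqP im|//]; case/eqP: ii0; exact: val_inj.
exact: (@cvg_reindex _ _ _ (s^~ w) (ks^~ w) (IH w i im')).
Qed.

(** It is enough that the norms have a finite limit inferior: the least integer bound met infinitely
    often is measurable, and so are indices of terms below it, which reduces to the bounded case. *)
Lemma random_subseq G n (X : nat -> Omega -> 'rV[R]_n) :
  (forall k, measurable_wrt G (X k)) ->
  (forall w, exists M : nat, forall k, exists p, (k <= p)%N /\
     forall i, `|X p w ord0 i| <= M%:R) ->
  exists t : nat -> Omega -> nat, exists Y, [/\ forall k, mnat G (t k),
    forall k w, (k <= t k w)%N, measurable_wrt G Y &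
    forall w, vcvg (fun k => X (t k w) w) (Y w)].
Proof.
move=> mX XM.
have mB p M : mevent G [set w | forall i, `|X p w ord0 i| <= M].
  apply: (mevent_forall (A := fun i => [set w | `|X p w ord0 i| <= M])) => i.
  by apply: mevent_le; [apply: mreal_norm; exact: mX|exact: mreal_cst].
have mC (M : nat) : mevent G [set w | forall k : nat, exists p : nat,
    ([set _ | (k <= p)%N] `&` [set w | forall i, `|X p w ord0 i| <= M%:R]) w].
  apply: (mevent_forall (A := fun k => [set w | exists p : nat,
    ([set _ | (k <= p)%N] `&` [set w | forall i, `|X p w ord0 i| <= M%:R]) w])) => k.
  apply: (mevent_exists (A := fun p => [set _ | (k <= p)%N] `&`
    [set w | forall i, `|X p w ord0 i| <= M%:R])) => p.
  by apply: meventI; [exact: mevent_prop|exact: mB].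
have [M mM HM] := mnat_first mC.
have {}HM w := HM w (XM w).
have /choice[s Hs] : forall k, exists s, mnat G s /\ forall w,
    (k <= s w)%N /\ forall i, `|X (s w) w ord0 i| <= (M w)%:R.
  move=> k; have [|s ms Hs] := @mnat_first G
    (fun p => [set w | (k <= p)%N] `&` [set w | forall i, `|X p w ord0 i| <= (M w)%:R]).
    move=> p; apply: meventI; first exact: mevent_prop.
    exact: (mevent_pick (A := fun m => [set w | forall i, `|X p w ord0 i| <= m%:R])).
  exists s; split => // w; apply: (Hs w); have [p Hp] := HM w k; by exists p.
have [||t [Y [mt tk mY tY]]] := @random_subseq_bounded G n
  (fun k w => X (s k w) w) (fun w => (M w)%:R).
- by move=> k; apply: mw_pick => //; have [] := Hs k.
- by move=> w k i; have [_ /(_ w)[]] := Hs k.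
exists (fun k w => s (t k w) w), Y; split => //.
  by move=> k; apply: mnat_pick => // j; have [] := Hs j.
move=> k w; apply: leq_trans (tk k w) _.
by have [_ /(_ w)[]] := Hs (t k w).
Qed.

End measurability.

(** * Cones and returns of the market *)

Section dense.
Context {R : realType}.

Lemma dense_orthant n : exists D : nat -> 'rV[R]_n, (forall m, orthant (D m)) /\
  forall x, orthant x -> forall e, 0 < e -> exists m, forall i, `|D m ord0 i - x ord0 i| < e.
Proof.
(* Rational vectors enumerated through [pickle]; absolute values keep all of them in the orthant. *)
exists (fun m => \row_i (if unpickle m is Some a then `|ratr ((a : {ffun 'I_n -> rat}) i)| else 0)).
split=> [m i|x xo e e0]; first by rewrite mxE; case: unpickle.
have /choice[q Hq] : forall i, exists q : rat, x ord0 i < ratr q < x ord0 i + e.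
  move=> i; have [|q] := @rat_in_itvoo R (x ord0 i) (x ord0 i + e).
    by rewrite ltrDl.
  by rewrite in_itv/= => Hq; exists q.
exists (pickle [ffun i => q i]) => i; rewrite mxE pickleK ffunE.
have /andP[h1 h2] := Hq i; have := xo i => xi.
rewrite (ger0_norm (x := ratr _)); last by rewrite ltW// (le_lt_trans xi).
by rewrite ger0_norm; lra.
Qed.

Lemma dense_orthant_cvg n (D : nat -> 'rV[R]_n) (x : 'rV[R]_n) :
  (forall e, 0 < e -> exists m, forall i, `|D m ord0 i - x ord0 i| < e) ->
  exists s : nat -> nat, vcvg (fun k => D (s k)) x.
Proof.
move=> HD; have /choice[s Hs] : forall k, exists m, forall i,
    `|D m ord0 i - x ord0 i| < k.+1%:R^-1.
  by move=> k; apply: HD; rewrite invr_gt0.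
by exists s => i; apply: cvg_harmonic_bound => k; exact: Hs.
Qed.

Lemma rat_cvg (x : R) : exists q : nat -> rat, (fun k => ratr (q k) : R) @ \oo --> x.
Proof.
have /choice[q Hq] : forall k : nat, exists q : rat, `|ratr q - x| < k.+1%:R^-1.
  move=> k; have [|q] := @rat_in_itvoo R x (x + k.+1%:R^-1).
    by rewrite ltrDl invr_gt0.
  rewrite in_itv/= => /andP[h1 h2]; exists q.
  by rewrite ger0_norm ?subr_ge0 ?ltW// ltrBlDl.
by exists q; exact: cvg_harmonic_bound.
Qed.

Lemma vcvg_lsum n m (c : nat -> nat -> R) (d : nat -> R) (X : nat -> 'rV[R]_n) :
  (forall k, c^~ k @ \oo --> d k) ->
  vcvg (fun j => \sum_(k < m) c j k *: X k) (\sum_(k < m) d k *: X k).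
Proof.
move=> cd; elim: m => [|m IH].
  by under eq_fun do rewrite big_ord0; rewrite big_ord0; exact: vcvg_cst.
rewrite big_ord_recr; under eq_fun do rewrite big_ord_recr /=.
by apply: vcvgD => //; apply: vcvgZ => //; exact: vcvg_cst.
Qed.

End dense.

(** * Measurability and concavity of the market data *)

Section market_facts.
Context {R : realType} {disp : measure_display} {Omega : measurableType disp}.
Variables (P : probability Omega R) (T dF dI : nat).
Variable F : nat -> set (set Omega).
Local Notation vec := 'rV[R]_(dF + dI).

Lemma ae_count (C : countType) (Q : C -> Omega -> Prop) :
  (forall c, \forall w \ae P, Q c w) -> \forall w \ae P, forall c, Q c w.
Proof.
move=> HQ; have : \forall w \ae P, forall n : nat,
    if unpickle n is Some c then Q c w else True.
  by apply: ae_foralln => n; case: unpickle => // ; apply: aeW.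
by apply: filterS => w H c; have := H (pickle c); rewrite pickleK.
Qed.

Lemma ae_and (A B : Omega -> Prop) : (\forall w \ae P, A w) -> (\forall w \ae P, B w) ->
  \forall w \ae P, A w /\ B w.
Proof. by apply: filterS2. Qed.

Lemma cone_process_closed (K : nat -> Omega -> set vec) : cone_process P T F K ->
  forall t, (t <= T)%N -> \forall w \ae P, closed_cone (K t w).
Proof.
move=> [X mX HX] t tT; apply: filterS (HX t tT) => w [h1 h2 -> h4].
exact: cone_gen_closed_cone.
Qed.

(** Being closed, the cone contains a point exactly when nonnegative rational combinations of the
    generators approach it, which involves countably many events. [K] is given by its generators
    only almost surely, hence an event equal to membership up to a null set. *)
Lemma cone_process_measurable (K : nat -> Omega -> set vec) : cone_process P T F K ->
  forall t, (t <= T)%N -> forall V : Omega -> vec, measurable_wrt (F t) V ->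
  exists2 B : set Omega, mevent (F t) B & \forall w \ae P, B w <-> K t w (V w).
Proof.
move=> cpK t tT V mV; have := cone_process_closed cpK tT.
case: cpK => X mX HX cK.
pose S (a : seq rat) w : vec := \sum_(k < size a) `|ratr (nth 0 a k)| *: X k t w.
pose near_S (j : nat) a := [set w | forall i, `|S a w ord0 i - V w ord0 i| < j.+1%:R^-1].
have mS j a : mevent (F t) (near_S j a).
  apply: (mevent_forall (A := fun i => [set w | `|S a w ord0 i - V w ord0 i| < j.+1%:R^-1])) => i.
  apply: mevent_lt; last exact: mreal_cst.
  apply: mreal_norm; apply: mrealB; last exact: mV.
  suff : measurable_wrt (F t) (S a) by exact.
  apply: mw_sum => k; apply: mwZ; first exact: mreal_cst.
  by have [] := mX k t tT.
exists [set w | forall j, exists a, near_S j a w].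
  apply: (mevent_forall (A := fun j => [set w | exists a, near_S j a w])) => j.
  exact: mevent_exists.
apply: filterS2 cK (HX t tT) => w cK [fX _ KE _]; split => [/choice[a Ha]|].
  apply: (cc_closed cK (x := fun j => S (a j) w)).
    by move=> j; rewrite KE; exists (size (a j)), (fun k => `|ratr (nth 0 (a j) k)|).
  by move=> i; apply: cvg_harmonic_bound => j; exact: Ha.
rewrite KE => -[m [c [c0 VE]]] j.
have /choice[q Hq] := fun k => rat_cvg (c k).
have Hq' k : (fun j => `|ratr (q k j)| : R) @ \oo --> c k.
  by rewrite -(ger0_norm (c0 k)); apply: cvg_norm.
have := @vcvg_lsum R _ m (fun j k => `|ratr (q k j)|) c (fun k => X k t w) Hq'.
rewrite -VE => cv.
have [p Hp] : exists p, forall i, `|(\sum_(k < m) `|ratr (q k p)| *: X k t w) ord0 i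
    - V w ord0 i| < j.+1%:R^-1.
  have : \forall p \near \oo, forall i, `|V w ord0 i - (\sum_(k < m) `|ratr (q k p)| *: X k t w) ord0 i| < j.+1%:R^-1.
    apply: filter_forall => i; have /cvgrPdist_lt := cv i; apply.
    by rewrite invr_gt0.
  by move=> [p _ Hp]; exists p => i; rewrite distrC; apply: Hp => /=.
exists [seq q k p | k <- iota 0 m] => i.
rewrite /S size_map size_iota; have := Hp i.
congr (`| fun_of_matrix _ _ _ - _| < _); apply: eq_bigr => k _.
by rewrite (nth_map 0%N) ?size_iota// nth_iota.
Qed.

(** The random point is approached by elements of a countable dense set chosen measurably, where
    [Rp] is measurable by definition. The limit superior is measurable everywhere and equals the
    value wherever [Rp t w] is continuous and the point lies in the orthant. *)
Lemma continuous_superposable (Rp : nat -> Omega -> 'rV[R]_dI -> vec) :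
  return_process T F Rp -> R1 P T Rp -> superposable P T F Rp.
Proof.
move=> rR r1 t tT alpha [ma oa].
have [D [Do Dd]] := @dense_orthant R dI.
have /choice[s Hs] : forall j : nat, exists s, mnat (F t) s /\ forall w,
    orthant (alpha w) -> forall i, `|D (s w) ord0 i - alpha w ord0 i| < j.+1%:R^-1.
  move=> j; have [|s ms Hs] := @mnat_first _ _ (F t)
      (fun m => [set w | forall i, `|D m ord0 i - alpha w ord0 i| < j.+1%:R^-1]).
    move=> m; apply: (mevent_forall (A := fun i =>
      [set w | `|D m ord0 i - alpha w ord0 i| < j.+1%:R^-1])) => i.
    apply: mevent_lt; last exact: mreal_cst.
    by apply: mreal_norm; apply: mrealB; [exact: mreal_cst|exact: ma].
  by exists s; split => // w aw; apply: Hs; apply: Dd => //; rewrite invr_gt0.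
pose f j w := Rp t w (D (s j w)).
have mf j : measurable_wrt (F t) (f j).
  apply: (mw_pick (X := fun m w => Rp t w (D m))); last by have [] := Hs j.
  by move=> m; have [] := rR t tT (D m) (Do m).
exists (fun w => \row_i fine (limn_esup (EFin \o (fun j => f j w ord0 i)))).
  split; last exact: aeW.
  move=> i; under eq_fun do rewrite mxE.
  by apply: (mreal_limsup (f := fun j w => f j w ord0 i)) => j; exact: mf.
apply: filterS2 oa (r1 t tT) => w oa [_ cR].
apply/rowP => i; rewrite mxE; apply/esym/limsupE.
apply: (continuous_orthant_seq cR) => //.
by move=> k; apply: cvg_harmonic_bound => j; have [_ /(_ w oa)] := Hs j.
Qed.

Definition concave_wrt (C : set vec) (f : 'rV[R]_dI -> vec) : Prop :=
  forall l x y, 0 <= l <= 1 -> orthant x -> orthant y ->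
  ucone C (f (l *: x + (1 - l) *: y) - (l *: f x + (1 - l) *: f y)).

Lemma orthant_conv n (l : R) (x y : 'rV[R]_n) : 0 <= l <= 1 -> orthant x -> orthant y ->
  orthant (l *: x + (1 - l) *: y).
Proof.
move=> /andP[l0 l1] xo yo i; rewrite !mxE.
by rewrite addr_ge0// mulr_ge0 ?subr_ge0.
Qed.

(* (R2) is only required for deterministic weights: it extends to all weights
   and points at once, off a single null set, by density. *)
Lemma R2_pointwise (K : nat -> Omega -> set vec) (Rp : nat -> Omega -> 'rV[R]_dI -> vec) :
  cone_process P T F K -> R1 P T Rp -> R2 P T F K Rp ->
  forall t, (t <= T)%N -> \forall w \ae P, concave_wrt (K t w) (Rp t w).
Proof.
move=> cpK r1 r2 t tT.
have [D [Do Dd]] := @dense_orthant R dI.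
(* Clipping keeps the rational weights in the unit interval, where (R2) applies, without moving them
   away from [l]. *)
pose clip (q : rat) : R := Num.max 0 (Num.min 1 (ratr q)).
have clip01 q : 0 <= clip q <= 1.
  rewrite /clip le_max lexx /= ge_max ler01 /= ge_min lexx //.
have LD m : L0 P (F T) (fun _ => @orthant R dI) (fun=> D m).
  by split; [exact: mw_cst|apply: aeW => w; exact: Do].
have := ae_count (fun c : rat * nat * nat =>
  r2 t tT (clip c.1.1) _ _ (clip01 c.1.1) (LD c.1.2) (LD c.2)).
apply: filterS3 (cone_process_closed cpK tT) (r1 t tT) => w cK [_ cR] H l x y l01 xo yo.
have [a xa] := dense_orthant_cvg (Dd x xo).
have [b yb] := dense_orthant_cvg (Dd y yo).
have [q lq] := rat_cvg l.
have lc : (fun k => clip (q k)) @ \oo --> l.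
  apply/cvgrPdist_lt => e e0; move/cvgrPdist_lt : lq => /(_ e e0).
  apply: filterS => k; apply: le_lt_trans; rewrite /clip.
  have /andP[l0 l1] := l01; move: (ratr (q k)) => r.
  rewrite minEle; case: (leP 1 r) => h1; rewrite maxEle.
    by rewrite ler01 distrC [leRHS]distrC !ger0_norm; lra.
  case: (leP 0 r) => h2; first by rewrite lexx.
  by rewrite subr0 !ger0_norm; lra.
have lc1 : (fun k => 1 - clip (q k)) @ \oo --> 1 - l.
  by apply: cvgB => //; exact: cvg_cst.
apply: (ucone_closed cK (x := fun k =>
  Rp t w (clip (q k) *: D (a k) + (1 - clip (q k)) *: D (b k)) -
   (clip (q k) *: Rp t w (D (a k)) + (1 - clip (q k)) *: Rp t w (D (b k))))).
  by move=> k; have := H (q k, a k, b k); rewrite /= opprB.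
apply: vcvgB.
  apply: (continuous_orthant_seq cR).
    by move=> k; exact: orthant_conv.
  by apply: vcvgD; exact: vcvgZ.
by apply: vcvgD; apply: vcvgZ => //; exact: (continuous_orthant_seq cR).
Qed.

End market_facts.

(** * Attainable wealth *)

Section attainable.
Context {R : realType} {disp : measure_display} {Omega : measurableType disp}.
Context (P : probability Omega R) (T dF dI : nat) (F : nat -> set (set Omega)).
Context (hF : filtration P T F).
Local Notation vec := 'rV[R]_(dF + dI).
Implicit Types (K : nat -> Omega -> set vec) (Rp : nat -> Omega -> 'rV[R]_dI -> vec).
Implicit Types (y : Omega -> 'rV[R]_dI) (g h xi : Omega -> vec) (k s : nat).

(** No return is paid after [T]; the value 0 at [T.+1] spares the recursion a separate last date. *)
Definition ret Rp t w x : vec := if (t <= T)%N then Rp t w x else 0.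

(** One date of the recursion with its first trade kept visible: closedness manipulates the sequence
    of first trades. *)
Definition step K Rp (A : (Omega -> 'rV[R]_dI) -> (Omega -> vec) -> Prop) s y g xi :=
  [/\ measurable_wrt (F s) y, measurable_wrt (F s) xi,
      \forall w \ae P, K s w (- xi w),
      \forall w \ae P, orthant (y w + rsubmx (xi w))
    & A (fun w => y w + rsubmx (xi w))
        (fun w => g w - xi w - ret Rp s.+1 w (y w + rsubmx (xi w)))].

(* [att K Rp k s y g]: with [k] trading dates [s, ..., T] left and the industrial
   position [y], the wealth [g] can be reached exactly. *)
Fixpoint att K Rp k s y g : Prop :=
  if k is k'.+1 then exists xi, step K Rp (att K Rp k' s.+1) s y g xi
  else \forall w \ae P, g w = 0.

(** Wealth produced by reversible financial trades alone; these leave industrial positions, hence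
    returns, unchanged. *)
Fixpoint null K k s h : Prop :=
  if k is k'.+1 then exists z, [/\ measurable_wrt (F s) z,
     \forall w \ae P, ucone0 (K s w) (z w) & null K k' s.+1 (fun w => h w - z w)]
  else \forall w \ae P, h w = 0.

(** What the recursion requires of a market, common to the given one and to the dominating one,
    whose returns may be discontinuous. *)
Record regular_market K Rp : Prop := RegularMarket {
  rm_cone : forall t, (t <= T)%N -> \forall w \ae P, closed_cone (K t w);
  rm_meas : forall t, (t <= T)%N -> forall V : Omega -> vec, measurable_wrt (F t) V ->
    exists2 B : set Omega, mevent (F t) B & \forall w \ae P, B w <-> K t w (V w);
  rm_sup : superposable P T F Rp;
  rm_rsub : forall t, (t <= T)%N -> forall x, orthant x -> forall w,
    rsubmx (Rp t w x) = 0 }.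

Lemma cone_return_regular K Rp : cone_process P T F K -> return_process T F Rp ->
  superposable P T F Rp -> regular_market K Rp.
Proof.
move=> cK rR sR; split => //.
- exact: (cone_process_closed cK).
- exact: (cone_process_measurable cK).
- by move=> t tT x xo; have [] := rR t tT x xo.
Qed.

Lemma filtration_le s t : (s <= t)%N -> (t <= T)%N -> F s `<=` F t.
Proof. by case: hF => _ + _ _; apply. Qed.

Lemma mw_next s n (X : Omega -> 'rV[R]_n) : (s < T)%N ->
  measurable_wrt (F s) X -> measurable_wrt (F s.+1) X.
Proof. by move=> sT; apply: mw_sub; apply: filtration_le. Qed.

Lemma mreal_next s (f : Omega -> R) : (s < T)%N -> mreal (F s) f -> mreal (F s.+1) f.
Proof. by move=> sT; apply: mreal_sub; apply: filtration_le. Qed.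

Lemma next_lt k s : (k + s.+1 = T.+1)%N -> (0 < k)%N -> (s < T)%N.
Proof. by lia. Qed.

(** Side conditions [0 < k] recur below: with no trade left the date is [T.+1], at which nothing is
    known about [F]. *)
Lemma att_ae K Rp k s y y' g g' : (k + s = T.+1)%N ->
  ((0 < k)%N -> measurable_wrt (F s) y') ->
  (\forall w \ae P, y w = y' w) -> (\forall w \ae P, g w = g' w) ->
  att K Rp k s y g -> att K Rp k s y' g'.
Proof.
elim: k s y y' g g' => [|k IH] s y y' g g' ks my yy' gg' /=.
  by apply: filterS2 gg' => w ->.
move=> [xi [h1 h2 h3 h4 h5]]; exists xi; split => //; first exact: my.
  by apply: filterS2 yy' h4 => w ->.
move: h5; apply: IH.
- by rewrite -ks addnS addSn.
- move=> k0; have sT : (s < T)%N by apply: (@next_lt k) => //; lia.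
  by apply: mw_next => //; apply: mwD; [exact: my|exact: mw_rsub].
- by apply: filterS yy' => w ->.
- by apply: filterS2 yy' gg' => w -> ->.
Qed.

Section one_market.
Context K Rp (hm : regular_market K Rp).

Lemma ret_measurable t y : ((t <= T)%N -> measurable_wrt (F t) y) ->
  (\forall w \ae P, orthant (y w)) ->
  exists2 k : Omega -> vec, measurable_wrt (F t) k & \forall w \ae P, ret Rp t w (y w) = k w.
Proof.
move=> my oy; rewrite /ret; case: leqP => tT; last first.
  by exists (fun=> 0); [exact: mw_cst|exact: aeW].
have [|k [mk _] Hk] := @rm_sup _ _ hm t tT y; first by split => //; exact: my.
by exists k.
Qed.

(** The first trade [xi - d] disposes of [d] at once, and leaves the industrial position unchanged
    because [d] is financial. *)
Lemma att_sub k s y g (d : Omega -> vec) : (k + s = T.+1)%N ->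
  ((s <= T)%N -> exists2 c : Omega -> vec, measurable_wrt (F s) c &
     \forall w \ae P, d w = c w) ->
  ((s <= T)%N -> \forall w \ae P, ucone (K s w) (d w)) ->
  ((T < s)%N -> \forall w \ae P, d w = 0) ->
  att K Rp k s y g -> att K Rp k s y (fun w => g w - d w).
Proof.
case: k => [|k] ks md ud d0 /=.
  have /d0 : (T < s)%N by rewrite -ks.
  by apply: filterS2 => w -> ->; rewrite subr0.
have sT : (s <= T)%N by lia.
move=> [xi [h1 h2 h3 h4 h5]]; have [c mc dc] := md sT.
have rc : \forall w \ae P, rsubmx (xi w - c w) = rsubmx (xi w).
  by apply: filterS2 dc (ud sT) => w <- [_ /= d1]; rewrite linearB /= d1 subr0.
exists (fun w => xi w - c w); split => //.
- exact: mwB.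
- apply: filterS3 h3 (ud sT) (ae_and dc (rm_cone hm sT)) => w h3 [ud' _] [<- cK].
  by rewrite opprB addrC; exact: (ccD cK).
- by apply: filterS2 rc h4 => w ->.
apply: att_ae h5.
- by rewrite -ks addnS addSn.
- move=> k0; have sT' : (s < T)%N by apply: (@next_lt k) => //; lia.
  by apply: mw_next => //; apply: mwD => //; apply: mw_rsub; exact: mwB.
- by apply: filterS rc => w ->.
apply: filterS2 rc dc => w -> ->.
by apply/rowP => i; rewrite !mxE; ring.
Qed.

Lemma step_pick A s (y : nat -> Omega -> 'rV[R]_dI) (g xi : nat -> Omega -> vec) t :
  (forall n, step K Rp A s (y n) (g n) (xi n)) -> mnat (F s) t ->
  A (fun w => y (t w) w + rsubmx (xi (t w) w))
    (fun w => g (t w) w - xi (t w) w - ret Rp s.+1 w (y (t w) w + rsubmx (xi (t w) w))) ->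
  step K Rp A s (fun w => y (t w) w) (fun w => g (t w) w) (fun w => xi (t w) w).
Proof.
move=> H mt hA; split => //.
- by apply: mw_pick => // n; have [] := H n.
- by apply: mw_pick => // n; have [] := H n.
- have : \forall w \ae P, forall n, K s w (- xi n w) by apply: ae_foralln => n; have [] := H n.
  by apply: filterS => w; exact.
have : \forall w \ae P, forall n, orthant (y n w + rsubmx (xi n w)).
  by apply: ae_foralln => n; have [] := H n.
by apply: filterS => w; exact.
Qed.

(** Gluing works because every constraint is an almost sure one: it holds for countably many
    strategies off one null set. The selected first trades are measurable, and the selection remains
    measurable at later dates. *)
Lemma att_pick k s (y : nat -> Omega -> 'rV[R]_dI) (g : nat -> Omega -> vec) t :
  (k + s = T.+1)%N -> (forall n, att K Rp k s (y n) (g n)) ->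
  ((0 < k)%N -> mnat (F s) t) ->
  att K Rp k s (fun w => y (t w) w) (fun w => g (t w) w).
Proof.
elim: k s y g => [|k IH] s y g ks /= H mt.
  have : \forall w \ae P, forall n, g n w = 0 by exact: ae_foralln.
  by apply: filterS => w; exact.
have /choice[xi Hxi] := H.
exists (fun w => xi (t w) w); apply: step_pick => //; first exact: mt.
apply: (IH s.+1 (fun n w => y n w + rsubmx (xi n w))
  (fun n w => g n w - xi n w - ret Rp s.+1 w (y n w + rsubmx (xi n w)))).
- by rewrite -ks addnS addSn.
- by move=> n; have [] := Hxi n.
move=> k0; have sT : (s < T)%N by apply: (@next_lt k) => //; lia.
by move=> n; apply: mevent_sub (mt isT n); exact: filtration_le.
Qed.

(** The reversible trade [z] is merged into [xi]. Being financial, it changes no later return, so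
    that the remaining correction is again an addition of null trades. *)
Lemma step_null k s y g h z xi : (k.+1 + s = T.+1)%N ->
  (forall y g h, att K Rp k s.+1 y g -> null K k s.+1 h ->
     att K Rp k s.+1 y (fun w => g w + h w)) ->
  step K Rp (att K Rp k s.+1) s y g xi ->
  measurable_wrt (F s) z -> (\forall w \ae P, ucone0 (K s w) (z w)) ->
  null K k s.+1 (fun w => h w - z w) ->
  step K Rp (att K Rp k s.+1) s y (fun w => g w + h w) (fun w => xi w + z w).
Proof.
move=> ks IH [h1 h2 h3 h4 h5] mz uz nz.
have sT : (s <= T)%N by lia.
have rz : \forall w \ae P, rsubmx (xi w + z w) = rsubmx (xi w).
  by apply: filterS uz => w [[_ /= z0] _]; rewrite linearD /= z0 addr0.
split => //.
- exact: mwD.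
- apply: filterS3 h3 uz (rm_cone hm sT) => w h3 [_ [z1 _]] cK.
  by rewrite opprD; exact: (ccD cK).
- by apply: filterS2 rz h4 => w ->.
apply: att_ae (IH _ _ _ h5 nz).
- by rewrite -ks addnS addSn.
- move=> k0; have sT' : (s < T)%N by apply: (@next_lt k) => //; lia.
  by apply: mw_next => //; apply: mwD => //; apply: mw_rsub; exact: mwD.
- by apply: filterS rz => w ->.
by apply: filterS rz => w ->; apply/rowP => i; rewrite !mxE; ring.
Qed.

Lemma att_null k s y g h : (k + s = T.+1)%N ->
  att K Rp k s y g -> null K k s h -> att K Rp k s y (fun w => g w + h w).
Proof.
elim: k s y g h => [|k IH] s y g h ks /=.
  by apply: filterS2 => w -> ->; rewrite addr0.
move=> [xi Hxi] [z [mz uz nz]]; exists (fun w => xi w + z w).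
apply: step_null => // y' g' h'; apply: IH.
by rewrite -ks addnS addSn.
Qed.

Lemma ucone0Z (C : set vec) a x : closed_cone C -> ucone0 C x -> ucone0 C (a *: x).
Proof.
move=> cC [h1 h2]; have [a0|a0] := leP 0 a.
  by split; [exact: uconeZ|rewrite /= -scalerN; exact: uconeZ].
split; last by rewrite /= -scaleNr; apply: uconeZ => //; rewrite oppr_ge0 ltW.
by rewrite -[a]opprK scaleNr -scalerN; apply: uconeZ => //; rewrite oppr_ge0 ltW.
Qed.

(** Reversible trades form a vector space, so random multipliers of either sign are allowed. *)
Lemma nullZ k s h (b : Omega -> R) : (k + s = T.+1)%N -> ((0 < k)%N -> mreal (F s) b) ->
  null K k s h -> null K k s (fun w => b w *: h w).
Proof.
elim: k s h => [|k IH] s h ks mb /=.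
  by apply: filterS => w ->; rewrite scaler0.
move=> [z [mz uz nz]]; exists (fun w => b w *: z w); split.
- by apply: mwZ => //; exact: mb.
- have sT : (s <= T)%N by lia.
  by apply: filterS2 uz (rm_cone hm sT) => w uz cK; exact: ucone0Z.
have -> : (fun w => b w *: h w - b w *: z w) = (fun w => b w *: (h w - z w)).
  by apply/funext => w; rewrite scalerBr.
apply: IH nz; first by rewrite -ks addnS addSn.
move=> k0; apply: mreal_next; last exact: mb.
by apply: (@next_lt k) => //; lia.
Qed.

Section concave.
Context (hconc : forall t, (t <= T)%N -> \forall w \ae P, concave_wrt (K t w) (Rp t w)).
Context (hR0 : forall t, (t <= T)%N -> \forall w \ae P, Rp t w 0 = 0).

Lemma ret0 t : \forall w \ae P, ret Rp t w 0 = 0.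
Proof. by rewrite /ret; case: leqP => tT; [exact: hR0|exact: aeW]. Qed.

(** By concavity the mixed position earns at least the mixed returns, up to an element of the
    financial cone; this surplus is disposed of at the next date by [att_sub]. The weight may be
    random, provided that it is known at date [s]. *)
Lemma step_conv k s y1 g1 xi1 y2 g2 xi2 (l : Omega -> R) : (k.+1 + s = T.+1)%N ->
  (forall y1 g1 y2 g2, att K Rp k s.+1 y1 g1 -> att K Rp k s.+1 y2 g2 ->
    att K Rp k s.+1 (fun w => l w *: y1 w + (1 - l w) *: y2 w)
                    (fun w => l w *: g1 w + (1 - l w) *: g2 w)) ->
  mreal (F s) l -> (forall w, 0 <= l w <= 1) ->
  step K Rp (att K Rp k s.+1) s y1 g1 xi1 -> step K Rp (att K Rp k s.+1) s y2 g2 xi2 ->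
  step K Rp (att K Rp k s.+1) s (fun w => l w *: y1 w + (1 - l w) *: y2 w)
    (fun w => l w *: g1 w + (1 - l w) *: g2 w)
    (fun w => l w *: xi1 w + (1 - l w) *: xi2 w).
Proof.
move=> ks IH ml l01 [a1 a2 a3 a4 a5] [b1 b2 b3 b4 b5].
have sT : (s <= T)%N by lia.
have ml1 : mreal (F s) (fun w => 1 - l w) by apply: mrealB => //; exact: mreal_cst.
have mx n (X Y : Omega -> 'rV[R]_n) : measurable_wrt (F s) X -> measurable_wrt (F s) Y ->
    measurable_wrt (F s) (fun w => l w *: X w + (1 - l w) *: Y w).
  by move=> mX mY; apply: mwD; exact: mwZ.
pose z1 w := y1 w + rsubmx (xi1 w); pose z2 w := y2 w + rsubmx (xi2 w).
have zE w : l w *: y1 w + (1 - l w) *: y2 w + rsubmx (l w *: xi1 w + (1 - l w) *: xi2 w)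
    = l w *: z1 w + (1 - l w) *: z2 w.
  by rewrite /z1 /z2 linearD !linearZ /= !scalerDr addrACA.
have mz1 : measurable_wrt (F s) z1 by apply: mwD => //; exact: mw_rsub.
have mz2 : measurable_wrt (F s) z2 by apply: mwD => //; exact: mw_rsub.
have oz : \forall w \ae P, orthant (l w *: z1 w + (1 - l w) *: z2 w).
  by apply: filterS2 a4 b4 => w o1 o2; exact: orthant_conv.
split.
- exact: mx.
- exact: mx.
- apply: filterS3 a3 b3 (rm_cone hm sT) => w c1 c2 cK.
  have /andP[l0 l1] := l01 w.
  rewrite opprD -!scalerN; apply: (ccD cK); apply: (ccZ cK) => //.
  by rewrite subr_ge0.
- by apply: filterS oz => w; rewrite zE.
have nT : (s.+1 <= T)%N -> measurable_wrt (F s.+1) z1 /\ measurable_wrt (F s.+1) z2 /\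
    mreal (F s.+1) l /\ mreal (F s.+1) (fun w => 1 - l w).
  by move=> sT'; split; [|split]; [| |split];
    (try by apply: mw_next) ; try by apply: mreal_next.
have := @att_sub k s.+1 _ _ (fun w => ret Rp s.+1 w (l w *: z1 w + (1 - l w) *: z2 w) -
  (l w *: ret Rp s.+1 w (z1 w) + (1 - l w) *: ret Rp s.+1 w (z2 w))) _ _ _ _ (IH _ _ _ _ a5 b5).
have ks' : (k + s.+1 = T.+1)%N by rewrite -ks addnS addSn.
move=> /(_ ks').
move=> H; apply: att_ae (H _ _ _) => //.
- move=> k0; have sT' : (s < T)%N by apply: (@next_lt k).
  apply: mw_next => //; apply: mwD; first exact: mx.
  by apply: mw_rsub; exact: mx.
- by apply: aeW => w; rewrite zE.
- apply: aeW => w; rewrite zE /z1 /z2.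
  by apply/rowP => i; rewrite !mxE; ring.
- move=> sT'; have [m1 [m2 [m3 m4]]] := nT sT'.
  have [c1 mc1 E1] := ret_measurable (fun _ => m1) a4.
  have [c2 mc2 E2] := ret_measurable (fun _ => m2) b4.
  have [|c3 mc3 E3] := @ret_measurable s.+1 (fun w => l w *: z1 w + (1 - l w) *: z2 w) _ oz.
    by move=> _; apply: mwD; exact: mwZ.
  exists (fun w => c3 w - (l w *: c1 w + (1 - l w) *: c2 w)).
    by apply: mwB => //; apply: mwD; exact: mwZ.
  by apply: filterS3 E1 E2 E3 => w -> -> ->.
- move=> sT'; rewrite /ret sT'.
  by apply: filterS3 a4 b4 (hconc sT') => w o1 o2; apply.
move=> Ts; rewrite /ret leqNgt Ts /=; apply: aeW => w.
by rewrite !scaler0 addr0 subr0.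
Qed.

Lemma att_conv k s y1 g1 y2 g2 (l : Omega -> R) : (k + s = T.+1)%N ->
  ((0 < k)%N -> mreal (F s) l) -> (forall w, 0 <= l w <= 1) ->
  att K Rp k s y1 g1 -> att K Rp k s y2 g2 ->
  att K Rp k s (fun w => l w *: y1 w + (1 - l w) *: y2 w)
               (fun w => l w *: g1 w + (1 - l w) *: g2 w).
Proof.
elim: k s y1 g1 y2 g2 => [|k IH] s y1 g1 y2 g2 ks ml l01 /=.
  by apply: filterS2 => w -> ->; rewrite !scaler0 addr0.
move=> [xi1 H1] [xi2 H2]; exists (fun w => l w *: xi1 w + (1 - l w) *: xi2 w).
apply: step_conv => //; last exact: ml.
move=> *; apply: IH => //; first by rewrite -ks addnS addSn.
move=> k0; apply: mreal_next; last exact: ml.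
by apply: (@next_lt k) => //; lia.
Qed.

Lemma att0 k s : (k + s = T.+1)%N -> att K Rp k s (fun=> 0) (fun=> 0).
Proof.
elim: k s => [|k IH] s ks /=; first exact: aeW.
have sT : (s <= T)%N by lia.
exists (fun=> 0); split; [exact: mw_cst|exact: mw_cst| | |].
- by apply: filterS (rm_cone hm sT) => w cK; rewrite oppr0; exact: (cc0 cK).
- by apply: aeW => w; rewrite linear0 addr0 => i; rewrite mxE.
have ks' : (k + s.+1 = T.+1)%N by rewrite -ks addnS addSn.
apply: att_ae (IH _ ks') => //.
- by move=> k0; rewrite linear0 addr0; exact: mw_cst.
- by apply: aeW => w; rewrite linear0 addr0.
by apply: filterS (ret0 s.+1) => w E; rewrite !linear0 !addr0 E subr0.
Qed.

(** Mixing with the zero strategy, which earns nothing. *)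
Lemma step_scale k s y g xi (l : Omega -> R) : (k.+1 + s = T.+1)%N ->
  mreal (F s) l -> (forall w, 0 <= l w <= 1) ->
  step K Rp (att K Rp k s.+1) s y g xi ->
  step K Rp (att K Rp k s.+1) s (fun w => l w *: y w) (fun w => l w *: g w)
    (fun w => l w *: xi w).
Proof.
move=> ks ml l01 H.
have sT : (s <= T)%N by lia.
have ks' : (k + s.+1 = T.+1)%N by rewrite -ks addnS addSn.
have H0 : step K Rp (att K Rp k s.+1) s (fun=> 0) (fun=> 0) (fun=> 0).
  split; [exact: mw_cst|exact: mw_cst| | |].
  - by apply: filterS (rm_cone hm sT) => w cK; rewrite oppr0; exact: (cc0 cK).
  - by apply: aeW => w; rewrite linear0 addr0 => i; rewrite mxE.
  apply: att_ae (att0 ks') => //.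
  - by move=> k0; rewrite linear0 addr0; exact: mw_cst.
  - by apply: aeW => w; rewrite linear0 addr0.
  by apply: filterS (ret0 s.+1) => w E; rewrite !linear0 !addr0 E subr0.
have := @step_conv k s _ _ _ _ _ _ l ks _ ml l01 H H0.
under [X in step _ _ _ _ X _ _]eq_fun do rewrite scaler0 addr0.
under [X in step _ _ _ _ _ X _]eq_fun do rewrite scaler0 addr0.
under [X in step _ _ _ _ _ _ X]eq_fun do rewrite scaler0 addr0.
apply => *; apply: att_conv => //.
move=> k0; apply: mreal_next => //.
by apply: (@next_lt k) => //; lia.
Qed.

Lemma att_scale k s y g (l : Omega -> R) : (k + s = T.+1)%N ->
  ((0 < k)%N -> mreal (F s) l) -> (forall w, 0 <= l w <= 1) ->
  att K Rp k s y g -> att K Rp k s (fun w => l w *: y w) (fun w => l w *: g w).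
Proof.
move=> ks ml l01 H; have := att_conv ks ml l01 H (att0 ks).
under [X in att _ _ _ _ X _]eq_fun do rewrite scaler0 addr0.
by under [X in att _ _ _ _ _ X]eq_fun do rewrite scaler0 addr0.
Qed.

End concave.
End one_market.

End attainable.

(** * Trades without cost *)

Section no_arbitrage.
Context {R : realType} {disp : measure_display} {Omega : measurableType disp}.
Context (P : probability Omega R) (T dF dI : nat) (F : nat -> set (set Omega)).
Context (hF : filtration P T F).
Local Notation vec := 'rV[R]_(dF + dI).
Context (K K' : nat -> Omega -> set vec) (Rp R' : nat -> Omega -> 'rV[R]_dI -> vec).
Context (hm : regular_market P T F K Rp) (hm' : regular_market P T F K' R').
Context (hR0 : forall t, (t <= T)%N -> \forall w \ae P, Rp t w 0 = 0).
Context (hdom : dominates P T K' R' K Rp).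
Implicit Types (y : Omega -> 'rV[R]_dI) (g h xi : Omega -> vec) (k s : nat).

Lemma att_eq Kx Rx k s y g g' : (forall w, g w = g' w) ->
  att P T F Kx Rx k s y g -> att P T F Kx Rx k s y g'.
Proof. by move=> /funext ->. Qed.

Lemma dominated_gain t : (t <= T)%N -> \forall w \ae P,
  forall x, orthant x -> ucone (K t w) (R' t w x - Rp t w x).
Proof.
move=> tT; apply: filterS2 (hdom tT) (hR0 tT) => w [_ _ d1 d2] R0 x xo.
have [->|x0] := eqVneq x 0; first by rewrite R0 subr0.
by have [] := d2 x xo x0.
Qed.

Lemma dominated_cone t : (t <= T)%N -> \forall w \ae P, K t w `<=` K' t w.
Proof. by move=> tT; apply: filterS (hdom tT) => w []. Qed.

(** The excess of [R'] over [Rp] lies in the financial cone of [K], hence of [K'], and is disposed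
    of. *)
Lemma att_ret_gain k s y g : (k + s = T.+1)%N ->
  ((s <= T)%N -> measurable_wrt (F s) y) -> (\forall w \ae P, orthant (y w)) ->
  att P T F K' R' k s y (fun w => g w - ret T Rp s w (y w)) ->
  att P T F K' R' k s y (fun w => g w - ret T R' s w (y w)).
Proof.
move=> ks my oy H.
have -> : (fun w => g w - ret T R' s w (y w)) = (fun w =>
  (g w - ret T Rp s w (y w)) - (ret T R' s w (y w) - ret T Rp s w (y w))).
  by apply/funext => w; rewrite opprB addrA subrK.
apply: (att_sub hF hm') => //.
- move=> sT; have [c1 m1 E1] := ret_measurable hm' my oy.
  have [c2 m2 E2] := ret_measurable hm my oy.
  exists (fun w => c1 w - c2 w); first exact: mwB.
  by apply: filterS2 E1 E2 => w -> ->.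
- move=> sT; rewrite /ret sT.
  apply: filterS3 oy (dominated_gain sT) (dominated_cone sT) => w oy H1 H2.
  by have [h1 h2] := H1 _ oy; split => //; exact: H2.
by move=> Ts; rewrite /ret leqNgt Ts /=; apply: aeW => w; rewrite subr0.
Qed.

Lemma att_dominated k s y g : (k + s = T.+1)%N ->
  att P T F K Rp k s y g -> att P T F K' R' k s y g.
Proof.
elim: k s y g => [//|k IH] s y g ks /= [xi [h1 h2 h3 h4 h5]].
have sT : (s <= T)%N by lia.
exists xi; split => //.
  by apply: filterS2 h3 (dominated_cone sT) => w h3; apply.
apply: att_ret_gain => //.
- by rewrite -ks addnS addSn.
- by move=> sT'; apply: (mw_next hF) => //; apply: mwD => //; exact: mw_rsub.
by apply: IH => //; rewrite -ks addnS addSn.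
Qed.

Lemma att_financial_step k s g xi : (k.+1 + s = T.+1)%N -> measurable_wrt (F s) xi ->
  (\forall w \ae P, ucone (K' s w) (- xi w)) ->
  att P T F K' R' k s.+1 (fun=> 0) (fun w => g w - xi w) ->
  att P T F K' R' k.+1 s (fun=> 0) g.
Proof.
move=> ks mxi uxi H.
have r0 : \forall w \ae P, rsubmx (xi w) = 0.
  by apply: filterS uxi => w [_ /= /eqP]; rewrite linearN /= oppr_eq0 => /eqP.
exists xi; split => //.
- by apply: filterS uxi => w [].
- by apply: filterS r0 => w ->; rewrite addr0 => i; rewrite mxE.
have ks' : (k + s.+1 = T.+1)%N by rewrite -ks addnS addSn.
have o0 : \forall w \ae P, orthant (0 : 'rV[R]_dI) by apply: aeW => _ i; rewrite mxE.
have H2 : att P T F K' R' k s.+1 (fun=> 0) (fun w => g w - xi w - ret T R' s.+1 w 0).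
  apply: (@att_ret_gain k s.+1 (fun=> 0) (fun w => g w - xi w)) => //.
    by move=> _; exact: mw_cst.
  apply: (att_ae hF) H => //; [by move=> _; exact: mw_cst|exact: aeW|].
  by apply: filterS (ret0 hR0 s.+1) => w ->; rewrite subr0.
apply: (att_ae hF) H2 => //.
- move=> k0; have sT' : (s < T)%N by apply: (@next_lt _ k).
  by apply: (mw_next hF) => //; apply: mwD; [exact: mw_cst|exact: mw_rsub].
- by apply: filterS r0 => w ->; rewrite addr0.
by apply: filterS r0 => w ->; rewrite addr0.
Qed.

Context (hNA : forall g, measurable_wrt (F T) g -> (\forall w \ae P, orthant (g w)) ->
  att P T F K' R' T.+1 0 (fun=> 0) g -> \forall w \ae P, g w = 0).
Context (hdF : (0 < dF)%N).

(* [h] is a financial position reached before date [s] at no cost. *)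
Definition costless k s h : Prop := forall g, measurable_wrt (F T) g ->
  (\forall w \ae P, orthant (g w)) ->
  att P T F K' R' k s (fun=> 0) (fun w => g w - h w) -> \forall w \ae P, g w = 0.

Lemma costless0 k s : (k + s = T.+1)%N -> costless k s (fun=> 0).
Proof.
elim: s k => [|s IH] k ks g mg og H.
  apply: hNA => //; rewrite addn0 in ks; rewrite -ks.
  by apply: att_eq H => w; rewrite subr0.
apply: (IH k.+1) => //; first by rewrite -ks addnS addSn.
apply: (@att_financial_step _ _ _ (fun=> 0)).
- by rewrite -ks addnS addSn.
- exact: mw_cst.
- have sT : (s <= T)%N by lia.
  by apply: filterS (rm_cone hm' sT) => w cK; rewrite oppr0; exact: ucone0_in.
by apply: att_eq H => w; rewrite !subr0.
Qed.

Lemma costless_next k s h xi : (k.+1 + s = T.+1)%N -> measurable_wrt (F s) xi ->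
  (\forall w \ae P, ucone0 (K s w) (xi w)) ->
  costless k.+1 s h -> costless k s.+1 (fun w => h w + xi w).
Proof.
move=> ks mxi uxi H g mg og Hg; apply: H => //.
apply: (@att_financial_step _ _ _ xi) => //.
  have sT : (s <= T)%N by lia.
  apply: filterS2 uxi (dominated_cone sT) => w [_ [h1 h2]] KK.
  by split => //; exact: KK.
by apply: att_eq Hg => w; rewrite opprD addrA.
Qed.

(** The unit of the spare gains that contradict no-arbitrage. *)
Definition bond : vec := row_mx (const_mx 1) 0.

Lemma bond_orthant : orthant bond.
Proof.
move=> i; rewrite /bond; case: (splitP i) => j ij.
  have -> : i = lshift dI j by apply/val_inj.
  by rewrite row_mxEl mxE.
have -> : i = rshift dF j by apply/val_inj.
by rewrite row_mxEr mxE.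
Qed.

Lemma bond_ucone (C : set vec) : closed_cone C -> ucone C bond.
Proof.
move=> cC; split; first exact: (cc_orthant cC) bond_orthant.
by rewrite /= row_mxKr.
Qed.

(** A gain granted on [B] only; if it can be attained at no cost, [bonus_eq0] makes [B] null. *)
Definition bonus (B : set Omega) j w : vec := (j.+1%:R^-1 * \1_B w) *: bond.

Lemma bonus_orthant B j w : orthant (bonus B j w).
Proof. by move=> i; rewrite mxE mulr_ge0 ?bond_orthant// mulr_ge0 ?invr_ge0. Qed.

Lemma bonus_measurable G B j : mevent G B -> measurable_wrt G (bonus B j).
Proof.
move=> mB; apply: mwZ; last exact: mw_cst.
by apply: mrealM; [exact: mreal_cst|exact: mreal_indic].
Qed.

Lemma bonus_rsub B j w : rsubmx (bonus B j w) = 0.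
Proof. by rewrite linearZ /= row_mxKr scaler0. Qed.

Lemma bonus_in (B : set Omega) j w : B w -> bonus B j w = j.+1%:R^-1 *: bond.
Proof. by move=> Bw; rewrite /bonus indicE mem_set// mulr1. Qed.

Lemma bonus_out (B : set Omega) j w : ~ B w -> bonus B j w = 0.
Proof. by move=> Bw; rewrite /bonus indicE memNset// mulr0 scale0r. Qed.

Lemma bonus_eq0 (B : set Omega) j :
  (\forall w \ae P, bonus B j w = 0) -> \forall w \ae P, ~ B w.
Proof.
apply: filterS => w + Bw; rewrite bonus_in// => /rowP/(_ (lshift dI (Ordinal hdF))).
rewrite mxE row_mxEl !mxE mulr1 => /eqP.
by rewrite invr_eq0 pnatr_eq0.
Qed.

(** Both conclusions come from an arbitrage of the dominating market. A nonzero industrial position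
    would leave, by (D2), part of the excess return to spare at the next date; an irreversible
    financial trade would lie, by (D1), in the relative interior of the dominating cone and leave
    something to spare at once. Each time a multiple of [bond] is the arbitrage. *)
Lemma costless_step k s h xi : (k.+1 + s = T.+1)%N -> costless k.+1 s h ->
  (\forall w \ae P, rsubmx (h w) = 0) ->
  step P T F K Rp (att P T F K Rp k s.+1) s (fun=> 0) (fun w => - h w) xi ->
  (\forall w \ae P, ucone0 (K s w) (xi w)) /\
  att P T F K Rp k s.+1 (fun=> 0) (fun w => - (h w + xi w)).
Proof.
move=> ks ch h0 [_ mxi Kxi oxi H].
have sT : (s <= T)%N by lia.
have ks' : (k + s.+1 = T.+1)%N by rewrite -ks addnS addSn.
have FT t : (t <= T)%N -> F t `<=` F T by move=> tT; exact: (filtration_le hF).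
pose y w := 0 + rsubmx (xi w).
have my' : measurable_wrt (F s) y by apply: mwD; [exact: mw_cst|exact: mw_rsub].
have my : (s.+1 <= T)%N -> measurable_wrt (F s.+1) y.
  by move=> sT'; exact: (mw_next hF).
have Hd : att P T F K' R' k s.+1 y (fun w => - h w - xi w - ret T Rp s.+1 w (y w)).
  exact: att_dominated.
(* First the industrial part of the trade vanishes. At the last date no return follows and the trade
   must equal [- h], which is financial. *)
have r0 : \forall w \ae P, rsubmx (xi w) = 0.
  have [sT'|Ts] := leqP s.+1 T; last first.
    move: H; have -> : k = 0%N by lia.
    rewrite /= /ret leqNgt Ts /=; apply: filterS2 h0 => w h0.
    rewrite subr0 => /eqP; rewrite subr_eq0 => /eqP <-.
    by rewrite linearN /= h0 oppr0.
  have [c1 m1 E1] := ret_measurable hm' my oxi.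
  have [c2 m2 E2] := ret_measurable hm my oxi.
  (* The size of the spare part depends on [w]; each [1 / (j + 1)] is excluded off its own null
     set. *)
  have key j : \forall w \ae P,
      ~ (K s.+1 w (c1 w - c2 w - j.+1%:R^-1 *: bond) /\ y w <> 0).
    have [|B0 mB0 HB0] := rm_meas hm sT' (V := fun w => c1 w - c2 w - j.+1%:R^-1 *: bond).
      by apply: mwB; [exact: mwB|exact: mw_cst].
    pose B := B0 `&` ~` [set w | y w = 0].
    have mB : mevent (F s.+1) B.
      by apply: meventI => //; apply: meventC; apply: mevent_eq0; exact: my.
    suff : \forall w \ae P, ~ B w.
      apply: filterS2 HB0 => w [_ HB0] nB [h1 h2]; apply: nB; split => //.
      exact: HB0.
    apply: (@bonus_eq0 B j); apply: ch.
    - by apply: bonus_measurable; apply: mevent_sub mB; exact: FT.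
    - by apply: aeW => w; exact: bonus_orthant.
    exists xi; split => //.
      by apply: filterS2 Kxi (dominated_cone sT) => w Kw; apply.
    (* Out of the excess return, all but the bonus on [B] is disposed of. *)
    apply: (@att_eq _ _ _ _ _ (fun w => (- h w - xi w - ret T Rp s.+1 w (y w)) -
      (ret T R' s.+1 w (y w) - ret T Rp s.+1 w (y w) - bonus B j w))).
      by move=> w; apply/rowP => i; rewrite !mxE; ring.
    apply: (att_sub hF hm') => //.
    - move=> _; exists (fun w => c1 w - c2 w - bonus B j w).
        by apply: mwB; [exact: mwB|exact: bonus_measurable].
      by apply: filterS2 E1 E2 => w -> ->.
    - move=> _.
      apply: filterS3 (ae_and E1 E2) (ae_and oxi HB0)
        (ae_and (dominated_gain sT') (dominated_cone sT')) => w [E1w E2w] [ow HBw] [gw cw].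
      have [g1 g2] := gw _ ow.
      have [Bw|Bw] := pselect (B w); last first.
        rewrite bonus_out// subr0 /ret sT'; split => //; exact: cw.
      rewrite bonus_in//; split; last first.
        by rewrite /= linearB /= linearZ /= row_mxKr scaler0 subr0 /ret sT'.
      by apply: cw; rewrite E1w E2w; apply/HBw; case: Bw.
    by move=> Ts; exfalso; lia.
  apply: filterS3 (ae_and E1 E2) (ae_and oxi (hdom sT'))
    (ae_and (rm_cone hm sT') (ae_foralln key)) => w [E1w E2w] [ow [_ _ _ d2]] [cK nk].
  apply/eqP; apply: contrapT => /negP y0.
  rewrite /y add0r in E1w E2w ow.
  have [j [Hj _]] := rel_int_shift (ucone0_in cK) (bond_ucone cK) (d2 _ ow y0).
  apply: (nk j); rewrite -E1w -E2w /ret sT' /y add0r; split => //.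
  exact/eqP.
have tail : att P T F K Rp k s.+1 (fun=> 0) (fun w => - (h w + xi w)).
  apply: (att_ae hF) H => //.
  - by move=> _; exact: mw_cst.
  - by apply: filterS r0 => w ->; rewrite addr0.
  apply: filterS2 r0 (ret0 hR0 s.+1) => w -> E.
  by rewrite addr0 E subr0 opprD.
split => //.
(* The trade is now known to be financial. Here the bonus is added to the trade itself, at date [s],
   as the cone of [K'] permits on [B]. *)
have key j : \forall w \ae P, ~ K' s w (- xi w - j.+1%:R^-1 *: bond).
  have [|B mB HB] := rm_meas hm' sT (V := fun w => - xi w - j.+1%:R^-1 *: bond).
    by apply: mwB; [exact: mwN|exact: mw_cst].
  suff : \forall w \ae P, ~ B w by apply: filterS2 HB => w [_ H2] nB /H2.
  apply: (@bonus_eq0 B j); apply: ch.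
  - by apply: bonus_measurable; apply: mevent_sub mB; exact: FT.
  - by apply: aeW => w; exact: bonus_orthant.
  have rb w : rsubmx (xi w + bonus B j w) = rsubmx (xi w).
    by rewrite linearD /= bonus_rsub addr0.
  have yb w : 0 + rsubmx (xi w + bonus B j w) = y w by rewrite rb.
  exists (fun w => xi w + bonus B j w); split => //.
  - by apply: mwD => //; exact: bonus_measurable.
  - apply: filterS3 HB Kxi (dominated_cone sT) => w HBw Kw KK.
    have [Bw|Bw] := pselect (B w); last by rewrite bonus_out// addr0; exact: KK.
    by rewrite bonus_in// opprD; exact/HBw.
  - by apply: filterS oxi => w; rewrite yb.
  have -> : (fun w => 0 + rsubmx (xi w + bonus B j w)) = y by apply/funext => w; exact: yb.
  apply: (@att_eq _ _ _ _ _ (fun w => (- h w - xi w) - ret T R' s.+1 w (y w))).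
    by move=> w; rewrite yb; apply/rowP => i; rewrite !mxE; ring.
  exact: att_ret_gain.
apply: filterS3 (ae_and Kxi r0) (ae_and (hdom sT) (rm_cone hm sT))
  (ae_and (rm_cone hm' sT) (ae_foralln key)) => w [Kw rw] [[d1 _ _ _] cK] [cK' nk].
have u1 : ucone (K s w) (- xi w) by split => //=; rewrite linearN /= rw oppr0.
suff Kxw : K s w (xi w) by split; [split|].
apply: contrapT => nKx.
have [|j [Hj _]] := rel_int_shift (ucone0_in cK') (bond_ucone cK') (d1 (- xi w) _).
  by split => // -[_ [/=]]; rewrite opprK.
exact: (nk j).
Qed.

(** The trades made so far are carried along in [h]: it stays financial and costless, so the same
    arbitrage argument applies at every later date. *)
Lemma costless_null k s h : (k + s = T.+1)%N -> costless k s h ->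
  (\forall w \ae P, rsubmx (h w) = 0) ->
  att P T F K Rp k s (fun=> 0) (fun w => - h w) -> null P F K k s (fun w => - h w).
Proof.
elim: k s h => [//|k IH] s h ks ch h0 [xi Hxi].
have [u tail] := costless_step ks ch h0 Hxi.
have [_ mxi _ _ _] := Hxi.
exists xi; split => //.
have -> : (fun w => - h w - xi w) = (fun w => - (h w + xi w)).
  by apply/funext => w; rewrite opprD.
apply: IH tail; first by rewrite -ks addnS addSn.
  exact: costless_next.
by apply: filterS2 h0 u => w h0 [[_ /= x0] _]; rewrite linearD /= h0 x0 addr0.
Qed.

Lemma null_step k s xi : (k.+1 + s = T.+1)%N ->
  step P T F K Rp (att P T F K Rp k s.+1) s (fun=> 0) (fun=> 0) xi ->
  (\forall w \ae P, ucone0 (K s w) (xi w)) /\ null P F K k s.+1 (fun w => 0 - xi w).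
Proof.
move=> ks H.
have H' : step P T F K Rp (att P T F K Rp k s.+1) s (fun=> 0) (fun=> - 0) xi by rewrite oppr0.
have r0 : \forall w \ae P, rsubmx (0 : vec) = 0 by apply: aeW => w; rewrite linear0.
have [u tail] := costless_step ks (costless0 ks) r0 H'.
have [_ mxi _ _ _] := H.
split => //.
have -> : (fun w => 0 - xi w) = (fun w => - (0 + xi w)).
  by apply/funext => w; rewrite sub0r add0r.
apply: costless_null tail; first by rewrite -ks addnS addSn.
  by apply: costless_next => //; exact: costless0.
by apply: filterS u => w [[_ /= x0] _]; rewrite add0r.
Qed.

End no_arbitrage.

(** * Closedness of the attainable sets *)

Section closedness.
Context {R : realType} {disp : measure_display} {Omega : measurableType disp}.
Context (P : probability Omega R) (T dF dI : nat) (F : nat -> set (set Omega)).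
Context (hF : filtration P T F).
Local Notation vec := 'rV[R]_(dF + dI).
Context (K : nat -> Omega -> set vec) (Rp : nat -> Omega -> 'rV[R]_dI -> vec).
Context (hm : regular_market P T F K Rp).
Context (hconc : forall t, (t <= T)%N -> \forall w \ae P, concave_wrt (K t w) (Rp t w)).
Context (hR0 : forall t, (t <= T)%N -> \forall w \ae P, Rp t w 0 = 0).
Context (hcont : forall t, (t <= T)%N -> \forall w \ae P, forall x l,
  (forall k, orthant (x k)) -> vcvg x l -> vcvg (fun k => Rp t w (x k)) (Rp t w l)).
Local Notation att := (att P T F K Rp).
Local Notation step k s := (step P T F K Rp (att k s.+1) s).
Context (hnull : forall k s xi, (k.+1 + s = T.+1)%N -> step k s (fun=> 0) (fun=> 0) xi ->
  (\forall w \ae P, ucone0 (K s w) (xi w)) /\ null P F K k s.+1 (fun w => 0 - xi w)).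
Implicit Types (y : Omega -> 'rV[R]_dI) (g h xi : Omega -> vec) (k s : nat).

(** Positions converge together with the wealth, because the induction over dates lets them vary. *)
Definition closed_at k s : Prop :=
  forall (y : nat -> Omega -> 'rV[R]_dI) (g : nat -> Omega -> vec) y0 g0,
  (forall n, att k s (y n) (g n)) -> ((0 < k)%N -> measurable_wrt (F s) y0) ->
  (\forall w \ae P, vcvg (y^~ w) (y0 w)) -> (\forall w \ae P, vcvg (g^~ w) (g0 w)) ->
  att k s y0 g0.

Lemma step_closed k s (y : nat -> Omega -> 'rV[R]_dI) (g xi : nat -> Omega -> vec) y0 g0 xi0 :
  (k.+1 + s = T.+1)%N -> closed_at k s.+1 ->
  (forall n, step k s (y n) (g n) (xi n)) ->
  measurable_wrt (F s) y0 -> measurable_wrt (F s) xi0 ->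
  (\forall w \ae P, vcvg (y^~ w) (y0 w)) -> (\forall w \ae P, vcvg (g^~ w) (g0 w)) ->
  (\forall w \ae P, vcvg (xi^~ w) (xi0 w)) -> step k s y0 g0 xi0.
Proof.
move=> ks IH H my mxi cy cg cxi.
have sT : (s <= T)%N by lia.
have HK : \forall w \ae P, forall n, K s w (- xi n w) by apply: ae_foralln => n; have [] := H n.
have Ho : \forall w \ae P, forall n, orthant (y n w + rsubmx (xi n w)).
  by apply: ae_foralln => n; have [] := H n.
have cz : \forall w \ae P,
    vcvg (fun n => y n w + rsubmx (xi n w)) (y0 w + rsubmx (xi0 w)).
  by apply: filterS2 cy cxi => w c1 c2; apply: vcvgD => //; exact: vcvg_rsub.
split => //.
- apply: filterS3 HK cxi (rm_cone hm sT) => w Kw c cK.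
  by apply: (cc_closed cK Kw); exact: vcvgN.
- by apply: filterS2 Ho cz => w ow; exact: orthant_seqclosed.
apply: (IH (fun n w => y n w + rsubmx (xi n w))
  (fun n w => g n w - xi n w - ret T Rp s.+1 w (y n w + rsubmx (xi n w)))) => //.
- by move=> n; have [] := H n.
- move=> k0; have sT' : (s < T)%N by apply: (@next_lt _ k) => //; lia.
  by apply: (mw_next hF) => //; apply: mwD => //; exact: mw_rsub.
have cr : \forall w \ae P, vcvg (fun n => ret T Rp s.+1 w (y n w + rsubmx (xi n w)))
    (ret T Rp s.+1 w (y0 w + rsubmx (xi0 w))).
  have [sT'|Ts] := leqP s.+1 T; last first.
    apply: aeW => w; rewrite /ret leqNgt Ts /=; exact: vcvg_cst.
  rewrite /ret sT'.
  by apply: filterS3 Ho cz (hcont sT') => w ow cw; exact.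
by apply: filterS3 cg cxi cr => w c1 c2 c3; apply: vcvgB => //; exact: vcvgB.
Qed.

Lemma indic01 (A : set Omega) w : 0 <= (\1_A w : R) <= 1.
Proof. by rewrite indicE; case: (w \in A); rewrite /= ?ler01 ?lexx. Qed.

Lemma indic_in (A : set Omega) w : A w -> \1_A w = 1 :> R.
Proof. by move=> Aw; rewrite indicE mem_set. Qed.

Lemma indic_out (A : set Omega) w : ~ A w -> \1_A w = 0 :> R.
Proof. by move=> Aw; rewrite indicE memNset. Qed.

(* On the event where the first trades stay bounded along a random subsequence
   the limit is obtained directly. *)
Lemma closed_bounded k s (y : nat -> Omega -> 'rV[R]_dI) (g xi : nat -> Omega -> vec) y0 g0 B :
  (k.+1 + s = T.+1)%N -> closed_at k s.+1 ->
  (forall n, step k s (y n) (g n) (xi n)) -> measurable_wrt (F s) y0 ->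
  (\forall w \ae P, vcvg (y^~ w) (y0 w)) -> (\forall w \ae P, vcvg (g^~ w) (g0 w)) ->
  mevent (F s) B ->
  (forall w, B w -> exists M : nat, forall p, exists n, (p <= n)%N /\
     forall i, `|xi n w ord0 i| <= M%:R) ->
  att k.+1 s (fun w => \1_B w *: y0 w) (fun w => \1_B w *: g0 w).
Proof.
move=> ks IH H my cy cg mB HB.
have m1B : mreal (F s) (\1_B : Omega -> R) by exact: mreal_indic.
have H1 n := step_scale hF hm hconc hR0 ks m1B (indic01 B) (H n).
have [||t [xi0 [mt tk mxi txi]]] := @random_subseq _ _ _ (F s) _ (fun n w => \1_B w *: xi n w).
- by move=> n; have [_ ? _ _ _] := H1 n.
- move=> w; have [Bw|Bw] := pselect (B w).
    have [M HM] := HB w Bw; exists M => p; have [n [pn Hn]] := HM p.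
    by exists n; split => // i; rewrite indic_in// scale1r.
  by exists 0%N => p; exists p; split => // i; rewrite indic_out// scale0r mxE normr0.
have H2 n : step k s (fun w => \1_B w *: y (t n w) w) (fun w => \1_B w *: g (t n w) w)
    (fun w => \1_B w *: xi (t n w) w).
  apply: (@step_pick _ _ _ P T _ _ F K Rp _ _ (fun n w => \1_B w *: y n w)
    (fun n w => \1_B w *: g n w) (fun n w => \1_B w *: xi n w)) => //.
  apply: (att_pick hF (y := fun n w => \1_B w *: y n w + rsubmx (\1_B w *: xi n w))
    (g := fun n w => \1_B w *: g n w - \1_B w *: xi n w -
       ret T Rp s.+1 w (\1_B w *: y n w + rsubmx (\1_B w *: xi n w)))).
  - by rewrite -ks addnS addSn.
  - by move=> j; have [] := H1 j.
  move=> k0 j; have sT' : (s < T)%N by apply: (@next_lt _ k) => //; lia.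
  by apply: mevent_sub (mt n j); exact: (filtration_le hF).
exists xi0; apply: (step_closed ks IH H2) => //.
- exact: mw_indic.
- apply: filterS cy => w c; apply: vcvgZ; first exact: cvg_cst.
  exact: (vcvg_reindex (tk^~ w) c).
- apply: filterS cg => w c; apply: vcvgZ; first exact: cvg_cst.
  exact: (vcvg_reindex (tk^~ w) c).
by apply: aeW => w; exact: txi.
Qed.

Definition norm1 (x : vec) : R := \sum_i `|x ord0 i|.

Lemma norm1_coord (x : vec) i : `|x ord0 i| <= norm1 x.
Proof. by rewrite /norm1 (bigD1 i)//= lerDl sumr_ge0. Qed.

Lemma norm1_ge0 (x : vec) : 0 <= norm1 x.
Proof. exact: sumr_ge0. Qed.

Lemma norm1Z a (x : vec) : norm1 (a *: x) = `|a| * norm1 x.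
Proof. by rewrite /norm1 mulr_sumr; apply: eq_bigr => i _; rewrite mxE normrM. Qed.

Lemma norm1_cvg (x : nat -> vec) l : vcvg x l -> (fun k => norm1 (x k)) @ \oo --> norm1 l.
Proof. by move=> xl; apply: cvg_sumr => i; apply: cvg_norm; exact: xl. Qed.

(* On the event where the first trades explode, their normalisations converge
   along a random subsequence to the first trade of a strategy with zero cost
   and zero gain. *)
Lemma explosion_direction k s (y : nat -> Omega -> 'rV[R]_dI) (g xi : nat -> Omega -> vec)
    y0 g0 (C : set Omega) (S : {set 'I_(dF + dI)}) :
  (k.+1 + s = T.+1)%N -> closed_at k s.+1 ->
  (forall n, step k s (y n) (g n) (xi n)) ->
  (\forall w \ae P, vcvg (y^~ w) (y0 w)) -> (\forall w \ae P, vcvg (g^~ w) (g0 w)) ->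
  (forall n w i, i \notin S -> xi n w ord0 i = 0) ->
  mevent (F s) C ->
  (forall w, C w -> forall M : nat, exists p, forall n, (p <= n)%N -> M%:R < norm1 (xi n w)) ->
  exists eta, [/\ step k s (fun=> 0) (fun=> 0) eta,
    forall w, C w -> eta w != 0 & forall w i, i \notin S -> eta w ord0 i = 0].
Proof.
move=> ks IH H cy cg xi0 mC HC.
(* The maximum with 1 keeps the weights [l] at most 1, so that scaling is allowed, and is the norm
   itself once the trades have exploded. *)
pose m n w : R := Num.max 1 (norm1 (xi n w)).
have m1 n w : 1 <= m n w by rewrite le_max lexx.
have m0 n w : 0 < m n w by rewrite (lt_le_trans _ (m1 n w)).
pose l n w : R := \1_C w * (m n w)^-1.
have mxi n : measurable_wrt (F s) (xi n) by have [] := H n.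
have ml n : mreal (F s) (l n).
  apply: mrealM; first exact: mreal_indic.
  apply: mrealV; apply: mreal_max; first exact: mreal_cst.
  apply: (@mreal_sum _ _ _ (F s) _ _ (fun i w => `|xi n w ord0 i|)) => i.
  by apply: mreal_norm; exact: mxi.
have l01 n w : 0 <= l n w <= 1.
  have /andP[i0 i1] := indic01 C w; apply/andP; split.
    by rewrite mulr_ge0// invr_ge0 ltW.
  by rewrite mulr_ile1// ?invr_ge0 ?invf_le1// ltW.
have H1 n := step_scale hF hm hconc hR0 ks (ml n) (l01 n) (H n).
have nm n w : norm1 (l n w *: xi n w) <= 1.
  rewrite norm1Z ger0_norm; last by have /andP[] := l01 n w.
  rewrite /l -mulrA mulr_ile1 ?mulr_ge0 ?norm1_ge0 ?invr_ge0 ?(ltW (m0 _ _))//.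
  by rewrite ler_pdivrMl// mulr1 le_max lexx orbT.
have [||t [eta [mt tk meta teta]]] := @random_subseq_bounded _ _ _ (F s) _
  (fun n w => l n w *: xi n w) (fun=> 1).
- by move=> n; have [_ ? _ _ _] := H1 n.
- by move=> w n i; exact: le_trans (norm1_coord _ _) (nm n w).
have l_out w n : ~ C w -> l n w = 0 by move=> Cw; rewrite /l indic_out// mul0r.
have mE w : C w -> forall M : nat, exists p, forall n, (p <= n)%N ->
    M%:R < m n w /\ m n w = norm1 (xi n w).
  move=> Cw M; have [p Hp] := HC w Cw (maxn 1 M); exists p => n pn.
  have h := Hp n pn; have h1 : 1 < norm1 (xi n w).
    by apply: le_lt_trans h; rewrite (_ : 1 = 1%:R)// ler_nat leq_maxl.
  rewrite /m (max_idPr (ltW h1)); split => //.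
  by apply: le_lt_trans h; rewrite ler_nat leq_maxr.
have lc w : (fun n => l n w) @ \oo --> (0 : R).
  have [Cw|Cw] := pselect (C w); last first.
    by under eq_fun do rewrite l_out//; exact: cvg_cst.
  have -> : (fun n => l n w) = (fun n => (m n w)^-1).
    by apply/funext => n; rewrite /l indic_in// mul1r.
  apply/gtr0_cvgV0; first by apply: nearW => n; exact: m0.
  apply/cvgryPgt => A; have [p Hp] := mE w Cw (Num.bound `|A|).
  exists p => // n /= pn; have [h _] := Hp n pn.
  apply: le_lt_trans h; rewrite (le_trans (ler_norm _))// ltW//.
  exact: archi_boundP (normr_ge0 _).
have H2 n : step k s (fun w => l (t n w) w *: y (t n w) w) (fun w => l (t n w) w *: g (t n w) w)
    (fun w => l (t n w) w *: xi (t n w) w).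
  apply: (@step_pick _ _ _ P T _ _ F K Rp _ _ (fun n w => l n w *: y n w)
    (fun n w => l n w *: g n w) (fun n w => l n w *: xi n w)) => //.
  apply: (att_pick hF (y := fun n w => l n w *: y n w + rsubmx (l n w *: xi n w))
    (g := fun n w => l n w *: g n w - l n w *: xi n w -
       ret T Rp s.+1 w (l n w *: y n w + rsubmx (l n w *: xi n w)))).
  - by rewrite -ks addnS addSn.
  - by move=> j; have [] := H1 j.
  move=> k0 j; have sT' : (s < T)%N by apply: (@next_lt _ k) => //; lia.
  by apply: mevent_sub (mt n j); exact: (filtration_le hF).
have lct w : (fun n => l (t n w) w) @ \oo --> (0 : R).
  exact: (cvg_reindex (tk^~ w) (lc w)).
exists eta; split.
- apply: (step_closed ks IH H2) => //.
  + apply: filterS cy => w c; rewrite -(scale0r (y0 w)); apply: vcvgZ => //.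
    exact: (vcvg_reindex (tk^~ w) c).
  + apply: filterS cg => w c; rewrite -(scale0r (g0 w)); apply: vcvgZ => //.
    exact: (vcvg_reindex (tk^~ w) c).
  by apply: aeW => w; exact: teta.
- move=> w Cw; apply/negP => /eqP eta0.
  have : norm1 (eta w) = 1; last first.
    rewrite eta0 /norm1 big1 => [|i _]; last by rewrite mxE normr0.
    by move/eqP; rewrite eq_sym oner_eq0.
  have cn := norm1_cvg (teta w).
  rewrite -(cvg_lim _ cn)//; apply: cvg_lim => //.
  have [p Hp] := mE w Cw 0%N.
  apply/cvgrPdist_lt => e e0; exists p => // n /= pn.
  have [_ h] := Hp (t n w) (leq_trans pn (tk n w)).
  have -> : norm1 (l (t n w) w *: xi (t n w) w) = 1.
    rewrite norm1Z /l indic_in// mul1r ger0_norm ?invr_ge0 ?(ltW (m0 _ _))//.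
    by rewrite -h mulVf// gt_eqF.
  by rewrite subrr normr0.
move=> w i iS.
have E : (fun n => (l (t n w) w *: xi (t n w) w) ord0 i) = (fun=> 0).
  by apply/funext => n; rewrite mxE xi0// mulr0.
have := teta w i; rewrite E => c.
by rewrite -(cvg_lim _ c)//; apply: cvg_lim => //; exact: cvg_cst.
Qed.

(** Inside the induction over dates runs an induction on the number of coordinates that the first
    trades use. Where these are bounded along a subsequence the limit is direct; elsewhere some
    coordinate of the limiting direction [eta] is nonzero, and adding multiples of [eta] with its
    null continuation, which alters neither positions nor final wealth, clears that coordinate.
    [att_pick] glues the events. *)
Lemma att_closed k s : (k + s = T.+1)%N -> closed_at k s.
Proof.
elim: k s => [|k IH] s ks y g y0 g0 H my cy cg.
  have H' : \forall w \ae P, forall n, g n w = 0 by exact: ae_foralln.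
  rewrite /=; apply: filterS2 H' cg => w H' c; apply: (vcvg_unique c).
  have -> : g^~ w = (fun=> 0) by apply/funext => n; exact: H'.
  exact: vcvg_cst.
have {}IH : closed_at k s.+1 by apply: IH; rewrite -ks addnS addSn.
have {}my := my isT.
have /choice[xi Hxi] := H.
suff main : forall m (S : {set 'I_(dF + dI)}), (#|S| < m)%N ->
  forall (y : nat -> Omega -> 'rV[R]_dI) (g xi : nat -> Omega -> vec) y0 g0,
  (forall n, step k s (y n) (g n) (xi n)) -> measurable_wrt (F s) y0 ->
  (\forall w \ae P, vcvg (y^~ w) (y0 w)) -> (\forall w \ae P, vcvg (g^~ w) (g0 w)) ->
  (forall n w i, i \notin S -> xi n w ord0 i = 0) -> att k.+1 s y0 g0.
  by apply: (main _ [set: 'I_(dF + dI)]%SET (ltnSn _) y g xi) => // n w i; rewrite inE.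
move=> {y g y0 g0 H my cy cg xi Hxi}; elim=> [//|m IHm] S Sm y g xi y0 g0 H my cy cg xiS.
have mxi n : measurable_wrt (F s) (xi n) by have [] := H n.
pose A M p n := [set w | (p <= n)%N /\ norm1 (xi n w) <= M%:R].
have mA M p n : mevent (F s) (A M p n).
  apply: (@meventI _ _ _ [set w | (p <= n)%N] [set w | norm1 (xi n w) <= M%:R]).
    exact: mevent_prop.
  apply: mevent_le; last exact: mreal_cst.
  apply: (@mreal_sum _ _ _ (F s) _ _ (fun i w => `|xi n w ord0 i|)) => i.
  by apply: mreal_norm; exact: mxi.
pose B := [set w | exists M, forall p, exists n, A M p n w].
have mB : mevent (F s) B.
  apply: (mevent_exists (A := fun M => [set w | forall p, exists n, A M p n w])) => M.
  apply: (mevent_forall (A := fun p => [set w | exists n, A M p n w])) => p.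
  exact: mevent_exists.
have HB : att k.+1 s (fun w => \1_B w *: y0 w) (fun w => \1_B w *: g0 w).
  apply: (closed_bounded ks IH H) => // w [M HM]; exists M => p.
  have [n [pn Hn]] := HM p; exists n; split => // i.
  exact: le_trans (norm1_coord _ _) Hn.
have [||eta [Heta etaC etaS]] := @explosion_direction k s y g xi y0 g0 (~` B) S ks IH H cy cg xiS.
- exact: meventC.
- move=> w Bw M; apply: contrapT => nex; apply: Bw; exists M => p.
  apply: contrapT => nex2; apply: nex; exists p => n pn.
  by rewrite ltNge; apply/negP => h; apply: nex2; exists n.
have [u0 nl] := hnull ks Heta.
have meta : measurable_wrt (F s) eta by have [] := Heta.
pose Bi (i : 'I_(dF + dI)) := [set w | eta w ord0 i != 0].
have mBi i : mevent (F s) (Bi i).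
  have -> : Bi i = ~` [set w | eta w ord0 i = 0].
    by apply/seteqP; split => w /eqP.
  by apply: meventC; apply: mevent_eq; [exact: meta|exact: mreal_cst].
have Hi i : i \in S -> att k.+1 s (fun w => \1_(Bi i) w *: y0 w) (fun w => \1_(Bi i) w *: g0 w).
  move=> iS.
  (* This multiplier cancels coordinate [i] of the first trade wherever that of [eta] is nonzero;
     the coordinates outside [S] stay zero. *)
  pose b n w := - (xi n w ord0 i / eta w ord0 i).
  have mb n : mreal (F s) (b n).
    by apply: mrealN; apply: mrealM; [exact: mxi|apply: mrealV; exact: meta].
  have H1 n : step k s (y n) (fun w => g n w + 0) (fun w => xi n w + b n w *: eta w).
    apply: (step_null hF hm ks _ (H n)).
    - by move=> y' g' h'; apply: (att_null hF hm); rewrite -ks addnS addSn.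
    - exact: mwZ.
    - have sT : (s <= T)%N by lia.
      by apply: filterS2 u0 (rm_cone hm sT) => w u cK; exact: ucone0Z.
    have -> : (fun w => 0 - b n w *: eta w) = (fun w => b n w *: (0 - eta w)).
      by apply/funext => w; rewrite !sub0r scalerN.
    apply: (nullZ hF hm) nl; first by rewrite -ks addnS addSn.
    move=> k0; apply: (mreal_next hF) => //.
    by apply: (@next_lt _ k) => //; lia.
  have H2 n := step_scale hF hm hconc hR0 ks (mreal_indic (mBi i)) (indic01 (Bi i)) (H1 n).
  apply: (IHm (S :\ i) _ _ _ _ _ _ H2).
  - by have := cardsD1 i S; rewrite iS; lia.
  - exact: mw_indic.
  - by apply: filterS cy => w c; apply: vcvgZ => //; exact: cvg_cst.
  - apply: filterS cg => w c; apply: vcvgZ; first exact: cvg_cst.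
    by under eq_fun do rewrite addr0.
  move=> n w j; rewrite !inE negb_and negbK => /orP[/eqP ->|jS].
    rewrite !mxE; have [Bw|Bw] := pselect (Bi i w).
      by rewrite /b mulNr divfK ?subrr ?mulr0.
    by rewrite indic_out// mul0r.
  by rewrite !mxE xiS// etaS// mulr0 addr0 mulr0.
(* Indices below [dF + dI] stand for the coordinates, those outside [S] giving the empty event; all
   other indices stand for [B]. Together these events cover the space. *)
pose AA n : set Omega := if (insub n : option 'I_(dF + dI)) is Some i
  then (if i \in S then Bi i else set0) else B.
have mAA n : mevent (F s) (AA n).
  by rewrite /AA; case: insub => // i; case: ifP => // _; exact: mevent0.
have Hn n : att k.+1 s (fun w => \1_(AA n) w *: y0 w) (fun w => \1_(AA n) w *: g0 w).
  rewrite /AA; case: insub => [i|//]; case: ifP => iS; first exact: Hi.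
  have -> : (fun w => \1_(set0 : set Omega) w *: y0 w) = (fun=> 0).
    by apply/funext => w; rewrite indic_out// scale0r.
  have -> : (fun w => \1_(set0 : set Omega) w *: g0 w) = (fun=> 0).
    by apply/funext => w; rewrite indic_out// scale0r.
  exact: (att0 hF hm hR0).
have [t mt Ht] := mnat_first mAA.
have Aw w : AA (t w) w.
  apply: Ht; have [Bw|Bw] := pselect (B w).
    by exists (dF + dI)%N; rewrite /AA insubN// ltnn.
  have /eqP := etaC w Bw; move=> eta0.
  have [i Hi0] : exists i, eta w ord0 i != 0.
    apply: contrapT => nex; apply: eta0; apply/rowP => i; rewrite mxE.
    by apply/eqP; apply: contrapT => /negP h; apply: nex; exists i.
  have iS : i \in S by apply: contraT => /etaS E; move: Hi0; rewrite E eqxx.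
  by exists i; rewrite /AA valK iS.
have := @att_pick _ _ _ P T _ _ F hF K Rp k.+1 s _ _ t ks Hn (fun _ => mt).
have -> : (fun w => \1_(AA (t w)) w *: y0 w) = y0.
  by apply/funext => w; rewrite indic_in// scale1r.
by have -> : (fun w => \1_(AA (t w)) w *: g0 w) = g0
  by apply/funext => w; rewrite indic_in// scale1r.
Qed.

End closedness.

(** * Claims as the outcome of the backward recursion *)

Section claims_attainable.
Context {R : realType} {disp : measure_display} {Omega : measurableType disp}.
Context (P : probability Omega R) (T dF dI : nat) (F : nat -> set (set Omega)).
Context (hF : filtration P T F).
Local Notation vec := 'rV[R]_(dF + dI).
Implicit Types (K : nat -> Omega -> set vec) (Rp : nat -> Omega -> 'rV[R]_dI -> vec).
Implicit Types (y : Omega -> 'rV[R]_dI) (g h : Omega -> vec) (k s : nat) (x : vec).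

Lemma strategies_att K Rp x (xi : nat -> Omega -> vec) k s : (k + s = T.+1)%N ->
  strategies P T F x K xi ->
  att P T F K Rp k s (fun w => rsubmx x + \sum_(0 <= r < s) rsubmx (xi r w))
    (fun w => \sum_(s <= r < T.+1) xi r w +
       \sum_(s <= r < T.+1) ret T Rp r.+1 w (rsubmx x + invest xi r w)).
Proof.
move=> + [axi oxi]; elim: k s => [|k IH] s ks /=.
  by apply: aeW => w; rewrite !big_geq ?addr0// -ks.
have sT : (s <= T)%N by lia.
have [ms Ks] := axi s sT.
have yE w : rsubmx x + \sum_(0 <= r < s) rsubmx (xi r w) + rsubmx (xi s w) =
    rsubmx x + invest xi s w.
  by rewrite /invest -addrA -big_nat_recr// big_mkord.
exists (xi s); split => //.
- apply: mwD; first exact: mw_cst.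
  rewrite (_ : (fun _ => _) = (fun w => \sum_(r < s) rsubmx (xi r w))); last first.
    by apply/funext => w; rewrite big_mkord.
  apply: mw_sum => r; apply: mw_rsub.
  have [mr _] := axi r (ltnW (leq_trans (ltn_ord r) sT)).
  by apply: mw_sub mr; apply: (filtration_le hF) => //; exact: ltnW.
- by apply: filterS (oxi s sT) => w; rewrite yE addrC.
have ks' : (k + s.+1 = T.+1)%N by lia.
have := IH s.+1 ks'.
have -> : (fun w => rsubmx x + \sum_(0 <= r < s.+1) rsubmx (xi r w)) =
    (fun w => rsubmx x + \sum_(0 <= r < s) rsubmx (xi r w) + rsubmx (xi s w)).
  by apply/funext => w; rewrite big_nat_recr//= addrA.
apply: att_eq => w; rewrite yE.
have hs : (s < T.+1)%N by rewrite ltnS.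
rewrite !(big_ltn hs).
by apply/rowP => i; rewrite !mxE; ring.
Qed.

Lemma att_strategies K Rp k s y g : (k + s = T.+1)%N -> att P T F K Rp k s y g ->
  exists z : nat -> Omega -> vec, [/\
    forall t, (s <= t <= T)%N -> L0 P (F t) (fun w => [set v | K t w (- v)]) (z t),
    forall t, (s <= t <= T)%N ->
      \forall w \ae P, orthant (y w + \sum_(s <= r < t.+1) rsubmx (z r w)) &
    \forall w \ae P, g w = \sum_(s <= r < T.+1) z r w +
       \sum_(s <= r < T.+1) ret T Rp r.+1 w (y w + \sum_(s <= q < r.+1) rsubmx (z q w))].
Proof.
elim: k s y g => [|k IH] s y g ks /=.
  move=> g0; exists (fun=> fun=> 0); split.
  - by move=> t ?; exfalso; lia.
  - by move=> t ?; exfalso; lia.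
  by apply: filterS g0 => w ->; rewrite !big_geq ?addr0// -ks.
move=> [xi [my mxi Kxi oxi tl]].
have [|z [z1 z2 z3]] := IH s.+1 _ _ _ tl; first by rewrite -ks addnS addSn.
have sT : (s <= T)%N by lia.
pose zz r := if r == s then xi else z r.
have zs : zz s = xi by rewrite /zz eqxx.
have zr r : (s < r)%N -> zz r = z r by rewrite /zz; case: eqP => // ->; rewrite ltnn.
have sumE t w : (s <= t)%N -> y w + \sum_(s <= r < t.+1) rsubmx (zz r w) =
    y w + rsubmx (xi w) + \sum_(s.+1 <= r < t.+1) rsubmx (z r w).
  move=> st; rewrite big_ltn// zs addrA; congr (_ + _).
  by apply: eq_big_nat => r /andP[sr _]; rewrite zr.
exists zz; split.
- move=> t /andP[st tT]; have [st'|ts|ts] := ltngtP s t; last by subst t; rewrite zs.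
    by rewrite zr//; apply: z1; rewrite st'.
  by exfalso; lia.
- move=> t /andP[st tT]; have [st'|ts|ts] := ltngtP s t; last first.
  + subst t; apply: filterS oxi => w; rewrite sumE//.
    by rewrite big_geq// addr0.
  + by exfalso; lia.
  have := z2 t; rewrite st' tT => /(_ isT); apply: filterS => w.
  by rewrite sumE.
apply: filterS z3 => w E.
have hs : (s < T.+1)%N by rewrite ltnS.
rewrite !(big_ltn hs).
have -> : \sum_(s.+1 <= r < T.+1) zz r w = \sum_(s.+1 <= r < T.+1) z r w.
  by apply: eq_big_nat => r /andP[sr _]; rewrite zr.
have -> : \sum_(s.+1 <= r < T.+1) ret T Rp r.+1 w (y w + \sum_(s <= q < r.+1) rsubmx (zz q w)) =
  \sum_(s.+1 <= r < T.+1) ret T Rp r.+1 w (y w + rsubmx (xi w) +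
     \sum_(s.+1 <= q < r.+1) rsubmx (z q w)).
  by apply: eq_big_nat => r /andP[sr _]; rewrite sumE// ltnW.
rewrite sumE// (big_geq (leqnn s.+1)) addr0 zs.
move: E; set A := \sum_(_ <= _ < _) _; set B := \sum_(_ <= _ < _) _ => E.
have -> : g w = (g w - xi w - ret T Rp s.+1 w (y w + rsubmx (xi w))) + xi w +
    ret T Rp s.+1 w (y w + rsubmx (xi w)).
  by apply/rowP => i; rewrite !mxE; ring.
by rewrite E; apply/rowP => i; rewrite !mxE; ring.
Qed.

Lemma sum_ret Rp (v : nat -> 'rV[R]_dI) w :
  \sum_(0 <= r < T.+1) ret T Rp r.+1 w (v r) = \sum_(t < T) Rp t.+1 w (v t).
Proof.
rewrite big_nat_recr//= [X in _ + X]/ret ltnn addr0 big_mkord.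
by apply: eq_bigr => i _; rewrite /ret ltn_ord.
Qed.

(** The endowment enters twice: its industrial part as initial position, the whole of it as wealth
    that the trades do not have to provide. *)
Lemma claimsP K Rp x g : claims P T F x K Rp g <->
  measurable_wrt (F T) g /\
  att P T F K Rp T.+1 0 (fun=> rsubmx x) (fun w => g w - x).
Proof.
split=> [[mg [xi sxi gE]]|[mg /att_strategies]].
  split => //; apply: (att_ae hF) (strategies_att Rp (addn0 T.+1) sxi).
  - by rewrite addn0.
  - by move=> _; exact: mw_cst.
  - by apply: aeW => w; rewrite big_geq// addr0.
  apply: filterS gE => w ->.
  by rewrite (sum_ret Rp (fun r => rsubmx x + invest xi r w)) big_mkord -[x + _ + _]addrA [RHS]addrAC subrr add0r.
rewrite addn0 => /(_ erefl)[z [z1 z2 z3]]; split => //; exists z.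
  split => [t tT|t tT]; first exact: z1.
  by apply: filterS (z2 t tT) => w; rewrite /invest big_mkord addrC.
apply: filterS z3 => w E.
have -> : g w = x + (g w - x) by rewrite addrC subrK.
rewrite E (sum_ret Rp (fun r => rsubmx x + \sum_(0 <= q < r.+1) rsubmx (z q w))) big_mkord addrA.
by congr (_ + _); apply: eq_bigr => i _; rewrite /invest big_mkord.
Qed.

Lemma NA_att K Rp : NA P T F K Rp -> forall g, measurable_wrt (F T) g ->
  (\forall w \ae P, orthant (g w)) -> att P T F K Rp T.+1 0 (fun=> 0) g ->
  \forall w \ae P, g w = 0.
Proof.
move=> na g mg og H.
have : (claims P T F 0 K Rp `&` L0 P (F T) (fun _ => @orthant R (dF + dI))) g.
  split; last by split.
  apply/claimsP; split => //; rewrite linear0.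
  by apply: att_eq H => w; rewrite subr0.
by rewrite na => -[_].
Qed.

(** In contrast with [att_sub], [d] is known only at date [T] and is disposed of there; nonnegative
    vectors belong to the cone. *)
Lemma att_discard K Rp k s y g (d : Omega -> vec) : regular_market P T F K Rp ->
  (k.+1 + s = T.+1)%N -> measurable_wrt (F T) d ->
  (\forall w \ae P, orthant (d w) /\ rsubmx (d w) = 0) ->
  att P T F K Rp k.+1 s y g -> att P T F K Rp k.+1 s y (fun w => g w - d w).
Proof.
move=> hm; elim: k s y g => [|k IH] s y g ks md od.
  have sT : s = T by lia.
  apply: (att_sub hF hm) => //.
  - by move=> _; exists d; [rewrite sT|exact: aeW].
  - move=> sT'; apply: filterS2 od (rm_cone hm sT') => w [od rd] cK.
    by split => //; exact: (cc_orthant cK).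
  by move=> ?; exfalso; lia.
move=> [xi [h1 h2 h3 h4 h5]]; exists xi; split => //.
have ks' : (k.+1 + s.+1 = T.+1)%N by lia.
have := IH s.+1 _ _ ks' md od h5.
by apply: att_eq => w; rewrite addrAC; congr (_ - _); rewrite addrAC.
Qed.

End claims_attainable.

(** * Consumption sets *)

Section consumption_sets.
Context {R : realType} {disp : measure_display} {Omega : measurableType disp}.
Context (P : probability Omega R) (T dF dI : nat) (F : nat -> set (set Omega)).
Context (hF : filtration P T F).
Local Notation vec := 'rV[R]_(dF + dI).
Context (K : nat -> Omega -> set vec) (Rp : nat -> Omega -> 'rV[R]_dI -> vec).
Context (hK : cone_process P T F K) (hR : return_process T F Rp).
Context (hR1 : R1 P T Rp) (hR2 : R2 P T F K Rp) (hNA : NAr P T F K Rp) (hdF : (0 < dF)%N).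
Implicit Types (x : vec) (c : nat -> Omega -> 'rV[R]_dF).
Local Notation att := (att P T F K Rp).
Local Notation cons := (fun x => consumptions P T F x K Rp).

Lemma ae_notP (E : set Omega) : measurable E -> (\forall w \ae P, ~ E w) <-> P E = 0%E.
Proof.
move=> mE; split=> [[A [mA A0 EA]]|E0]; last first.
  by exists E; split => // w /= /contrapT.
apply/eqP; rewrite eq_le measure_ge0 andbT -A0 le_measure ?inE//.
by move=> w Ew; apply: EA => /= /(_ Ew).
Qed.

Let hm : regular_market P T F K Rp.
Proof. by apply: cone_return_regular => //; exact: continuous_superposable. Qed.

Let hconc : forall t, (t <= T)%N -> \forall w \ae P, concave_wrt (K t w) (Rp t w).
Proof. by move=> t tT; exact: (R2_pointwise hK hR1 hR2). Qed.

Let hR0 : forall t, (t <= T)%N -> \forall w \ae P, Rp t w 0 = 0.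
Proof. by move=> t tT; apply: filterS (hR1 tT) => w []. Qed.

Let hcont : forall t, (t <= T)%N -> \forall w \ae P,
  forall (x : nat -> 'rV[R]_dI) l, (forall k, orthant (x k)) -> vcvg x l -> vcvg (fun k => Rp t w (x k)) (Rp t w l).
Proof.
move=> t tT; apply: filterS (hR1 tT) => w [_ cR] x l; exact: continuous_orthant_seq.
Qed.

Lemma NAr_closed (y : nat -> Omega -> 'rV[R]_dI) (g : nat -> Omega -> vec) y0 g0 :
  (forall n, att T.+1 0 (y n) (g n)) -> measurable_wrt (F 0%N) y0 ->
  (\forall w \ae P, vcvg (y^~ w) (y0 w)) -> (\forall w \ae P, vcvg (g^~ w) (g0 w)) ->
  att T.+1 0 y0 g0.
Proof.
move=> H my cy cg.
have [K' [R' [cK' rR' sR' dom na]]] := hNA.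
have hm' : regular_market P T F K' R' by exact: cone_return_regular.
have nas := NA_att hF na.
apply: (@att_closed _ _ _ P T _ _ F hF K Rp hm hconc hR0 hcont _ T.+1 0%N _ y g) => //.
- move=> k s xi ks; exact: (null_step hF hm hm' hR0 dom nas hdF ks).
- by rewrite addn0.
Qed.

Lemma NAr_no_arbitrage (g : Omega -> vec) : measurable_wrt (F T) g ->
  (\forall w \ae P, orthant (g w)) -> att T.+1 0 (fun=> 0) g -> \forall w \ae P, g w = 0.
Proof.
move=> mg og H; have [K' [R' [cK' rR' sR' dom na]]] := hNA.
have hm' : regular_market P T F K' R' by exact: cone_return_regular.
apply: (NA_att hF na) => //.
by apply: (att_dominated hF hm hm' hR0 dom) H; rewrite addn0.
Qed.

Definition csum c w : vec := row_mx (\sum_(t < T.+1) c t w) 0.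

Lemma csum_measurable c : adaptedL0 P T F (fun _ _ => @orthant R dF) c ->
  measurable_wrt (F T) (csum c).
Proof.
move=> ac; apply: mw_row0; apply: mw_sum => t.
have tT : (t <= T)%N by rewrite -ltnS.
by have [mc _] := ac t tT; apply: mw_sub mc; exact: (filtration_le hF).
Qed.

Lemma consP x c : cons x c <-> adaptedL0 P T F (fun _ _ => @orthant R dF) c /\
  att T.+1 0 (fun=> rsubmx x) (fun w => csum c w - x).
Proof.
split=> [[ac /(claimsP hF)[_ H]]|[ac H]]; first by split.
by split => //; apply/(claimsP hF); split => //; exact: csum_measurable.
Qed.

Lemma csum_conv l c1 c2 w :
  csum (fun t w => l *: c1 t w + (1 - l) *: c2 t w) w = l *: csum c1 w + (1 - l) *: csum c2 w.
Proof.
rewrite /csum !scale_row_mx add_row_mx !scaler0 addr0; congr row_mx.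
by rewrite big_split /= -!scaler_sumr.
Qed.

Lemma adapted_conv l c1 c2 : 0 <= l <= 1 ->
  adaptedL0 P T F (fun _ _ => @orthant R dF) c1 ->
  adaptedL0 P T F (fun _ _ => @orthant R dF) c2 ->
  adaptedL0 P T F (fun _ _ => @orthant R dF) (fun t w => l *: c1 t w + (1 - l) *: c2 t w).
Proof.
move=> l01 a1 a2 t tT; have [m1 o1] := a1 t tT; have [m2 o2] := a2 t tT.
split; first by apply: mwD; apply: mwZ => //; exact: mreal_cst.
by apply: filterS2 o1 o2 => w; exact: orthant_conv.
Qed.

Lemma cons_conv l x1 x2 c1 c2 : 0 <= l <= 1 -> cons x1 c1 -> cons x2 c2 ->
  cons (l *: x1 + (1 - l) *: x2) (fun t w => l *: c1 t w + (1 - l) *: c2 t w).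
Proof.
move=> l01 /consP[a1 H1] /consP[a2 H2]; apply/consP; split; first exact: adapted_conv.
have ml : mreal (F 0%N) (fun _ : Omega => l) by exact: mreal_cst.
have := @att_conv _ _ _ P T _ _ F hF K Rp hm hconc T.+1 0%N _ _ _ _ (fun=> l)
  (addn0 _) (fun _ => ml) (fun _ => l01) H1 H2.
have -> : (fun w : Omega => l *: rsubmx x1 + (1 - l) *: rsubmx x2) =
    (fun w => rsubmx (l *: x1 + (1 - l) *: x2)).
  by apply/funext => w; rewrite linearD !linearZ.
apply: att_eq => w; rewrite csum_conv.
by apply/rowP => i; rewrite !mxE; ring.
Qed.

Lemma cons_closed x (cn : nat -> nat -> Omega -> 'rV[R]_dF) c : (forall n, cons x (cn n)) ->
  adaptedL0 P T F (fun _ _ => @orthant R dF) c ->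
  (forall t, (t <= T)%N -> \forall w \ae P, vcvg (fun n => cn n t w) (c t w)) ->
  cons x c.
Proof.
move=> H ac cc; apply/consP; split => //.
apply: (NAr_closed (y := fun _ _ => rsubmx x) (g := fun n w => csum (cn n) w - x)).
- by move=> n; have /consP[] := H n.
- exact: mw_cst.
- by apply: aeW => w; exact: vcvg_cst.
have : \forall w \ae P, forall t : 'I_T.+1, vcvg (fun n => cn n t w) (c t w).
  by apply: ae_count => t; apply: cc; rewrite -ltnS.
apply: filterS => w Hw; apply: vcvgB; last exact: vcvg_cst.
move=> i; rewrite /csum; case: (splitP i) => j ij.
  have -> : i = lshift dI j by apply/val_inj.
  rewrite row_mxEl summxE; under eq_fun do rewrite row_mxEl summxE.
  by apply: cvg_sumr => t; exact: Hw.
have -> : i = rshift dF j by apply/val_inj.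
by rewrite row_mxEr; under eq_fun do rewrite row_mxEr; exact: cvg_cst.
Qed.

(** The difference of the endowments is given up with the first trade. *)
Lemma cons_mono x x' c : cons x c -> (\forall w \ae P, K 0%N w (x' - x)) -> cons x' c.
Proof.
move=> /consP[ac [xi [h1 h2 h3 h4 h5]]] Kx; apply/consP; split => //.
have E w : rsubmx x' + rsubmx (xi w - (x' - x)) = rsubmx x + rsubmx (xi w).
  by rewrite -!linearD /=; congr rsubmx; apply/rowP => i; rewrite !mxE; ring.
exists (fun w => xi w - (x' - x)); split.
- exact: mw_cst.
- by apply: mwB => //; exact: mw_cst.
- apply: filterS3 h3 Kx (rm_cone hm (leq0n T)) => w k1 k2 cK.
  by rewrite opprB addrC; exact: (ccD cK).
- by apply: filterS h4 => w; rewrite E.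
have -> : (fun w => rsubmx x' + rsubmx (xi w - (x' - x))) = (fun w => rsubmx x + rsubmx (xi w)).
  by apply/funext => w; exact: E.
apply: att_eq h5 => w; rewrite E.
by apply/rowP => i; rewrite !mxE; ring.
Qed.

Definition cst_cons (v : 'rV[R]_dF) : vec := row_mx (v *+ T.+1) 0.

Lemma cons_shift x c (v : 'rV[R]_dF) : orthant v -> cons x c ->
  cons (x + cst_cons v) (fun t w => c t w + v).
Proof.
move=> vo /consP[ac H]; apply/consP; split.
  move=> t tT; have [m1 o1] := ac t tT; split; first by apply: mwD => //; exact: mw_cst.
  by apply: filterS o1 => w o i; rewrite mxE addr_ge0.
have -> : (fun _ : Omega => rsubmx (x + cst_cons v)) = (fun=> rsubmx x).
  by apply/funext => w; rewrite linearD /= row_mxKr addr0.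
apply: att_eq H => w; rewrite opprD addrA.
have -> : csum (fun t w => c t w + v) w = csum c w + cst_cons v.
  rewrite /csum /cst_cons add_row_mx addr0; congr row_mx.
  by rewrite big_split /= sumr_const card_ord.
by apply/rowP => i; rewrite !mxE; ring.
Qed.

Lemma cons0 : cons 0 (fun _ _ => 0).
Proof.
apply/consP; split.
  by move=> t tT; split; [exact: mw_cst|apply: aeW => w i; rewrite mxE].
have E w : csum (fun _ _ => 0) w = 0 by rewrite /csum big1// row_mx0.
have := @att0 _ _ _ P T _ _ F hF K Rp hm hR0 T.+1 0%N (addn0 _).
rewrite [X in _ -> att _ _ X _](_ : _ = fun=> 0); last by apply/funext => w; rewrite linear0.
by apply: att_eq => w; rewrite E subr0.
Qed.

Lemma cons_cst x (v : 'rV[R]_dF) : orthant v -> orthant (x - cst_cons v) ->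
  cons x (fun _ _ => v).
Proof.
move=> vo xo; have := cons_shift vo cons0; rewrite add0r.
have -> : (fun (_ : nat) (_ : Omega) => 0 + v) = (fun _ _ => v).
  by apply/funext => t; apply/funext => w; rewrite add0r.
move=> /cons_mono; apply.
by apply: filterS (rm_cone hm (leq0n T)) => w cK; exact: (cc_orthant cK).
Qed.

(** If a coordinate exploded with positive probability, a suitable member of the sequence would
    exceed [j + 1] on a fixed event [D]. Scaled by [1 / (j + 1)] and with the rest disposed of, it
    would attain one unit on [D] from an endowment tending to 0; closedness turns this into an
    arbitrage. *)
Lemma cons_bounded x (cn : nat -> nat -> Omega -> 'rV[R]_dF) t i : (t <= T)%N ->
  (forall n, cons x (cn n)) ->
  \forall w \ae P, ~ ((fun n => cn n t w ord0 i) @ \oo --> +oo).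
Proof.
move=> tT H; pose a n w := cn n t w ord0 i.
have ma n : mreal (F T) (a n).
  have /consP[ac _] := H n; have [mc _] := ac t tT.
  exact: (mw_sub (filtration_le hF tT (leqnn T)) mc).
pose E := [set w | forall M, exists p, forall n, (p + n)%N \in [pred q | M%:R < a q w]].
have EP w : (fun n => cn n t w ord0 i) @ \oo --> +oo -> E w.
  move=> /cvgryPgt cw M; have [p _ Hp] := cw M%:R; exists p => n.
  by rewrite inE; apply: Hp => /=; exact: leq_addr.
have mE : mevent (F T) E.
  apply: (mevent_forall (A := fun M => [set w | exists p, forall n, (p + n)%N \in [pred q | M%:R < a q w]])) => M.
  apply: (mevent_exists (A := fun p => [set w | forall n, (p + n)%N \in [pred q | M%:R < a q w]])) => p.
  apply: (mevent_forall (A := fun n => [set w | (p + n)%N \in [pred q | M%:R < a q w]])) => n.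
  by under eq_set do rewrite inE; apply: mevent_lt; [exact: mreal_cst|exact: ma].
have FT : F T `<=` @measurable _ Omega by case: hF => _ _ -> _.
have mE' : measurable E by exact: mevent_measurable mE.
suff /(ae_notP mE') : P E = 0%E by apply: filterS => w nE /EP.
apply/eqP; apply: contrapT => /negP E0.
have PE : (0 < P E)%E by rewrite lt0e E0 measure_ge0.
have PEf : P E \is a fin_num by exact: fin_num_measure.
pose e := fine (P E) / 2.
have e0 : 0 < e by rewrite divr_gt0// fine_gt0// PE ltey_eq PEf.
(* [exp(-a)] converts divergence into convergence to 0, to which Egorov's theorem applies; at least
   half of the probability of [E] is kept. *)
pose f n w := expR (- a n w).
have [|||B [mB PB uB]] := @pointwise_almost_uniform _ _ _ P f (fun=> 0) E e _ mE' _ _ e0.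
- move=> n; apply: measurable_funTS; apply: (mreal_measurable FT).
  by apply: (mreal_comp (@measurable_expR R)); apply: mrealN; exact: ma.
- by rewrite ltey_eq PEf.
- move=> w Ew; apply/cvgrPdist_lt => b b0.
  have [p Hp] := Ew (Num.bound `|ln b|); exists p => // n /= pn.
  have := Hp (n - p)%N; rewrite subnKC// inE => an.
  rewrite sub0r normrN ger0_norm ?expR_ge0// -[ltRHS]lnK// ltr_expR ltrNl.
  apply: le_lt_trans an; rewrite (le_trans (ler_norm _))// normrN ltW//.
  exact: archi_boundP (normr_ge0 _).
pose D := E `\` B.
have /choice[q Hq] : forall j : nat, exists n, forall w, D w -> j.+1%:R < a n w.
  move=> j.
  have : \forall n \near \oo, forall w, D w -> ball (0 : R) (expR (- j.+1%:R)) (f n w).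
    apply: (uB [set h | forall w, D w -> ball (0 : R) (expR (- j.+1%:R)) (h w)]).
    apply/uniform_nbhs; exists [set xy | ball xy.1 (expR (- j.+1%:R)) xy.2].
    by split; [exact: (@entourage_ball _ _ (PosNum (expR_gt0 (- j.+1%:R))))|move=> h /= Hh w Dw; exact: Hh].
  move=> [n _ Hn]; exists n => w Dw; have := Hn n (leqnn n) w Dw.
  by rewrite /ball/= sub0r normrN ger0_norm ?expR_ge0// ltr_expR ltrN2.
have mDF : mevent (F T) D.
  have sA : sigma_algebra [set: Omega] (F T) by case: hF => + _ _ _; apply.
  rewrite /mevent; apply: sub_sigma_algebra.
  by case: hF => _ _ -> _; exact: measurableD.
pose bi : vec := row_mx (delta_mx ord0 i) 0.
have dbl k : (delta_mx ord0 i : 'rV[R]_dF) ord0 k = (k == i)%:R.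
  by rewrite mxE eqxx.
have Hj (j : nat) : att T.+1 0 (fun=> j.+1%:R^-1 *: rsubmx x)
    (fun w => \1_D w *: bi - j.+1%:R^-1 *: x).
  have /consP[ac Hc] := H (q j).
  have l01 : 0 <= (j.+1%:R^-1 : R) <= 1 by rewrite invr_ge0 ler0n invf_le1 ?ltr0n// ler1n.
  have ml : mreal (F 0%N) (fun _ : Omega => j.+1%:R^-1 : R) by exact: mreal_cst.
  have Hs := @att_scale _ _ _ P T _ _ F hF K Rp hm hconc hR0 T.+1 0%N _ _ (fun=> j.+1%:R^-1)
    (addn0 _) (fun _ => ml) (fun _ => l01) Hc.
  have : att T.+1 0 (fun=> j.+1%:R^-1 *: rsubmx x)
    (fun w => j.+1%:R^-1 *: (csum (cn (q j)) w - x) -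
       (j.+1%:R^-1 *: csum (cn (q j)) w - \1_D w *: bi)).
    apply: (att_discard hF hm (addn0 _)) Hs.
      apply: mwB; first by apply: mwZ; [exact: mreal_cst|exact: csum_measurable].
      by apply: mw_indic => //; exact: mw_cst.
    have : \forall w \ae P, forall r : 'I_T.+1, orthant (cn (q j) r w).
      apply: ae_count => r; have rT : (r <= T)%N by rewrite -ltnS.
      by have [] := ac r rT.
    apply: filterS => w ow; split; last first.
      rewrite -scaleNr linearD /= !linearZ_LR /= /csum /bi.
      by rewrite !row_mxKr !scaler0 addr0.
    move=> k; rewrite /csum /bi; case: (splitP k) => k' kk'; last first.
      have -> : k = rshift dF k' by apply/val_inj.
      by rewrite !(row_mxEr, mxE) !mulr0 subr0.
    have -> : k = lshift dI k' by apply/val_inj.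
    have sge0 : 0 <= (\sum_(r < T.+1) cn (q j) r w) ord0 k'.
      by rewrite summxE; apply: sumr_ge0 => r _; exact: ow.
    have -> : forall (al be : R) (u v : 'rV[R]_dF),
        (al *: row_mx u 0 - be *: row_mx v 0 : vec) ord0 (lshift dI k') =
        al * u ord0 k' - be * v ord0 k'.
      by move=> al be u v; rewrite -scaleNr mxE [X in X + _]mxE [X in _ + X]mxE !row_mxEl mulNr.
    rewrite dbl; have [Dw|Dw] := pselect (D w); last first.
      by rewrite indic_out// mul0r subr0 mulr_ge0// invr_ge0.
    rewrite indic_in// mul1r.
    have [->|_] := eqVneq k' i; last by rewrite subr0 mulr_ge0// invr_ge0.
    rewrite subr_ge0 mulrC ler_pdivlMr ?ltr0n// mul1r.
    apply: (le_trans (ltW (Hq j w Dw))).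
    rewrite summxE (bigD1 (Ordinal (_ : (t < T.+1)%N)))//= lerDl.
    by apply: sumr_ge0 => r _; exact: ow.
  apply: att_eq => w.
  by apply/rowP => k; rewrite !mxE; ring.
have ch : (fun j : nat => j.+1%:R^-1) @ \oo --> (0 : R) by exact: cvg_harmonic.
have lim : att T.+1 0 (fun=> 0) (fun w => \1_D w *: bi).
  apply: (NAr_closed Hj).
  - exact: mw_cst.
  - apply: aeW => w; rewrite -(scale0r (rsubmx x)); apply: vcvgZ => //; exact: vcvg_cst.
  apply: aeW => w; rewrite -[X in vcvg _ X]subr0 -(scale0r x).
  by apply: vcvgB; [exact: vcvg_cst|apply: vcvgZ => //; exact: vcvg_cst].
have bio : orthant bi.
  move=> k; rewrite /bi; case: (splitP k) => k' kk'.
    have -> : k = lshift dI k' by apply/val_inj.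
    by rewrite row_mxEl dbl.
  have -> : k = rshift dF k' by apply/val_inj.
  by rewrite row_mxEr mxE.
have PD : P D = 0%E.
  apply/(ae_notP (measurableD mE' mB)).
  have md : measurable_wrt (F T) (fun w => \1_D w *: bi).
    by apply: mw_indic => //; exact: mw_cst.
  have od : \forall w \ae P, orthant (\1_D w *: bi).
    by apply: aeW => w k; rewrite mxE mulr_ge0.
  apply: filterS (NAr_no_arbitrage md od lim) => w + Dw.
  rewrite indic_in// scale1r => /rowP/(_ (lshift dI i)).
  by rewrite /bi row_mxEl dbl eqxx mxE => /eqP; rewrite oner_eq0.
have : (P E <= e%:E)%E.
  have -> : E = D `|` (E `&` B) by rewrite /D setDE -setIUr setUC setUv setIT.
  apply: (le_trans (measureU2 _ _ _)).
  - exact: measurableD.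
  - exact: measurableI.
  have h1 : (P D <= 0)%E by rewrite PD.
  have h2 : (P (E `&` B) <= e%:E)%E.
    apply: le_trans (ltW PB); apply: le_measure.
    - by rewrite inE; exact: measurableI.
    - by rewrite inE.
    - exact: subIsetr.
  by apply: (le_trans (leeD h1 h2)); rewrite add0e.
rewrite -(fineK PEf) lee_fin /e.
have : 0 < fine (P E) by apply: fine_gt0; rewrite PE ltey_eq PEf.
lra.
Qed.

End consumption_sets.

(** * Utility functions *)

Section utility.
Context {R : realType} (n : nat) (U : 'rV[R]_n -> \bar R).
Implicit Types (x y z p : 'rV[R]_n).

Definition posv x : Prop := forall i, 0 < x ord0 i.

Lemma posv_orthant x : posv x -> orthant x.
Proof. by move=> px i; exact: ltW. Qed.

Lemma posv_lb x : posv x -> exists2 e : R, 0 < e & forall i, e <= x ord0 i.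
Proof.
move=> px; pose S := \sum_i (x ord0 i)^-1 + 1.
have S0 : 0 < S by rewrite ltr_wpDl// sumr_ge0// => i _; rewrite invr_ge0 ltW.
exists S^-1; first by rewrite invr_gt0.
move=> i; rewrite invf_ple ?posrE//.
rewrite /S (bigD1 i)//= -addrA lerDl addr_ge0// sumr_ge0// => j _.
by rewrite invr_ge0 ltW.
Qed.

Lemma posvZ (a : R) x : 0 < a -> posv x -> posv (a *: x).
Proof. by move=> a0 px i; rewrite mxE mulr_gt0. Qed.

Context (hU : forall x, orthant x -> U x != +oo%E) (hUc : concave_on_orthant U).
Context (hU1 : U1 U) (hU2 : U2 U).

(** A point of the domain close to half of [x] lies below [x], and monotonicity carries finiteness
    upwards. *)
Lemma utility_fin x : posv x -> U x \is a fin_num.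
Proof.
move=> px; have xo := posv_orthant px.
have hx : posv (2^-1 *: x) by apply: posvZ => //; rewrite invr_gt0.
have [e e0 He] := posv_lb hx.
have : closure (edom U) (2^-1 *: x) by rewrite hU1; exact: posv_orthant.
move=> /(_ (ball (2^-1 *: x) e) (nbhsx_ballx _ _ e0)) [q [[qo qf] [_ qb]]].
have qx : orthant (x - q).
  move=> i; have := qb ord0 i; rewrite /ball/= !mxE => /ltW; rewrite ler_distlC => /andP[_ h].
  by have := He i; rewrite mxE; lra.
have := hU2 xo qo qx => h; rewrite fin_numE hU// andbT.
by apply: contraTneq h => ->; rewrite leeNy_eq; move: qf; rewrite fin_numE => /andP[].
Qed.

(** Used in the open orthant, where [U] is finite. *)
Definition rutil x : R := fine (U x).

Lemma rutilE x : posv x -> U x = (rutil x)%:E.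
Proof. by move=> px; rewrite /rutil fineK//; exact: utility_fin. Qed.

Lemma rutil_le x y : posv x -> (forall i, x ord0 i <= y ord0 i) -> rutil x <= rutil y.
Proof.
move=> px xy.
have py : posv y by move=> i; exact: lt_le_trans (px i) (xy i).
rewrite -lee_fin -!rutilE//; apply: hU2; try exact: posv_orthant.
by move=> i; rewrite !mxE subr_ge0.
Qed.

Lemma dotvC x y : dotv x y = dotv y x.
Proof. by apply: eq_bigr => i _; rewrite mulrC. Qed.

Lemma dotvBl x y z : dotv (x - y) z = dotv x z - dotv y z.
Proof. by rewrite dotvDl -scaleN1r dotvZl mulN1r. Qed.

(* One-dimensional extension step of the Hahn-Banach argument: the slope in the
   new direction is the supremum of the difference quotients to the right. *)
Lemma supergradient_ext z (m : nat) (hm : (m < n)%N) p : posv z ->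
  (forall x, orthant x -> (forall i : 'I_n, (m <= i)%N -> x ord0 i = z ord0 i) ->
     (U x <= (rutil z + dotv p (x - z))%:E)%E) ->
  exists q, forall x, orthant x -> (forall i : 'I_n, (m < i)%N -> x ord0 i = z ord0 i) ->
     (U x <= (rutil z + dotv q (x - z))%:E)%E.
Proof.
move=> pz Hp; pose k := Ordinal hm.
pose qq x := \sum_(i < n | i != k) p ord0 i * (x - z) ord0 i.
pose s x := x ord0 k - z ord0 k.
pose valid x := orthant x /\ (forall i : 'I_n, (m < i)%N -> x ord0 i = z ord0 i).
pose a x := rutil x - rutil z - qq x.
(* Slopes to the right never exceed slopes to the left: the weight [l] makes the mixture of [x1] and
   [x2] return to the slice through [z], where the inequality is known. *)
have key x1 x2 : valid x1 -> valid x2 -> U x1 \is a fin_num -> U x2 \is a fin_num ->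
    0 < s x1 -> s x2 < 0 -> a x1 / s x1 <= - a x2 / - s x2.
  move=> [x1o e1] [x2o e2] f1 f2 s1 s2.
  pose r := - s x2; have r0 : 0 < r by rewrite oppr_gt0.
  have sr0 : 0 < s x1 + r by exact: addr_gt0.
  pose l := r / (s x1 + r).
  have l0 : 0 < l by exact: divr_gt0.
  have l1E : 1 - l = s x1 / (s x1 + r).
    by rewrite /l -[1](divff (lt0r_neq0 sr0)) -mulrBl addrK.
  have l1 : 0 < 1 - l by rewrite l1E divr_gt0.
  have l01 : 0 <= l <= 1 by rewrite ltW//= -subr_ge0 ltW.
  pose x := l *: x1 + (1 - l) *: x2.
  have xo : orthant x by exact: orthant_conv.
  have xk : x ord0 k = z ord0 k.
    apply/eqP; rewrite -subr_eq0 !mxE.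
    have -> : l * x1 ord0 k + (1 - l) * x2 ord0 k - z ord0 k = l * s x1 - (1 - l) * r.
      by rewrite /r /s; ring.
    by rewrite l1E /l mulrAC [r * _]mulrC -[_ * r]mulrAC subrr.
  have xm (i : 'I_n) : (m <= i)%N -> x ord0 i = z ord0 i.
    rewrite leq_eqVlt => /orP[/eqP mi|mi].
      by have -> : i = k by exact: val_inj.
    by rewrite !mxE e1// e2//; ring.
  have := le_trans (hUc x1o x2o l01) (Hp x xo xm).
  have -> : dotv p (x - z) = l * qq x1 + (1 - l) * qq x2.
    rewrite /dotv (bigD1 k)//= !mxE.
    have -> : l * x1 ord0 k + (1 - l) * x2 ord0 k - z ord0 k = 0.
      by have := xk; rewrite !mxE => ->; rewrite subrr.
    rewrite mulr0 add0r /qq !mulr_sumr -big_split /=; apply: eq_bigr => i _.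
    by rewrite !mxE; ring.
  rewrite -(fineK f1) -(fineK f2) -!EFinM -EFinD lee_fin -!/(rutil _) => H.
  have {}H : l * a x1 + (1 - l) * a x2 <= 0 by rewrite /a; lra.
  have {}H : r * a x1 + s x1 * a x2 <= 0.
    have : (s x1 + r) * (l * a x1 + (1 - l) * a x2) <= 0 by rewrite pmulr_rle0.
    rewrite l1E /l; suff -> : (s x1 + r) * (r / (s x1 + r) * a x1 + s x1 / (s x1 + r) * a x2) =
      r * a x1 + s x1 * a x2 by [].
    by field; rewrite gt_eqF.
  rewrite -/r ler_pdivrMr// mulrAC ler_pdivlMr//.
  by rewrite mulNr; lra.
pose S1 : set R := [set t | exists2 x, valid x /\ U x \is a fin_num & 0 < s x /\ t = a x / s x].
(* Displacements of [z] along coordinate [k], by 1 and by minus half of that coordinate, show that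
   the set of slopes is nonempty and bounded above. *)
pose xd (e : R) : 'rV[R]_n := \row_i (if i == k then z ord0 k + e else z ord0 i).
have xd_s e : s (xd e) = e by rewrite /s mxE eqxx addrC addKr.
have xd_ok e : - z ord0 k < e -> posv (xd e).
  move=> he i; rewrite mxE; case: ifP => _; last exact: pz.
  by rewrite -ltrBlDl sub0r.
have xd_valid e : - z ord0 k < e -> valid (xd e).
  move=> he; split; first by apply: posv_orthant; exact: xd_ok.
  by move=> i mi; rewrite mxE; case: eqP => [ik|//]; move: mi; rewrite ik ltnn.
have x1ok : - z ord0 k < 1 by rewrite (lt_trans _ ltr01)// oppr_lt0.
have x2ok : - z ord0 k < - (z ord0 k / 2) by have := pz k; lra.
have S1n : S1 !=set0.
  exists (a (xd 1) / s (xd 1)); exists (xd 1); last by rewrite xd_s.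
  by split; [exact: xd_valid|apply: utility_fin; exact: xd_ok].
have ub x : valid x -> U x \is a fin_num -> s x < 0 -> ubound S1 (- a x / - s x).
  by move=> vx fx sx _ [x1 [v1 f1] [s1 ->]]; exact: key.
have S1b : has_sup S1.
  split => //; exists (- a (xd (- (z ord0 k / 2))) / - s (xd (- (z ord0 k / 2)))).
  apply: ub; [exact: xd_valid|by apply: utility_fin; exact: xd_ok|].
  by rewrite xd_s oppr_lt0 divr_gt0//; exact: pz.
exists (\row_i (if i == k then sup S1 else p ord0 i)) => x xo xm.
have [fx|] := boolP (U x \is a fin_num); last first.
  by rewrite fin_numE hU// andbT negbK => /eqP ->; rewrite leNye.
have -> : dotv (\row_i (if i == k then sup S1 else p ord0 i)) (x - z) = sup S1 * s x + qq x.
  rewrite /dotv (bigD1 k)//= !mxE eqxx /s; congr (_ + _).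
  by apply: eq_bigr => i ik; rewrite mxE (negbTE ik).
rewrite -(fineK fx) lee_fin -/(rutil x).
suff : a x <= sup S1 * s x by rewrite /a; lra.
have [sx|sx|sx] := ltgtP (s x) 0.
- have : sup S1 <= - a x / - s x by apply: ge_sup => //; exact: ub.
  by rewrite ler_pdivlMr ?oppr_gt0//; lra.
- rewrite -ler_pdivrMr//; apply: ub_le_sup; first by case: S1b.
  by exists x.
rewrite sx mulr0; have := Hp x xo.
have xm' (i : 'I_n) : (m <= i)%N -> x ord0 i = z ord0 i.
  rewrite leq_eqVlt => /orP[/eqP mi|]; last exact: xm.
  have -> : i = k by exact: val_inj.
  by apply/eqP; rewrite -subr_eq0; apply/eqP.
move=> /(_ xm'); rewrite -(fineK fx) lee_fin -/(rutil x).
have -> : dotv p (x - z) = qq x.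
  rewrite /dotv (bigD1 k)//= [X in _ * X]mxE [X in _ * (_ + X)]mxE.
  by rewrite -/(s x) sx mulr0 add0r.
by rewrite /a; lra.
Qed.

(** One coordinate is freed at a time, starting from the point [z] alone; monotonicity along the
    coordinate directions makes the supergradient nonnegative. *)
Lemma supergradient z : posv z -> exists p, orthant p /\ forall x, orthant x ->
  (U x <= (rutil z + dotv p (x - z))%:E)%E.
Proof.
move=> pz.
have [p Hp] : exists p, forall x, orthant x -> (U x <= (rutil z + dotv p (x - z))%:E)%E.
  suff /(_ n (leqnn n)) [p Hp] : forall m, (m <= n)%N -> exists p, forall x, orthant x ->
      (forall i : 'I_n, (m <= i)%N -> x ord0 i = z ord0 i) ->
      (U x <= (rutil z + dotv p (x - z))%:E)%E.
    by exists p => x xo; apply: Hp => // i; rewrite leqNgt ltn_ord.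
  elim=> [_|m IH mn].
    exists 0 => x xo xz; have -> : x = z by apply/rowP => i; rewrite xz.
    by rewrite subrr rutilE// lee_fin /dotv big1 ?addr0// => i _; rewrite mxE mul0r.
  have [p Hp] := IH (ltnW mn); exact: (supergradient_ext mn pz Hp).
exists p; split => // i.
pose x : 'rV[R]_n := z + delta_mx ord0 i.
have zx j : z ord0 j <= x ord0 j by rewrite !mxE lerDl.
have px : posv x by move=> j; exact: lt_le_trans (pz j) (zx j).
have xz : x - z = delta_mx ord0 i by rewrite /x addrC addKr.
have := Hp x (posv_orthant px); rewrite rutilE// lee_fin xz.
have -> : dotv p (delta_mx ord0 i) = p ord0 i.
  rewrite /dotv (bigD1 i)//= mxE !eqxx mulr1 big1 ?addr0// => j ji.
  by rewrite mxE (negbTE ji) mulr0.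
by have := rutil_le pz zx; lra.
Qed.

Lemma conjugate_ge p x : orthant x ->
  (U x - (dotv x p)%:E <= conjugate U p)%E.
Proof. by move=> xo; apply: ereal_sup_ubound; exists x. Qed.

Lemma conjugate_supergradient z p : posv z ->
  (forall x, orthant x -> (U x <= (rutil z + dotv p (x - z))%:E)%E) ->
  conjugate U p = (rutil z - dotv p z)%:E.
Proof.
move=> pz Hp; apply/eqP; rewrite eq_le; apply/andP; split; last first.
  have := conjugate_ge p (posv_orthant pz); rewrite rutilE// dotvC.
  by [].
apply: ub_ereal_sup => _ [x xo <-]; rewrite -/(dotv x p).
rewrite leeBlDr// -EFinD.
apply: le_trans (Hp x xo) _; rewrite lee_fin dotvC dotvBl [dotv p z]dotvC.
lra.
Qed.

Context (hU4 : U4 U).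

(* Writing (U4) at a supergradient [p] of [U] at [z], where the conjugate equals
   [U z - p . z], bounds [p . z] by a fraction of [U z]. *)
Lemma utility_growth (del : R) : 0 < del -> exists (gam C : R), [/\ 0 <= gam, gam < 1,
  0 <= C & forall z, (forall i, del <= z ord0 i) ->
    rutil (2 *: z) <= (1 + gam) * Num.max (rutil z) 0 + C].
Proof.
move=> del0.
(* The weight 1/2 serves when the conjugate at [p] is nonnegative. When it is negative, the weight
   1/4 leaves, with [D <= 2 u + 2 c0], half of [u], which is then bounded by a constant. *)
have [|C1 C10 H1] := hU4 (l := 2^-1).
  by rewrite invr_gt0 ltr0n invf_lt1 ?ltr0n// ltr1n.
have [|C2 C20 H2] := hU4 (l := 4^-1).
  by rewrite invr_gt0 ltr0n invf_lt1 ?ltr0n// ltr1n.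
pose dv : 'rV[R]_n := const_mx (del / 2).
pose c0 := `|rutil dv|.
pose C := Num.max C1 1.
have C1' : 1 <= C by rewrite le_max lexx orbT.
have C1C : C1 <= C by rewrite le_max lexx.
(* Solving [u - D / 2 <= C (1 + u - D)] for [D] gives the slope [gam], and [C >= 1] bounds the
   constant [C / (C - 1 / 2)] by 2. *)
pose gam := (C - 1) / (C - 2^-1).
have Ch : 0 < C - 2^-1 by lra.
exists gam, (2 + 6 * C2 + 5 * c0).
have gam0 : 0 <= gam by rewrite divr_ge0; lra.
have gam1 : gam < 1 by rewrite ltr_pdivrMr//; lra.
have c00 : 0 <= c0 by rewrite /c0 normr_ge0.
split => //; first by lra.
move=> z zd; have pz : posv z by move=> i; exact: lt_le_trans del0 (zd i).
have [p [po Hp]] := supergradient pz.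
have cE := conjugate_supergradient pz Hp.
have dom : edom (conjugate U) p by split => //; rewrite cE.
pose D := dotv p z; pose u := rutil z.
have cl (l : R) : ((u - l * D)%:E <= conjugate U (l *: p))%E.
  by have := conjugate_ge (l *: p) (posv_orthant pz); rewrite rutilE// dotvC dotvZl.
have mE : (1 + maxe (conjugate U p) 0 = (1 + Num.max (u - D) 0)%:E)%E.
  by rewrite cE -EFin_max EFinD.
have h1 : u - 2^-1 * D <= C1 * (1 + Num.max (u - D) 0).
  by rewrite -lee_fin; apply: le_trans (cl _) _; have := H1 p dom; rewrite mE -EFinM.
have h2 : u - 4^-1 * D <= C2 * (1 + Num.max (u - D) 0).
  by rewrite -lee_fin; apply: le_trans (cl _) _; have := H2 p dom; rewrite mE -EFinM.
have p2 : posv (2 *: z) by exact: posvZ.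
have h3 : rutil (2 *: z) <= u + D.
  have := Hp _ (posv_orthant p2); rewrite rutilE// lee_fin.
  by rewrite scaler_nat mulr2n addrK.
have ph : posv (2^-1 *: z) by apply: posvZ => //; rewrite invr_gt0.
(* The supergradient inequality at half of [z], where [U] is bounded below since [z] stays away from
   the boundary. *)
have h4 : D <= 2 * u + 2 * c0.
  have := Hp _ (posv_orthant ph); rewrite rutilE// lee_fin dotvC dotvBl dotvZl.
  rewrite [dotv z p]dotvC -/D -/u.
  have pd : posv dv by move=> i; rewrite mxE divr_gt0.
  have : rutil dv <= rutil (2^-1 *: z).
    by apply: rutil_le => // i; rewrite !mxE; have := zd i; lra.
  have : - c0 <= rutil dv by rewrite /c0 lerNl -normrN ler_norm.
  lra.
have D0 : 0 <= D by rewrite /D /dotv; apply: sumr_ge0 => i _; apply: mulr_ge0; [exact: po|exact: ltW].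
rewrite -/u; have [uD|uD] := leP 0 (u - D).
  rewrite (max_idPl uD) in h1.
  have h1' : u - 2^-1 * D <= C * (1 + (u - D)).
    by apply: le_trans h1 _; apply: ler_wpM2r => //; lra.
  have Dg : D <= gam * u + 2.
    have : (C - 2^-1) * D <= C + (C - 1) * u by lra.
    rewrite -ler_pdivlMl// => /le_trans; apply.
    rewrite mulrDr [X in _ + X]mulrA [_^-1 * (C - 1)]mulrC -/gam addrC lerD2l.
    by rewrite mulrC ler_pdivrMr//; lra.
  have u0 : 0 <= u by lra.
  rewrite (max_idPl u0); lra.
rewrite (max_idPr (ltW uD)) in h2.
have ub : u <= 2 * C2 + c0 by lra.
have m0 : 0 <= (1 + gam) * Num.max u 0.
  by rewrite mulr_ge0 ?le_max ?lexx ?orbT//; lra.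
lra.
Qed.

Section shifted.
Context (del : R) (hdel : 0 < del).

Definition delv : 'rV[R]_n := const_mx del.

(** Nonnegative and finite on the closed orthant, boundary included, where [U] itself may equal
    [-oo]; it dominates [U] up to a constant. *)
Definition shifted x : R := rutil (x + delv) - rutil delv.

Lemma posv_delv : posv delv. Proof. by move=> i; rewrite mxE. Qed.

Lemma posv_shift x : orthant x -> posv (x + delv).
Proof. by move=> xo i; rewrite !mxE ltr_wpDl. Qed.

Lemma shifted_ge0 x : orthant x -> 0 <= shifted x.
Proof.
move=> xo; rewrite subr_ge0; apply: rutil_le; first exact: posv_delv.
by move=> i; rewrite !mxE lerDr.
Qed.

Lemma shifted_le x y : orthant x -> (forall i, x ord0 i <= y ord0 i) -> shifted x <= shifted y.
Proof.
move=> xo xy; rewrite lerD2r; apply: rutil_le; first exact: posv_shift.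
by move=> i; rewrite !mxE lerD2r.
Qed.

Lemma utility_le_shifted x : orthant x -> (U x <= (shifted x + rutil delv)%:E)%E.
Proof.
move=> xo; have px := posv_shift xo; rewrite subrK -rutilE//; apply: hU2 => //.
  exact: posv_orthant.
by move=> i; rewrite !mxE addrC addKr ltW.
Qed.

Lemma shifted_double : exists (gam C : R), [/\ 0 <= gam, gam < 1, 0 <= C &
  forall x, orthant x -> shifted (2 *: x) <= (1 + gam) * shifted x + C].
Proof.
have [gam [C [g0 g1 C0 H]]] := utility_growth hdel.
exists gam, (C + 3 * `|rutil delv|); split => //; first by rewrite addr_ge0 ?mulr_ge0.
move=> x xo.
have := H (x + delv); set u := rutil (x + delv) => /(_ _)/wrap[|H2].
  by move=> i; rewrite !mxE lerDr.
have W0 := shifted_ge0 xo.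
have uE : u = shifted x + rutil delv by rewrite subrK.
have mx : Num.max u 0 <= shifted x + `|rutil delv|.
  rewrite ge_max; apply/andP; split; last exact: addr_ge0.
  by rewrite uE lerD2l ler_norm.
have l1 : shifted (2 *: x) + rutil delv <= rutil (2 *: (x + delv)).
  rewrite subrK; apply: rutil_le.
    by apply: posv_shift => i; rewrite mxE mulr_ge0.
  by move=> i; rewrite !mxE; have := hdel; lra.
have n1 : - rutil delv <= `|rutil delv| by rewrite -normrN ler_norm.
have : (1 + gam) * Num.max u 0 <= (1 + gam) * (shifted x + `|rutil delv|).
  by rewrite ler_wpM2l//; lra.
have : gam * `|rutil delv| <= `|rutil delv| by rewrite ler_piMl// ltW.
rewrite mulrDr mulrDl mul1r; lra.
Qed.

End shifted.

Section measurability.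
Context {disp : measure_display} {Omega : measurableType disp}.

(* The superlevel sets are increasing, hence inside the open orthant they are
   countable unions of translated orthants with rational corners. *)
Lemma posv_level_event G (X : Omega -> 'rV[R]_n) (a : R) : measurable_wrt G X ->
  (forall w, posv (X w)) -> mevent G [set w | (a%:E < U (X w))%E].
Proof.
move=> mX pX.
pose pt (q : {ffun 'I_n -> rat}) : 'rV[R]_n := \row_i ratr (q i).
rewrite (_ : [set w | _] = [set w | exists q, ([set w | posv (pt q) /\ (a%:E < U (pt q))%E] `&`
   [set w | forall i, pt q ord0 i <= X w ord0 i]) w]).
  apply: mevent_exists => q; apply: meventI; first exact: mevent_prop.
  apply: (mevent_forall (A := fun i => [set w | pt q ord0 i <= X w ord0 i])) => i.
  by apply: mevent_le; [exact: mreal_cst|exact: mX].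
apply/seteqP; split => w /=; last first.
  move=> [q [[pq aq] qX]]; apply: lt_le_trans aq _; rewrite !rutilE// lee_fin.
  exact: rutil_le.
rewrite rutilE// lte_fin => aU.
set x := X w in aU *; have px : posv x := pX w.
have ph : posv (2^-1 *: x) by apply: posvZ => //; rewrite invr_gt0.
(* Concavity on the segment from [x] to half of [x] prevents a jump at [x] from below: a point
   slightly closer to 0 keeps the level, and a rational corner fits between it and [x]. *)
have [l l01 lH] : exists2 l : R, 0 < l < 1 &
    a < (1 - l) * rutil x + l * rutil (2^-1 *: x).
  pose b := rutil x - rutil (2^-1 *: x).
  pose l := Num.min 2^-1 ((rutil x - a) / (2 * (`|b| + 1))).
  have d0 : 0 < 2 * (`|b| + 1) by rewrite mulr_gt0// ltr_wpDl.
  have l0 : 0 < l by rewrite lt_min invr_gt0 ltr0n/= divr_gt0// subr_gt0.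
  exists l; first by rewrite l0/= (@le_lt_trans _ _ 2^-1) ?ge_min ?lexx// invf_lt1 ?ltr0n// ltr1n.
  have : l * (2 * (`|b| + 1)) <= rutil x - a.
    by rewrite -ler_pdivlMr// ge_min lexx orbT.
  have : l * b <= l * `|b| by rewrite ler_wpM2l ?ler_norm// ltW.
  have : 0 <= l * `|b| by rewrite mulr_ge0// ltW.
  rewrite /b; lra.
have /andP[l0 l1] := l01.
have /choice[q Hq] : forall i, exists q : rat, (1 - l / 2) * x ord0 i < ratr q < x ord0 i.
  move=> i; have [|q] := @rat_in_itvoo R ((1 - l / 2) * x ord0 i) (x ord0 i).
    have := mulr_gt0 l0 (px i); lra.
  by rewrite in_itv/=; exists q.
exists [ffun i => q i].
have ptE i : pt [ffun i => q i] ord0 i = ratr (q i) by rewrite mxE ffunE.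
have pp : posv (pt [ffun i => q i]).
  move=> i; rewrite ptE; have /andP[h _] := Hq i; apply: le_lt_trans h.
  have l2 : 0 <= 1 - l / 2 by lra.
  by rewrite mulr_ge0// ltW.
split; last by move=> i; rewrite ptE; have /andP[_ /ltW] := Hq i.
split => //; rewrite rutilE// lte_fin; apply: lt_le_trans lH _.
pose v := (1 - l) *: x + l *: (2^-1 *: x).
have pv : posv v.
  by move=> i; rewrite !mxE !mulrA -mulrDl mulr_gt0//; lra.
apply: (@le_trans _ _ (rutil v)).
  have := @hUc x (2^-1 *: x) (1 - l) (posv_orthant px) (posv_orthant ph) _.
  rewrite subKr !rutilE// => H; rewrite -lee_fin; apply: H; lra.
apply: rutil_le => // i; rewrite ptE; have /andP[/ltW h _] := Hq i.
by apply: le_trans h; rewrite !mxE; lra.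
Qed.

Lemma posv_utility_measurable G (X : Omega -> 'rV[R]_n) : measurable_wrt G X ->
  (forall w, posv (X w)) -> mreal G (fun w => rutil (X w)).
Proof.
move=> mX pX mT; apply: (measurability _ (RGenOInfty.measurableE R)).
2: exact: measurableT.
move=> _ [_ [a ->] <-]; rewrite setTI.
have -> : (fun w : g_sigma_algebraType G => rutil (X w)) @^-1` `]a, +oo[%classic =
    [set w | (a%:E < U (X w))%E].
  by apply/seteqP; split => w /=; rewrite in_itv/= andbT rutilE// lte_fin.
exact: posv_level_event.
Qed.

Context (husc : usc_on_orthant U).

Lemma usc_seq (x : nat -> 'rV[R]_n) l (a : R) : (forall k, orthant (x k)) -> vcvg x l ->
  (U l < a%:E)%E -> \forall k \near \oo, (U (x k) < a%:E)%E.
Proof.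
move=> xo xl Ua; apply: contrapT => nk.
have lo := orthant_seqclosed xo xl.
suff [_] : [set x | orthant x /\ (a%:E <= U x)%E] l by rewrite leNgt Ua.
apply: (husc (a := a)) => B /nbhs_ballP[e e0 He].
have : \forall k \near \oo, forall i, `|l ord0 i - x k ord0 i| < e.
  by apply: filter_forall => j; have /cvgrPdist_lt := xl j; exact.
move=> [N _ HN].
have [k Nk aU] : exists2 k, (N <= k)%N & (a%:E <= U (x k))%E.
  apply: contrapT => nex; apply: nk; exists N => // k /= Nk.
  by rewrite ltNge; apply/negP => h; apply: nex; exists k.
exists (x k); split; first by split.
by apply: He; apply: ball_row => //; exact: HN.
Qed.

(** Monotonicity and upper semicontinuity make [U] at a boundary point the limit along the diagonal
    from the open orthant, where measurability is known. *)
Lemma orthant_level_event G (X : Omega -> 'rV[R]_n) (a : R) : measurable_wrt G X ->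
  (forall w, orthant (X w)) -> mevent G [set w | (U (X w) < a%:E)%E].
Proof.
move=> mX oX; pose e (k : nat) : 'rV[R]_n := const_mx k.+1%:R^-1.
have pXe k w : posv (X w + e k).
  by move=> i; rewrite !mxE ltr_wpDl ?invr_gt0//; exact: oX.
rewrite (_ : [set w | _] = [set w | exists k, [set w | rutil (X w + e k) < a] w]).
  apply: mevent_exists => k; apply: mevent_lt; last exact: mreal_cst.
  by apply: posv_utility_measurable => //; apply: mwD => //; exact: mw_cst.
apply/seteqP; split => w /=; last first.
  move=> [k Uk]; rewrite -lte_fin -rutilE// in Uk; apply: le_lt_trans Uk; apply: hU2 => //.
    exact: posv_orthant.
  by move=> i; rewrite !mxE addrC addKr invr_ge0.
move=> Ua; have eX : vcvg (fun k => X w + e k) (X w).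
  move=> i; rewrite [X in _ --> X](_ : _ = X w ord0 i + 0); last by rewrite addr0.
  under eq_fun do rewrite !mxE.
  by apply: cvgD; [exact: cvg_cst|exact: cvg_harmonic].
have [N _ HN] := usc_seq (fun k => posv_orthant (pXe k w)) eX Ua.
by exists N; have /= := HN N (leqnn N); rewrite rutilE// lte_fin.
Qed.

End measurability.
End utility.

(** * Integration *)

Section integration.
Context {R : realType} {disp : measure_display} {Omega : measurableType disp}.
Context (P : probability Omega R).

(** Raising [g] to [+oo] on the exceptional set makes the inequality hold everywhere, so that
    monotonicity applies even to a nonmeasurable [f]. *)
Lemma integral_le_ae (f g : Omega -> \bar R) : (forall w, 0 <= f w)%E ->
  (forall w, 0 <= g w)%E -> measurable_fun setT g -> (\forall w \ae P, (f w <= g w)%E) ->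
  (\int[P]_w f w <= \int[P]_w g w)%E.
Proof.
move=> f0 g0 mg [A [mA A0 fA]].
pose g' w := if w \in A then +oo%E else g w.
have mg' : measurable_fun setT g'.
  apply: measurable_fun_ifT => //; apply: (measurable_fun_bool true).
  rewrite setTI (_ : _ @^-1` _ = A)//; apply/seteqP; split => w /= h; first exact: set_mem.
  exact: mem_set.
have -> : (\int[P]_w g w = \int[P]_w g' w)%E.
  apply: ae_eq_integral => //; exists A; split => // w /= h.
  by apply: contrapT => nA; apply: h => _; rewrite /g' memNset.
have fg w : (f w <= g' w)%E.
  rewrite /g'; case: ifPn => [_|wA]; first exact: leey.
  by apply: contrapT => h; move/negP: wA; apply; apply: mem_set; exact: fA.
have g'0 w : (0 <= g' w)%E by exact: le_trans (f0 w) (fg w).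
rewrite !ge0_integralTE//; apply: ereal_sup_le => _ [h /= hf <-].
by exists h => //= w; exact: le_trans (hf w) (fg w).
Qed.

Lemma integral_real_cst (r : R) : (\int[P]_w r%:E = r%:E)%E.
Proof.
have := @integral_cst _ _ _ P setT measurableT r%:E; rewrite /cst/= => ->.
by rewrite (probability_setT P) mule1.
Qed.

Lemma measurable_bigmax (g : nat -> Omega -> R) (s : seq nat) :
  (forall k, measurable_fun setT (g k)) ->
  measurable_fun setT (fun w => \big[Num.max/0]_(k <- s) g k w).
Proof.
move=> mg; elim: s => [|k s IH].
  by under eq_fun do rewrite big_nil; exact: measurable_cst.
by under eq_fun do rewrite big_cons; exact: measurable_maxr.
Qed.

Lemma bigmax_le_cat (g : nat -> R) (s r : seq nat) :
  \big[Num.max/0]_(k <- s) g k <= \big[Num.max/0]_(k <- s ++ r) g k.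
Proof.
elim: s => [|k s IH] /=; last by rewrite !big_cons ge_max !le_max lexx IH orbT.
rewrite big_nil; elim: r => [|k r IH] /=; first by rewrite big_nil.
by rewrite big_cons le_max IH orbT.
Qed.

Lemma bigmax0_ge0 (g : nat -> R) (s : seq nat) : 0 <= \big[Num.max/0]_(k <- s) g k.
Proof. by have := bigmax_le_cat g [::] s; rewrite big_nil. Qed.

(* If infinitely many of the integrals exceeded [eta], a subsequence of the [g k]
   would be almost disjoint, hence its running maxima would have integrals
   growing linearly. *)
Lemma reverse_fatou_max (g : nat -> Omega -> R) :
  (forall k, measurable_fun setT (g k)) -> (forall k w, 0 <= g k w) ->
  (\forall w \ae P, g^~ w @ \oo --> (0 : R)) ->
  (forall eta : R, 0 < eta -> exists m : nat, forall s : seq nat, size s = m ->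
     (\int[P]_w (\big[Num.max/0]_(k <- s) g k w)%:E < (eta * m%:R)%:E)%E) ->
  forall eta : R, 0 < eta -> \forall k \near \oo, (\int[P]_w (g k w)%:E <= eta%:E)%E.
Proof.
move=> mg g0 gc H eta eta0; apply: contrapT => nk.
have e20 : 0 < eta / 2 by rewrite divr_gt0.
have [m Hm] := H _ e20.
have freq (A : nat -> Prop) : (\forall k \near \oo, A k) ->
    exists2 k, A k & (eta%:E < \int[P]_w (g k w)%:E)%E.
  move=> [N _ HN]; apply: contrapT => nex; apply: nk; exists N => // k /= Nk.
  by rewrite leNgt; apply/negP => h; apply: nex; exists k => //; exact: HN.
pose G s w := \big[Num.max/0]_(k <- s) g k w.
have mG s : measurable_fun setT (fun w => (G s w)%:E).
  by apply/measurable_EFinP; exact: measurable_bigmax.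
have mgE k : measurable_fun setT (fun w => (g k w)%:E) by exact/measurable_EFinP.
have G0 s w : 0 <= G s w by exact: bigmax0_ge0.
suff /(_ m (leqnn m)) [s sm] : forall p, (p <= m)%N -> exists2 s, size s = p &
    ((eta / 2 * p%:R)%:E <= \int[P]_w (G s w)%:E)%E.
  by rewrite leNgt Hm.
elim=> [_|p IH pm].
  by exists [::] => //; rewrite mulr0; apply: integral_ge0 => w _; rewrite lee_fin.
have [s sp Hs] := IH (ltnW pm).
have Gi : P.-integrable setT (fun w => (G s w)%:E).
  apply/integrableP; split => //; under eq_integral do rewrite gee0_abs ?lee_fin//.
  (* Padding the list with index 0 to length [m] enlarges the maximum, whose integral is finite by
     [Hm]. *)
  have := Hm (s ++ nseq (m - p) 0%N); rewrite size_cat size_nseq sp subnKC ?(ltnW pm)//.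
  move=> /(_ erefl) h; apply: le_lt_trans (lt_trans h (ltry _)).
  apply: ge0_le_integral => //; try by move=> w _; rewrite lee_fin.
  - exact: mG.
  - by move=> w _; rewrite lee_fin; exact: bigmax_le_cat.
pose mn k w := Num.min (G s w) (g k w).
have mmn k : measurable_fun setT (fun w => (mn k w)%:E).
  by apply/measurable_EFinP; apply: measurable_minr => //; exact: measurable_bigmax.
have mn0 k w : 0 <= mn k w by rewrite le_min G0 g0.
have Hd : (fun k => \int[P]_w (mn k w)%:E)%E @ \oo --> 0%E.
  have dc1 : \forall w \ae P, setT w -> (fun k => (mn k w)%:E) @ \oo --> 0%E.
    apply: filterS gc => w gw _; apply: cvg_EFin; first exact: nearW.
    apply: (@squeeze_cvgr _ _ _ _ (fun=> 0) (fun k => g k w)); [|exact: cvg_cst|exact: gw].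
    by apply: nearW => k; rewrite mn0/= ge_min lexx orbT.
  have dc2 : \forall w \ae P, forall k, setT w -> (`|(mn k w)%:E| <= (G s w)%:E)%E.
    by apply: aeW => w k _; rewrite gee0_abs lee_fin// ge_min lexx.
  have [_ _] := dominated_convergence measurableT mmn (measurable_cst _) dc1 Gi dc2.
  by rewrite integral0.
have Hn : \forall k \near \oo, (\int[P]_w (mn k w)%:E <= (eta / 2)%:E)%E.
  have /fine_cvgP[h1 /cvgrPdist_le /(_ _ e20) h2] := Hd.
  near=> k; have f : (\int[P]_w (mn k w)%:E)%E \is a fin_num by near: k.
  rewrite -(fineK f) lee_fin; have : `|0 - fine (\int[P]_w (mn k w)%:E)%E| <= eta / 2.
    by near: k; exact: h2.
  by rewrite sub0r normrN; apply: le_trans; exact: ler_norm.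
have [k kn kg] := freq _ Hn.
exists (k :: s); first by rewrite /= sp.
(* Maximum plus minimum equals the sum; as the minimum with the earlier maxima tends to 0 in mean, a
   late [k] adds at least half of [eta]. *)
have E : (\int[P]_w (G (k :: s) w)%:E + \int[P]_w (mn k w)%:E =
    \int[P]_w (G s w)%:E + \int[P]_w (g k w)%:E)%E.
  rewrite -!ge0_integralD//; try by move=> w _; rewrite lee_fin.
  apply: eq_integral => w _; rewrite -!EFinD /G big_cons -/(G s w) /mn; congr EFin.
  by rewrite maxC addr_max_min.
have fG : (\int[P]_w (mn k w)%:E)%E \is a fin_num.
  rewrite ge0_fin_numE; first exact: le_lt_trans kn (ltry _).
  by apply: integral_ge0 => w _; rewrite lee_fin.
rewrite -(leeD2rE _ _ fG) E -(natr1 p) mulrDr mulr1 EFinD -addeA.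
apply: leeD => //; apply: le_trans (ltW kg).
rewrite [leRHS](_ : _ = (eta / 2)%:E + (eta / 2)%:E)%E; last by rewrite -EFinD -splitr.
by apply: leeD.
Unshelve. all: by end_near. Qed.

(** By the arithmetic-geometric inequality each increment [D] is at most [2^-j + 2^j D^2], of mean
    at most [5 * 2^-j]; the sum of these bounds is integrable, hence finite almost surely. *)
Lemma cvgn_square_summable (u : nat -> Omega -> R) :
  (forall j, measurable_fun setT (u j)) ->
  (forall j, (\int[P]_w ((u j.+1 w - u j w) ^+ 2)%:E <= (4 * 4^-1 ^+ j)%:E)%E) ->
  \forall w \ae P, cvgn (u^~ w).
Proof.
move=> mu Hu; pose D j w := u j.+1 w - u j w.
have mD j : measurable_fun setT (fun w => (D j w) ^+ 2).
  by apply: measurable_funX; exact: measurable_funB.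
pose a j w := 2^-1 ^+ j + 2 ^+ j * (D j w) ^+ 2.
have a0 j w : 0 <= a j w by apply: addr_ge0; [exact: exprn_ge0|apply: mulr_ge0; [exact: exprn_ge0|exact: sqr_ge0]].
have ma j : measurable_fun setT (fun w => (a j w)%:E).
  by apply/measurable_EFinP/measurable_funD => //; exact: measurable_funM.
have aD j w : `|D j w| <= a j w.
  have h0 : (0 : R) < 2 ^+ j by rewrite exprn_gt0.
  have hE : (2^-1 : R) ^+ j = (2 ^+ j)^-1 by rewrite exprVn.
  rewrite /a hE -[D j w ^+ 2]real_normK ?num_real//.
  have := sqr_ge0 ((2 ^+ j)^-1 - `|D j w|); rewrite sqrrB => h.
  have : 0 <= 2 ^+ j * ((2 ^+ j)^-1 ^+ 2 - (2 ^+ j)^-1 * `|D j w| *+ 2 + `|D j w| ^+ 2).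
    by rewrite mulr_ge0// ltW.
  have -> : 2 ^+ j * ((2 ^+ j)^-1 ^+ 2 - (2 ^+ j)^-1 * `|D j w| *+ 2 + `|D j w| ^+ 2) =
     (2 ^+ j)^-1 + 2 ^+ j * `|D j w| ^+ 2 - `|D j w| *+ 2.
    by field; rewrite expf_neq0.
  have := normr_ge0 (D j w); lra.
have Ia j : (\int[P]_w (a j w)%:E <= (5 * 2^-1 ^+ j)%:E)%E.
  under eq_integral do rewrite /a EFinD EFinM.
  rewrite ge0_integralD//; last 2 first.
  - by move=> w _; rewrite -EFinM lee_fin; apply: mulr_ge0; [exact: exprn_ge0|exact: sqr_ge0].
  - by apply: emeasurable_funM => //; exact/measurable_EFinP.
  rewrite integral_real_cst ge0_integralZl//; last 2 first.
  - exact/measurable_EFinP.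
  - by move=> w _; rewrite lee_fin sqr_ge0.
  apply: (@le_trans _ _ ((2^-1 ^+ j)%:E + (2 ^+ j)%:E * (4 * 4^-1 ^+ j)%:E)%E).
    by apply: leeD => //; apply: lee_wpmul2l => //; exact: Hu.
  rewrite -EFinM -EFinD lee_fin.
  have -> : (2 : R) ^+ j * (4 * 4^-1 ^+ j) = 4 * 2^-1 ^+ j.
    by rewrite mulrCA -exprMn; congr (_ * _ ^+ _); field.
  lra.
have S10 : (\sum_(0 <= j <oo) \int[P]_w (a j w)%:E <= 10%:E)%E.
  apply: lime_le; first by apply: is_cvg_nneseries => j _ _; apply: integral_ge0 => w _; rewrite lee_fin.
  apply: nearW => k; apply: (@le_trans _ _ (\sum_(0 <= j < k) (5 * 2^-1 ^+ j)%:E)%E).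
    by apply: lee_sum => j _.
  have -> : (\sum_(0 <= j < k) (5 * 2^-1 ^+ j)%:E = (10 - 10 * 2^-1 ^+ k : R)%:E)%E.
    elim: k => [|k IH]; first by rewrite big_geq// expr0 mulr1 subrr.
    by rewrite big_nat_recr//= IH -EFinD exprS; congr EFin; field.
  by rewrite lee_fin gerBl mulr_ge0// exprn_ge0.
rewrite -integral_nneseries// in S10; last by move=> j w _; rewrite lee_fin.
pose phi w := (\sum_(0 <= j <oo) (a j w)%:E)%E.
have phi0 w : (0 <= phi w)%E by apply: nneseries_ge0 => j _ _; rewrite lee_fin.
have /integrable_ae : P.-integrable setT phi.
  apply/integrableP; split.
    by apply: ge0_emeasurable_sum => // j w _ _; rewrite lee_fin.
  under eq_integral do rewrite gee0_abs//.
  exact: le_lt_trans S10 (ltry _).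
move=> /(_ measurableT); apply: filterS => w /(_ I) fphi.
have -> : u^~ w = (fun k => u 0%N w + series (telescope (u^~ w)) k).
  by apply/funext => k; exact: (eq_sum_telescope (u^~ w) k).
apply: is_cvgD; first exact: is_cvg_cst.
apply: normed_cvg.
rewrite (_ : [normed series (telescope (u^~ w))] = fun k => \sum_(0 <= j < k) `|D j w|)//.
apply: nondecreasing_is_cvgn.
  apply/nondecreasing_seqP => k; rewrite big_nat_recr//= lerDl.
  exact: normr_ge0.
exists (fine (phi w)) => _ [k _ <-].
rewrite -lee_fin fineK//; apply: le_trans (@nneseries_lim_ge _ _ _ _ k _); last first.
  by move=> j _ _; rewrite lee_fin.
rewrite -sumEFin; apply: lee_sum => j _.
by rewrite lee_fin; exact: aD.
Qed.

End integration.

(** * Convergent sequences in nested convex sets *)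

Section convex_selection.
Context {R : realType} {disp : measure_display} {Omega : measurableType disp}.
Context (P : probability Omega R) (T n : nat).
Local Notation proc := (nat -> Omega -> 'rV[R]_n).

Definition midpoint (c c' : proc) : proc :=
  fun t w => 2^-1 *: c t w + (1 - 2^-1) *: c' t w.

Definition expdec (c : proc) w : R := \sum_(t < T.+1) \sum_i expR (- c t w ord0 i).

Definition expgap (c c' : proc) w : R :=
  \sum_(t < T.+1) \sum_i (expR (- c t w ord0 i / 2) - expR (- c' t w ord0 i / 2)) ^+ 2.

(** With [a = exp(-x/2)] and [b = exp(-y/2)], the midpoint contributes [a b] and the identity is
    [a^2 + b^2 = 2 a b + (a - b)^2]; hence the halved exponents in [expgap]. *)
Lemma expdec_midpoint c c' w :
  expdec c w + expdec c' w = 2 * expdec (midpoint c c') w + expgap c c' w.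
Proof.
rewrite /expdec /expgap mulr_sumr -!big_split; apply: eq_bigr => t _.
rewrite mulr_sumr -!big_split; apply: eq_bigr => i _ /=.
set x := c t w ord0 i; set y := c' t w ord0 i.
have -> : - midpoint c c' t w ord0 i = - x / 2 + - y / 2 by rewrite !mxE -/x -/y; field.
have E z : expR (- z) = expR (- z / 2) ^+ 2 :> R.
  by rewrite expr2 -expRD -splitr.
by rewrite expRD (E x) (E y); ring.
Qed.

Lemma expgap_ge0 c c' w : 0 <= expgap c c' w.
Proof. by apply: sumr_ge0 => t _; apply: sumr_ge0 => i _; exact: sqr_ge0. Qed.

Lemma expdec_ge0 c w : 0 <= expdec c w.
Proof. by apply: sumr_ge0 => t _; apply: sumr_ge0 => i _; exact: expR_ge0. Qed.

Definition good_process (c : proc) : Prop := forall t, (t <= T)%N ->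
  (forall i, measurable_fun setT (fun w => c t w ord0 i)) /\ forall w, orthant (c t w).

Lemma measurable_exp_half c t i : good_process c -> (t <= T)%N ->
  measurable_fun setT (fun w => expR (- c t w ord0 i / 2)).
Proof.
move=> gc tT; have [mc _] := gc t tT.
apply: measurableT_comp => //; apply: measurable_funM => //.
exact: measurableT_comp.
Qed.

Lemma measurable_expdec c : good_process c -> measurable_fun setT (expdec c).
Proof.
move=> gc; apply: measurable_sum => t; apply: measurable_sum => i.
have [mc _] := gc t (ltn_ord t).
apply: measurableT_comp => //; exact: measurableT_comp.
Qed.

Lemma measurable_expgap c c' : good_process c -> good_process c' ->
  measurable_fun setT (expgap c c').
Proof.
move=> gc gc'; apply: measurable_sum => t; apply: measurable_sum => i.
apply: measurable_funX; apply: measurable_funB; exact: (measurable_exp_half _ _ (ltn_ord t)).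
Qed.

Lemma expdec_le c w : good_process c -> expdec c w <= (T.+1 * n)%:R.
Proof.
move=> gc; apply: (@le_trans _ _ (\sum_(t < T.+1) \sum_(i < n) 1)); last first.
  by rewrite !big_const_ord !iter_addr_0 -mulrnA mulnC.
apply: ler_sum => t _; apply: ler_sum => i _; rewrite -expR0 ler_expR oppr_le0.
by have [_] := gc t (ltn_ord t); exact.
Qed.

Definition expmass c : R := fine (\int[P]_w (expdec c w)%:E)%E.

Lemma expmassE c : good_process c -> (\int[P]_w (expdec c w)%:E)%E = (expmass c)%:E.
Proof.
move=> gc; rewrite fineK// ge0_fin_numE; last first.
  by apply: integral_ge0 => w _; rewrite lee_fin expdec_ge0.
apply: (@le_lt_trans _ _ (\int[P]_w (T.+1 * n)%:R%:E)%E).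
  apply: ge0_le_integral => //.
  - by move=> w _; rewrite lee_fin expdec_ge0.
  - exact/measurable_EFinP/measurable_expdec.
  - by move=> w _; rewrite lee_fin expdec_le.
by rewrite integral_real_cst ltry.
Qed.

Lemma expmass_bounds c : good_process c -> 0 <= expmass c <= (T.+1 * n)%:R.
Proof.
move=> gc; rewrite -!lee_fin -expmassE//; apply/andP; split.
  by apply: integral_ge0 => w _; rewrite lee_fin expdec_ge0.
apply: (@le_trans _ _ (\int[P]_w (T.+1 * n)%:R%:E)%E).
  apply: ge0_le_integral => //.
  - by move=> w _; rewrite lee_fin expdec_ge0.
  - exact/measurable_EFinP/measurable_expdec.
  - by move=> w _; rewrite lee_fin expdec_le.
by rewrite integral_real_cst.
Qed.

Lemma expmass_midpoint c c' : good_process c -> good_process c' ->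
  good_process (midpoint c c') ->
  (\int[P]_w (expgap c c' w)%:E = (expmass c + expmass c' - 2 * expmass (midpoint c c'))%:E)%E.
Proof.
move=> gc gc' gm.
have mE d : good_process d -> measurable_fun setT (fun w => (expdec d w)%:E).
  by move=> gd; exact/measurable_EFinP/measurable_expdec.
have mg : measurable_fun setT (fun w => (expgap c c' w)%:E).
  exact/measurable_EFinP/measurable_expgap.
have : (\int[P]_w ((expdec c w)%:E + (expdec c' w)%:E) =
   \int[P]_w (2%:E * (expdec (midpoint c c') w)%:E + (expgap c c' w)%:E))%E.
  by apply: eq_integral => w _; rewrite -EFinM -!EFinD expdec_midpoint.
rewrite ge0_integralD//; [|by move=> w _; rewrite lee_fin expdec_ge0|exact: mE
  |by move=> w _; rewrite lee_fin expdec_ge0|exact: mE].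
rewrite ge0_integralD//; last 3 first.
- by move=> w _; rewrite -EFinM lee_fin mulr_ge0// expdec_ge0.
- by apply: emeasurable_funM => //; exact: mE.
- by move=> w _; rewrite lee_fin expgap_ge0.
rewrite ge0_integralZl//; [|exact: mE|by move=> w _; rewrite lee_fin expdec_ge0].
rewrite !expmassE// -EFinM -EFinD => H.
by rewrite EFinB H addeAC -EFinN -EFinD subrr add0e.
Qed.

(* Elements that nearly minimise the mean of the strictly convex functional
   [exp(-c)] are close to each other, by the parallelogram identity
   [expdec_midpoint]: this replaces Komlos' lemma. *)
Lemma convex_selection (S : nat -> set proc) :
  (forall k, S k !=set0) -> (forall k l, (k <= l)%N -> S l `<=` S k) ->
  (forall k c c', S k c -> S k c' -> S k (midpoint c c')) ->
  (forall k c, S k c -> good_process c) ->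
  exists c : nat -> proc, (forall j, S j (c j)) /\
    forall t i, (t <= T)%N ->
      \forall w \ae P, cvgn (fun j => expR (- c j t w ord0 i / 2)).
Proof.
move=> S0 Sd Sc Sg.
pose E k := [set expmass c | c in S k].
have Elb k : has_inf (E k).
  split; first by have [c Skc] := S0 k; exists (expmass c), c.
  by exists 0 => _ [c Skc <-]; have /andP[] := expmass_bounds (Sg _ _ Skc).
pose m k := inf (E k).
have m_le k c : S k c -> m k <= expmass c.
  by move=> Skc; apply: ge_inf; [case: (Elb k)|exists c].
have m_mono k l : (k <= l)%N -> m k <= m l.
  move=> kl; apply: lb_le_inf; first by case: (Elb l).
  by move=> _ [c Slc <-]; apply: m_le; exact: Sd Slc.
have hM : has_sup (range m).
  split; first by exists (m 0%N), 0%N.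
  exists (T.+1 * n)%:R => _ [k _ <-]; have [c Skc] := S0 k.
  by apply: le_trans (m_le _ _ Skc) _; have /andP[] := expmass_bounds (Sg _ _ Skc).
pose M := sup (range m).
have q0 j : (0 : R) < 4^-1 ^+ j by rewrite exprn_gt0// invr_gt0.
have /choice[N HN] : forall j, exists N, M - 4^-1 ^+ j <= m N.
  by move=> j; have [_ [N _ <-] /ltW] := sup_adherent (q0 j) hM; exists N.
(* The sum makes [nn j] nondecreasing in [j] and at least [N j]. *)
pose nn j := (j + \sum_(i < j.+1) N i)%N.
have nnN j : (N j <= nn j)%N.
  by rewrite /nn big_ord_recr/= addnA leq_addl.
have nnS j : (nn j <= nn j.+1)%N.
  by rewrite /nn [X in (_ <= _ + X)%N]big_ord_recr/= leq_add// leq_addr.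
have /choice[c Hc] : forall j, exists c, S (nn j) c /\ expmass c <= M + 4^-1 ^+ j.
  move=> j; have [_ [c Sc' <-] h] := inf_adherent (q0 j) (Elb (nn j)).
  exists c; split => //; apply: le_trans (ltW h) _; rewrite lerD2r.
  by apply: ub_le_sup; [case: hM|exists (nn j)].
have gc j : good_process (c j) by have [h _] := Hc j; exact: Sg h.
exists c; split.
  by move=> j; have [h _] := Hc j; apply: Sd h; exact: leq_addr.
(* Both processes and their midpoint belong to the set of index [nn j]: the gap has mean at most
   [q + q / 4 + 2 q] with [q = 4^-j]. *)
have gap j : (\int[P]_w (expgap (c j) (c j.+1) w)%:E <= (4 * 4^-1 ^+ j)%:E)%E.
  have [h1 e1] := Hc j; have [/(Sd _ _ (nnS j)) h2 e2] := Hc j.+1.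
  have h3 := Sc _ _ _ h1 h2.
  rewrite expmass_midpoint//; last exact: Sg h3.
  rewrite lee_fin; have := m_le _ _ h3; have := le_trans (HN j) (m_mono _ _ (nnN j)).
  move: (q0 j) e1 e2; rewrite exprS.
  by move: (expmass _) (expmass _) (expmass _) (m _) (_ ^+ j) => *; lra.
move=> t i tT; apply: cvgn_square_summable.
  by move=> j; exact: measurable_exp_half.
move=> j; apply: le_trans (gap j); apply: ge0_le_integral => //.
- by move=> w _; rewrite lee_fin sqr_ge0.
- by apply/measurable_EFinP/measurable_funX; apply: measurable_funB; exact: measurable_exp_half.
- exact/measurable_EFinP/measurable_expgap.
move=> w _; rewrite lee_fin /expgap (bigD1 (Ordinal (tT : (t < T.+1)%N)))//= (bigD1 i)//=.
rewrite -sqrrN opprB -addrA lerDl addr_ge0//.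
  by apply: sumr_ge0 => ? _; exact: sqr_ge0.
by apply: sumr_ge0 => ? _; apply: sumr_ge0 => ? _; exact: sqr_ge0.
Qed.

End convex_selection.

(** * Expected utility *)

Lemma lty_ubound {R : realType} (y : \bar R) : (y < +oo)%E -> exists B : R, (y <= B%:E)%E.
Proof. by case: y => // [r _|_]; [exists r|exists 0; rewrite leNye]. Qed.

Section total_utility.
Context {R : realType} {disp : measure_display} {Omega : measurableType disp}.
Context (P : probability Omega R) (T n : nat) (F : nat -> set (set Omega)).
Context (U : nat -> 'rV[R]_n -> \bar R).
Context (hU : forall t, (t <= T)%N -> forall x, orthant x -> U t x != +oo%E).
Context (hUc : forall t, (t <= T)%N -> concave_on_orthant (U t)).
Context (hU1 : forall t, (t <= T)%N -> U1 (U t)).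
Context (hU2 : forall t, (t <= T)%N -> U2 (U t)).
Context (hF : filtration P T F).
Implicit Types (c : nat -> Omega -> 'rV[R]_n).
Local Notation V := (total_utility T U).

Definition orthant_process c := forall t w, orthant (c t w).

Lemma total_utilityE c w : (forall t, orthant (c t w)) ->
  V c w = (\sum_(t < T.+1) U t (c t w))%E.
Proof. by move=> oc; apply: eq_bigr => t _; rewrite patchE mem_set. Qed.

Lemma total_utility_neq_pinfty c w : V c w != +oo%E.
Proof.
rewrite /total_utility; elim/big_ind : _ => // [x y|t _].
  by case: x => //; case: y.
by rewrite patchE; case: ifPn => // /set_mem; apply: hU; exact: leq_ord.
Qed.

Lemma ereal_sum_conv (m : nat) (l : R) (a b z : nat -> \bar R) : 0 <= l <= 1 ->
  (forall t, (t < m)%N -> [/\ a t != +oo, b t != +oo &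
     l%:E * a t + (1 - l)%:E * b t <= z t]%E) ->
  (l%:E * (\sum_(t < m) a t) + (1 - l)%:E * (\sum_(t < m) b t) <= \sum_(t < m) z t)%E.
Proof.
move=> l01; elim: m => [_|m IH H]; first by rewrite !big_ord0 !mule0 addr0.
have sN (f : nat -> \bar R) : (forall t, (t < m)%N -> f t != +oo%E) ->
    (\sum_(t < m) f t != +oo)%E.
  move=> fN; elim/big_ind : _ => // [x y|t _]; last exact: fN.
  by case: x => //; case: y.
have aN := sN a (fun t tm => let: And3 h _ _ := H t (ltnW tm) in h).
have bN := sN b (fun t tm => let: And3 _ h _ := H t (ltnW tm) in h).
have [am bm zm] := H m (leqnn _).
have D (r : R) (x y : \bar R) : x != +oo%E -> y != +oo%E ->
    (r%:E * (x + y) = r%:E * x + r%:E * y)%E.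
  by move=> xN yN; rewrite muleDr//; case: x xN => //; case: y yN.
rewrite !big_ord_recr /= !D// addeACA; apply: leeD => //; apply: IH => t tm.
exact: H (ltnW tm).
Qed.

Lemma total_utility_conv l c c' w : 0 <= l <= 1 -> orthant_process c -> orthant_process c' ->
  (l%:E * V c w + (1 - l)%:E * V c' w <=
    V (fun t w => l *: c t w + (1 - l) *: c' t w)%R w)%E.
Proof.
move=> l01 oc oc'; rewrite !total_utilityE//; last by move=> t; exact: orthant_conv.
apply: (ereal_sum_conv (a := fun t => U t (c t w)) (b := fun t => U t (c' t w))
  (z := fun t => U t (l *: c t w + (1 - l) *: c' t w)%R)) => // t tT.
by split; [exact: hU|exact: hU|exact: hUc].
Qed.

Definition pos_utility (x : nat -> 'rV[R]_n) : R := \sum_(t < T.+1) rutil (U t) (x t).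

Lemma total_utility_pos c w : (forall t, posv (c t w)) -> V c w = (pos_utility (c^~ w))%:E.
Proof.
move=> pc; rewrite total_utilityE; last by move=> t; exact: posv_orthant.
rewrite -sumEFin; apply: eq_bigr => t _; apply: rutilE => //.
- by move=> z; apply: hU; exact: leq_ord.
- by apply: hU1; exact: leq_ord.
- by apply: hU2; exact: leq_ord.
Qed.

Lemma pos_utility_le (x y : nat -> 'rV[R]_n) : (forall t, posv (x t)) ->
  (forall t i, x t ord0 i <= y t ord0 i) -> pos_utility x <= pos_utility y.
Proof.
move=> px xy; apply: ler_sum => t _; apply: rutil_le => //.
- by move=> z; apply: hU; exact: leq_ord.
- by apply: hU1; exact: leq_ord.
- by apply: hU2; exact: leq_ord.
Qed.

Lemma filtration_measurable t : (t <= T)%N -> F t `<=` @measurable _ Omega.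
Proof. by move=> tT; have [_ h <- _] := hF; exact: h. Qed.

Lemma measurable_pos_utility c : (forall t, (t <= T)%N -> measurable_wrt (F t) (c t)) ->
  (forall t w, posv (c t w)) -> measurable_fun setT (fun w => pos_utility (c^~ w)).
Proof.
move=> mc pc; apply: measurable_sum => t; have tT : (t <= T)%N by exact: leq_ord.
apply: (mreal_measurable (filtration_measurable tT)).
apply: posv_utility_measurable => //; [exact: hU|exact: hUc|exact: hU1|exact: hU2|exact: mc].
Qed.

Lemma measurable_total_utility c : (forall t, (t <= T)%N -> usc_on_orthant (U t)) ->
  (forall t, (t <= T)%N -> measurable_wrt (F t) (c t)) -> measurable_fun setT (V c).
Proof.
move=> husc mc; apply: emeasurable_sum => t; have tT : (t <= T)%N by exact: leq_ord.
apply: (measurability _ (ErealGenInftyO.measurableE R)) => //.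
move=> _ [_ [a ->] <-]; rewrite setTI.
have mX := mc t tT; pose O := [set w | orthant (c t w)].
have mO : mevent (F t) O by exact: mevent_orthant.
pose X w := \1_O w *: c t w.
have XO w : orthant (X w).
  have [Ow|Ow] := pselect (O w); first by rewrite /X indic_in// scale1r.
  by rewrite /X indic_out// scale0r => i; rewrite mxE.
have mL : mevent (F t) [set w | (U t (X w) < a%:E)%E].
  apply: (orthant_level_event (hU tT) (hUc tT) (hU1 tT) (hU2 tT) (husc t tT)) => //.
  exact: mw_indic.
apply: (mevent_measurable (filtration_measurable tT)).
rewrite (_ : _ @^-1` _ = (O `&` [set w | (U t (X w) < a%:E)%E]) `|`
    (~` O `&` [set _ | (0 < a%:E)%E])).
  apply: meventU; apply: meventI => //; first exact: meventC.
  exact: mevent_prop.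
apply/seteqP; split => w /=; rewrite in_itv/= patchE.
  case: ifPn => [/set_mem Ow|/negP Ow] h; [left|right]; split => //.
    by rewrite /X indic_in// scale1r.
  by move=> ow; apply: Ow; exact: mem_set.
move=> [[Ow]|[Ow a0]]; last by rewrite memNset.
by rewrite /X indic_in// scale1r mem_set.
Qed.

(** For processes almost surely in the orthant this is a modification on a null set with values in
    the orthant everywhere, as the pointwise inequalities between utilities require. *)
Definition clip c t w := \1_[set w | orthant (c t w)] w *: c t w.

Lemma clip_orthant c : orthant_process (clip c).
Proof.
move=> t w; have [Ow|Ow] := pselect ([set w | orthant (c t w)] w).
  by rewrite /clip indic_in// scale1r.
by rewrite /clip indic_out// scale0r => i; rewrite mxE.
Qed.

Lemma clip_eq c t w : orthant (c t w) -> clip c t w = c t w.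
Proof. by move=> Ow; rewrite /clip (_ : \1__ w = 1) ?scale1r//; exact: indic_in. Qed.

Lemma clip_adapted c : (forall t, (t <= T)%N -> measurable_wrt (F t) (c t)) ->
  adaptedL0 P T F (fun _ _ => @orthant R n) (clip c).
Proof.
move=> mc t tT; split; first by apply: mw_indic; [exact: mevent_orthant (mc _ tT)|exact: mc].
by apply: aeW => w; exact: clip_orthant.
Qed.

Lemma clip_utility c : adaptedL0 P T F (fun _ _ => @orthant R n) c ->
  \forall w \ae P, V (clip c) w = V c w.
Proof.
move=> ac; have : \forall w \ae P, forall t, (t <= T)%N -> orthant (c t w).
  apply: ae_foralln => t; have [tT|tT] := boolP (t <= T)%N; last exact: aeW.
  by apply: filterS (ac t tT).2 => w.
apply: filterS => w ow; apply: eq_bigr => t _; rewrite clip_eq//.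
by apply: ow; exact: leq_ord.
Qed.

Lemma integrable_negpart (f : Omega -> \bar R) : measurable_fun setT f ->
  P.-integrable setT (f^\- )%E -> (\int[P]_w f w < +oo)%E -> P.-integrable setT f.
Proof.
move=> mf nf; rewrite integralE => fo; apply/integrableP; split => //.
have nfin : (\int[P]_w (f^\-)%E w)%E \is a fin_num by exact: integrable_fin_num.
rewrite (_ : (fun w => `|f w|%E) = (fun w => f^\+ w + f^\- w)%E); last first.
  by apply/funext => w; have /(congr1 (fun g => g w)) := fune_abse f.
rewrite ge0_integralD//; [|exact: measurable_funepos|exact: measurable_funeneg].
by move: nfin fo; case: (\int[P]_w f^\- w)%E => // r _; case: (\int[P]_w f^\+ w)%E => //= s _; rewrite -EFinD ltry.
Qed.

End total_utility.

(** * Finiteness of the value function *)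

Section finite_value.
Context {R : realType} {disp : measure_display} {Omega : measurableType disp}.
Context (P : probability Omega R) (T dF dI : nat) (F : nat -> set (set Omega)).
Context (hF : filtration P T F).
Local Notation vec := 'rV[R]_(dF + dI).
Context (K : nat -> Omega -> set vec) (Rp : nat -> Omega -> 'rV[R]_dI -> vec).
Context (hK : cone_process P T F K) (hR : return_process T F Rp).
Context (hR1 : R1 P T Rp) (hR2 : R2 P T F K Rp) (hNA : NAr P T F K Rp) (hdF : (0 < dF)%N).
Context (U : nat -> 'rV[R]_dF -> \bar R).
Context (hU : forall t, (t <= T)%N -> forall x, orthant x -> U t x != +oo%E).
Context (hUc : forall t, (t <= T)%N -> concave_on_orthant (U t)).
Context (hU1 : forall t, (t <= T)%N -> U1 (U t)).
Context (hU2 : forall t, (t <= T)%N -> U2 (U t)).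
Local Notation cons := (fun x => consumptions P T F x K Rp).
Local Notation V := (total_utility T U).
Local Notation val := (fun x => value P T F U x K Rp).

(** Closedness applied to a constant sequence: consumption sets ignore adapted modifications on null
    sets. *)
Lemma cons_clip x c : cons x c -> cons x (clip c).
Proof.
move=> H; have [ac _] := H; apply: (cons_closed hF hK hR hR1 hR2 hNA hdF (fun _ : nat => H)).
  by apply: clip_adapted => t tT; have [] := ac t tT.
move=> t tT; apply: filterS (ac t tT).2 => w ow; rewrite clip_eq//; exact: vcvg_cst.
Qed.

(** The radius of a ball inside the cone is random. As [F 0] is trivial, one of the countably many
    events that a fixed [e] suffices has probability 1. *)
Lemma interior_shift x : (\forall w \ae P, (K 0%N w)° x) ->
  exists2 e : R, 0 < e & \forall w \ae P, K 0%N w (x - const_mx e).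
Proof.
move=> Kx; pose e (m : nat) : R := m.+1%:R^-1.
have e0 m : 0 < e m by rewrite invr_gt0.
have /choice[B HB] : forall m, exists B, mevent (F 0%N) B /\
    \forall w \ae P, B w <-> K 0%N w (x - const_mx (e m)).
  move=> m; have [] := cone_process_measurable hK (leq0n T) (V := fun=> x - const_mx (e m)).
    exact: mw_cst.
  by move=> B mB HB; exists B.
have mB m : measurable (B m).
  by apply: mevent_measurable (HB m).1; exact: (filtration_measurable hF (leq0n T)).
have [[m Pm]|nex] := pselect (exists m, P (B m) != 0%E).
  exists (e m) => //; have [F0 _ _ tr] := hF.
  have FB : F 0%N (B m) by rewrite -(sigma_algebra_id (F0 0%N (leq0n T))); exact: (HB m).1.
  have [P0|P1] := tr _ FB; first by rewrite P0 eqxx in Pm.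
  have : \forall w \ae P, B m w.
    exists (~` B m); split => //; first exact: measurableC.
    by rewrite probability_setC// P1 subee.
  by apply: filterS2 (HB m).2 => w [h _] /h.
exfalso.
have : \forall w \ae P, forall m, ~ B m w.
  apply: ae_foralln => m; apply/ae_notP => //; apply/eqP; apply: contrapT => Pm.
  by apply: nex; exists m; exact/negP.
move=> h; have : \forall w \ae P, False.
  have HB' : \forall w \ae P, forall m, B m w <-> K 0%N w (x - const_mx (e m)).
    by apply: ae_foralln => m; exact: (HB m).2.
  apply: filterS3 h HB' Kx => w nB BK /interior_row[r r0 Hr].
  have [m _ Hm] : \forall m \near \oo, `|0 - @harmonic R m| < r.
    by have /cvgrPdist_lt := @cvg_harmonic R; exact.
  apply: (nB m); apply/BK; apply: Hr => i; rewrite !mxE opprB addrC subrK.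
  by have := Hm m (leqnn m); rewrite sub0r normrN.
move=> [A [mA A0 AT]]; have : P setT = 0%E.
  apply/eqP; rewrite -measure_le0 -A0 le_measure ?inE// => w _; exact: AT.
by rewrite probability_setT => /eqP; rewrite onee_eq0.
Qed.

(** The lower bound [b] makes the negative part integrable, so that the consumption competes in the
    value. *)
Lemma pos_consumption_integrable x c (b : R) : cons x c -> (forall t w, posv (c t w)) ->
  (forall w, b <= pos_utility T U (c^~ w)) -> (val x < +oo)%E ->
  P.-integrable setT (fun w => (pos_utility T U (c^~ w))%:E) /\
  (\int[P]_w (pos_utility T U (c^~ w))%:E <= val x)%E.
Proof.
move=> Hc pc bV xoo; have [ac _] := Hc.
have -> : (fun w => (pos_utility T U (c^~ w))%:E) = V c.
  by apply/funext => w; rewrite (total_utility_pos hU hU1 hU2).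
have VE w : V c w = (pos_utility T U (c^~ w))%:E by exact: total_utility_pos.
have mV : measurable_fun setT (V c).
  rewrite (_ : V c = EFin \o fun w => pos_utility T U (c^~ w)); last by apply/funext => w; exact: VE.
  apply/measurable_EFinP; apply: (measurable_pos_utility hU hUc hU1 hU2 hF) => // t tT.
  by have [] := ac t tT.
have nV : P.-integrable setT (V c)^\-%E.
  apply: (@le_integrable _ _ _ P _ measurableT _ (EFin \o cst `|b|)).
  - exact: measurable_funeneg.
  - move=> w _; rewrite funenegE VE /= !gee0_abs ?lee_fin// ?le_max ?lexx ?orbT//.
    rewrite -EFin_max lee_fin normr_id ge_max normr_ge0 andbT.
    by have := bV w; have := ler_norm (- b); rewrite normrN; lra.
  - exact: finite_measure_integrable_cst.
have Vx : (\int[P]_w V c w <= val x)%E by apply: ereal_sup_ubound; exists c.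
by split => //; apply: integrable_negpart => //; exact: le_lt_trans Vx xoo.
Qed.

(** Given [c] financed from [y], its mixture with a constant consumption is financed from [x0], and
    concavity bounds the utility of [c] by that of the mixture divided by [l], up to a constant. *)
Lemma value_finite x0 y : (\forall w \ae P, (K 0%N w)° x0) -> (val x0 < +oo)%E ->
  (val y < +oo)%E.
Proof.
move=> Kx0 v0; have [e e0 Ke] := interior_shift Kx0.
have [B vB] := lty_ubound v0.
have [j Hj] := small_scale y (divr_gt0 e0 (ltr0n _ 2)).
(* One more than the denominator given by [small_scale], so that the weight is at most 1/2. *)
pose l : R := j.+2%:R^-1.
have l0 : 0 < l by rewrite invr_gt0.
have l12 : l <= 2^-1 by rewrite lef_pV2 ?posrE// ler_nat.
have l01 : 0 <= l <= 1 by lra.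
have l1 : 0 < 1 - l by lra.
have Hl i : l * y ord0 i <= e / 2.
  apply: (@le_trans _ _ `|j.+1%:R^-1 * y ord0 i|); last exact: ltW.
  apply: le_trans (ler_norm _) _; rewrite !normrM ler_wpM2r// !ger0_norm ?invr_ge0//.
  by rewrite lef_pV2 ?posrE// ler_nat.
pose del := e / 2 / T.+1%:R; have del0 : 0 < del by rewrite !divr_gt0.
pose v : 'rV[R]_dF := const_mx del.
have pv : posv v by move=> i; rewrite mxE.
(* The mixture [l y + (1 - l) z] equals [const_mx e], which [x0] exceeds by an element of the cone.
   By [Hl], each coordinate of [z] is at least [e / 2], which pays for [del] at the [T.+1] dates. *)
pose z : vec := (1 - l)^-1 *: (const_mx e - l *: y).
pose b0 := pos_utility T U (fun=> (1 - l) *: v).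
pose b1 := (1 - l) * pos_utility T U (fun=> v).
pose C := `|b0| + `|b1|.
have zo : orthant (z - cst_cons T dI v).
  move=> i; rewrite !mxE; have h : e / 2 <= (1 - l)^-1 * (e - l * y ord0 i).
    rewrite ler_pdivlMl//; have := Hl i; have : (1 - l) * (e / 2) <= e / 2.
      by rewrite ler_piMl//; [exact: divr_ge0 (ltW e0) _|lra].
    lra.
  case: splitP => k _; rewrite ?mulmxnE mxE; last by rewrite subr0; apply: le_trans h; rewrite divr_ge0// ltW.
  by rewrite -mulr_natr divfK ?pnatr_eq0// subr_ge0.
have HB c : consumptionsU P T F U y K Rp c -> (expected_utility P T U c <= (l^-1 * (B + C))%:E)%E.
  move=> [Hc _]; have [ac _] := Hc.
  pose c' t w := l *: clip c t w + (1 - l) *: v.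
  have pc' t w : posv (c' t w).
    move=> i; have := clip_orthant c t w i; rewrite !mxE => h.
    apply: ltr_wpDl; last exact: mulr_gt0.
    by apply: mulr_ge0; [exact: ltW|exact: h].
  have Hc' : cons x0 c'.
    have := cons_conv hF hK hR hR1 hR2 l01 (cons_clip Hc)
      (cons_cst hF hK hR hR1 (posv_orthant pv) zo).
    move=> /(cons_mono hF hK hR hR1); apply; apply: filterS Ke => w.
    by rewrite /z scalerA divff ?gt_eqF// scale1r [l *: y + _]addrC subrK.
  pose Vr w := pos_utility T U (c'^~ w).
  have Vb w : b0 <= Vr w.
    apply: pos_utility_le => //; first by move=> t; exact: posvZ.
    move=> t i; rewrite [leRHS]mxE lerDr mxE; apply: mulr_ge0; first exact: ltW.
    exact: clip_orthant.
  have [iV /le_trans/(_ vB) VB] := pos_consumption_integrable Hc' pc' Vb v0.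
  have mVr : measurable_fun setT (fun w => (Vr w)%:E) by exact: measurable_int iV.
  have VC0 w : 0 <= Vr w + C.
    have := Vb w; have := ler_norm (- b0); rewrite normrN /C; have := normr_ge0 b1; lra.
  have hg w : 0 <= l^-1 * (Vr w + C) by apply: mulr_ge0; [rewrite invr_ge0 ltW|exact: VC0].
  apply: (@le_trans _ _ (\int[P]_w ((V c)^\+)%E w)%E).
    rewrite /expected_utility integralE -[leRHS]sube0; apply: leeB => //.
    exact: integral_ge0.
  apply: (@le_trans _ _ (\int[P]_w (l^-1%:E * ((Vr w)%:E + C%:E)))%E).
    apply: integral_le_ae => //.
      by apply: emeasurable_funM => //; exact: emeasurable_funD.
    apply: filterS (clip_utility U ac) => w; rewrite funeposE => <-.
    have := total_utility_conv hU hUc w l01 (clip_orthant c) (c' := fun _ _ => v)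
      (fun _ _ => posv_orthant pv).
    rewrite -/(V c' w) (total_utility_pos hU hU1 hU2 (c := c')) => [|t]; last exact: pc'.
    rewrite (total_utility_pos hU hU1 hU2 (c := fun _ _ => v)) => [|//].
    rewrite -EFinD -EFinM.
    case: (V (clip c) w) (total_utility_neq_pinfty hU (clip c) w) => [r _|//|_ _].
      rewrite -!EFinM -EFinD lee_fin => h; rewrite -EFin_max lee_fin ge_max.
      rewrite hg andbT ler_pdivlMl//.
      have := ler_norm (- b1); rewrite normrN /C; have := normr_ge0 b0.
      by move: h; rewrite /b1 /Vr; lra.
    by rewrite maxNye lee_fin; exact: hg.
  have iC : P.-integrable setT (EFin \o cst C) by exact: finite_measure_integrable_cst.
  rewrite integralZl//; last exact: (integrableD measurableT iV iC).
  rewrite integralD// (integral_real_cst P C) EFinM lee_pmul2l ?lte_fin ?invr_gt0//.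
  exact: (leeD VB (lexx C%:E)).
apply: le_lt_trans (ltry (l^-1 * (B + C))); apply: ub_ereal_sup => _ [c Hc <-].
exact: HB.
Qed.

End finite_value.

(** * Attainment *)

Section limits.
Context {R : realType}.

(* The factor [q < 2] wins against doubling: an iterated bound
   [A_(j+1) <= (1 + gam) A_j + C] is [o(2 ^ j)]. *)
Lemma geometric_majorant (gam C A0 : R) : 0 <= gam -> gam < 1 -> 0 <= C -> 0 <= A0 ->
  exists q A, [/\ A0 <= A,
    forall j, (1 + gam) * (q ^+ j * A) + C <= q ^+ j.+1 * A
  & forall D eta : R, 0 < eta -> exists j : nat, q ^+ j * A + D < eta * 2 ^+ j].
Proof.
move=> g0 g1 C0 A00; pose r := (1 - gam) / 2; have r0 : 0 < r by rewrite divr_gt0// subr_gt0.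
(* [q] is the midpoint of [1 + gam] and 2, and [A] contains [C / r] so that the additional growth
   [r * A] absorbs [C]. *)
pose q := 1 + gam + r; pose A := A0 + C / r.
have q1 : 1 <= q by rewrite /q; lra.
have q2 : q < 2 by rewrite /q /r; lra.
have Cr : 0 <= C / r by rewrite divr_ge0// ltW.
have A_ge0 : 0 <= A by rewrite addr_ge0.
exists q, A; split; first by rewrite /A lerDl.
  move=> j; rewrite exprS -mulrA {3}/q [leRHS]mulrDl lerD2l.
  apply: (@le_trans _ _ (r * A)).
    by rewrite /A mulrDr mulrCA divff ?gt_eqF// mulr1 lerDr mulr_ge0// ltW.
  by rewrite ler_wpM2l ?(ltW r0)// ler_peMl// exprn_ege1.
move=> D eta eta0.
have c1 : (fun j => (q / 2) ^+ j * A + D * 2^-1 ^+ j) @ \oo --> (0 : R).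
  rewrite [X in _ --> X](_ : _ = 0 * A + D * 0); last by rewrite mul0r mulr0 addr0.
  apply: cvgD.
    apply: cvgM; last exact: cvg_cst.
    by apply: cvg_expr; rewrite ger0_norm; lra.
  apply: cvgM; first exact: cvg_cst.
  by apply: cvg_expr; rewrite ger0_norm; lra.
have [N _ HN] := cvgr_lt _ c1 _ eta0; exists N; have := HN N (leqnn N).
have p0 : (0 : R) < 2 ^+ N by rewrite exprn_gt0.
rewrite -(ltr_pM2r p0) mulrDl => h; apply: le_lt_trans h.
rewrite mulrAC -exprMn divfK// -mulrA -exprMn mulVf// expr1n mulr1.
by [].
Qed.

(** A positive limit can be inverted by the logarithm; the limit 0 means divergence. *)
Lemma exp_half_cvg (u : nat -> R) : cvgn (fun j => expR (- u j / 2)) ->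
  u @ \oo --> +oo \/ cvgn u.
Proof.
set e := fun j => _ => /cvg_ex[l el]; have [l0|l0] := ltP 0 l.
  right; apply/cvg_ex; exists (- 2 * ln l).
  have -> : u = fun j => - 2 * ln (e j).
    by apply/funext => j; rewrite /e expRK; field.
  apply: cvgM; first exact: cvg_cst.
  exact: (cvg_comp _ _ el (continuous_ln l0)).
left; apply/cvgryPge => A.
have : \forall j \near \oo, e j < expR (- A / 2).
  by apply: cvgr_lt el _ _; apply: le_lt_trans l0 _; exact: expR_gt0.
by apply: filterS => j; rewrite /e ltr_expR => h; lra.
Qed.

Lemma ereal_between (x y : \bar R) : (x < y)%E -> exists b : R, (x < b%:E)%E /\ (b%:E < y)%E.
Proof.
case: x => [x| |]; case: y => [y| |] xy; rewrite ?ltNge ?leey ?leNye//= in xy.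
- by exists ((x + y) / 2); move: xy; rewrite -ltNge !lte_fin => xy; split; lra.
- by exists (x + 1); rewrite lte_fin ltry; split => //; lra.
- by exists (y - 1); rewrite lte_fin ltNyr; split => //; lra.
- by exists 0; rewrite ltNyr ltry.
Qed.

Lemma limn_einf_ge (f : nat -> \bar R) y :
  (forall b : R, (b%:E < y)%E -> \forall k \near \oo, (b%:E <= f k)%E) ->
  (y <= limn_einf f)%E.
Proof.
move=> H; rewrite leNgt; apply/negP => /ereal_between[b [b1 b2]].
have [N _ HN] := H b b2; move: b1; rewrite ltNge => /negP; apply.
rewrite limn_einf_lim; apply: lime_ge; first exact: is_cvg_einfs.
exists N => // k /= Nk; apply: le_ereal_inf_tmp => _ [m /= km <-].
by apply: HN => /=; exact: leq_trans km.
Qed.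

Lemma limn_einf_le (f : nat -> \bar R) y :
  (\forall k \near \oo, (f k <= y)%E) -> (limn_einf f <= y)%E.
Proof.
move=> H; rewrite limn_einf_lim; apply: lime_le; first exact: is_cvg_einfs.
apply: filterS H => k; apply: le_trans; apply: ereal_inf_lbound.
by exists k => //=.
Qed.

Lemma ereal_lt_split (x y : \bar R) (a : R) : x != +oo%E -> y != +oo%E ->
  (x + y < a%:E)%E -> exists b c : R, [/\ (x < b%:E)%E, (y < c%:E)%E & b + c = a].
Proof.
case: x => [x| |] //; case: y => [y| |] // _ _; rewrite -?EFinD ?lte_fin => h.
- by exists (x + (a - x - y) / 2), (y + (a - x - y) / 2); rewrite !lte_fin; split; lra.
- by exists (x + 1), (a - x - 1); rewrite lte_fin ltNyr; split => //; lra.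
- by exists (a - y - 1), (y + 1); rewrite lte_fin ltNyr; split => //; lra.
- by exists 0, a; rewrite !ltNyr add0r.
Qed.

(** Serves to integrate the negative part of the utility of a midpoint; the weights are simply
    bounded by 1. *)
Lemma negpart_conv (l : R) (a b z : \bar R) : 0 <= l <= 1 ->
  a != +oo%E -> b != +oo%E -> z != +oo%E -> (l%:E * a + (1 - l)%:E * b <= z)%E ->
  (maxe (- z) 0 <= maxe (- a) 0 + maxe (- b) 0)%E.
Proof.
move=> /andP[l0 l1].
have mN (e : \bar R) : maxe e 0%E != -oo%E.
  by rewrite gt_eqF// (lt_le_trans (ltNyr 0))// le_max lexx orbT.
have my : maxe (- -oo)%E 0%E = +oo%E :> \bar R by rewrite maxye.
case: a => [a| |] //; last by rewrite my addye ?leey.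
case: b => [b| |] //; last by rewrite my addey ?leey.
move=> _ _ zy; rewrite -!EFinM -EFinD => h.
have zf : z \is a fin_num by rewrite fin_numE zy andbT gt_eqF// (lt_le_trans (ltNyr _) h).
move: h; rewrite -(fineK zf); move: (fine z) => y.
rewrite lee_fin -!EFinN -!EFin_max -EFinD lee_fin => h.
have h1 : - a <= Num.max (- a) 0 by rewrite le_max lexx.
have h2 : - b <= Num.max (- b) 0 by rewrite le_max lexx.
have h3 : 0 <= Num.max (- a) 0 by rewrite le_max lexx orbT.
have h4 : 0 <= Num.max (- b) 0 by rewrite le_max lexx orbT.
have h5 : l * - a <= Num.max (- a) 0.
  by apply: le_trans (ler_wpM2l l0 h1) _; rewrite ler_piMl.
have h6 : (1 - l) * - b <= Num.max (- b) 0.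
  have l2 : 0 <= 1 - l by rewrite subr_ge0.
  by apply: le_trans (ler_wpM2l l2 h2) _; rewrite ler_piMl// gerBl.
by rewrite ge_max addr_ge0// andbT; move: h h5 h6; lra.
Qed.

End limits.

Section attainment.
Context {R : realType} {disp : measure_display} {Omega : measurableType disp}.
Context (P : probability Omega R) (T dF dI : nat) (F : nat -> set (set Omega)).
Context (hF : filtration P T F).
Local Notation vec := 'rV[R]_(dF + dI).
Context (K : nat -> Omega -> set vec) (Rp : nat -> Omega -> 'rV[R]_dI -> vec).
Context (hK : cone_process P T F K) (hR : return_process T F Rp).
Context (hR1 : R1 P T Rp) (hR2 : R2 P T F K Rp) (hNA : NAr P T F K Rp) (hdF : (0 < dF)%N).
Context (U : nat -> 'rV[R]_dF -> \bar R).
Context (hU : forall t, (t <= T)%N -> forall x, orthant x -> U t x != +oo%E).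
Context (hUc : forall t, (t <= T)%N -> concave_on_orthant (U t)).
Context (hU1 : forall t, (t <= T)%N -> U1 (U t)).
Context (hU2 : forall t, (t <= T)%N -> U2 (U t)).
Context (hU4 : forall t, (t <= T)%N -> U4 (U t)).
Implicit Types (c : nat -> Omega -> 'rV[R]_dF).
Local Notation cons := (fun x => consumptions P T F x K Rp).
Local Notation consU := (fun x => consumptionsU P T F U x K Rp).
Local Notation V := (total_utility T U).
Local Notation val := (fun x => value P T F U x K Rp).
Context (hval : forall x, (val x < +oo)%E).

(** A finite nonnegative majorant of the total utility up to the constant [base], to which the
    doubling estimate applies. *)
Definition growth (x : nat -> 'rV[R]_dF) : R := \sum_(t < T.+1) shifted (U t) 1 (x t).

Let base : R := pos_utility T U (fun=> delv dF 1).

Lemma growth_ge0 x : (forall t, orthant (x t)) -> 0 <= growth x.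
Proof.
move=> xo; apply: sumr_ge0 => t _; have tT : (t <= T)%N := leq_ord t.
exact: (shifted_ge0 (hU tT) (hU1 tT) (hU2 tT)).
Qed.

Lemma growth_le (x y : nat -> 'rV[R]_dF) : (forall t, orthant (x t)) -> (forall t i, x t ord0 i <= y t ord0 i) ->
  growth x <= growth y.
Proof.
move=> xo xy; apply: ler_sum => t _; have tT : (t <= T)%N := leq_ord t.
exact: (shifted_le (hU tT) (hU1 tT) (hU2 tT)).
Qed.

Lemma growthE x : growth x = pos_utility T U (fun t => x t + delv dF 1) - base.
Proof. exact: sumrB. Qed.

Lemma total_utility_le_growth c w : orthant_process c -> (V c w <= (growth (c^~ w) + base)%:E)%E.
Proof.
move=> oc; rewrite (total_utilityE T U (c := c)) => [|t]; last exact: oc.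
rewrite /growth /base -big_split -sumEFin; apply: lee_sum => t _.
have tT : (t <= T)%N := leq_ord t.
by apply: (utility_le_shifted (hU tT) (hU1 tT) (hU2 tT)) => //; exact: oc.
Qed.

Lemma growth_double : exists gam C : R, [/\ 0 <= gam, gam < 1, 0 <= C &
  forall x, (forall t, orthant (x t)) ->
    growth (fun t => 2 *: x t) <= (1 + gam) * growth x + C].
Proof.
have /choice[gC HgC] : forall t : 'I_T.+1, exists gC : R * R,
    [/\ 0 <= gC.1, gC.1 < 1, 0 <= gC.2 & forall x, orthant x ->
      shifted (U t) 1 (2 *: x) <= (1 + gC.1) * shifted (U t) 1 x + gC.2].
  move=> t; have tT : (t <= T)%N := leq_ord t.
  have [g [C H]] := shifted_double (hU tT) (hUc tT) (hU1 tT) (hU2 tT) (hU4 tT) ltr01.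
  by exists (g, C).
exists (\big[Num.max/0]_t (gC t).1), (\sum_t (gC t).2); split.
- by apply: bigmax_ge_id.
- by apply: bigmax_lt => // t _; have [] := HgC t.
- by apply: sumr_ge0 => t _; have [] := HgC t.
move=> x xo; rewrite /growth mulr_sumr -big_split; apply: ler_sum => t _ /=.
have [g0 g1 C0 /(_ _ (xo t))] := HgC t; move=> /le_trans; apply; rewrite lerD2r.
have tT : (t <= T)%N := leq_ord t.
apply: ler_wpM2r; first exact: (shifted_ge0 (hU tT) (hU1 tT) (hU2 tT)).
by rewrite lerD2l; apply: (le_bigmax 0 (fun t => (gC t).1) t).
Qed.

Lemma adapted_mw c : adaptedL0 P T F (fun _ _ => @orthant R dF) c ->
  forall t, (t <= T)%N -> measurable_wrt (F t) (c t).
Proof. by move=> ac t tT; have [] := ac t tT. Qed.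

Lemma measurable_growth c (a : R) : 0 <= a -> orthant_process c ->
  (forall t, (t <= T)%N -> measurable_wrt (F t) (c t)) ->
  measurable_fun setT (fun w => growth (fun t => a *: c t w)).
Proof.
move=> a0 oc mc; under eq_fun do rewrite growthE.
apply: measurable_funB => //.
apply: (measurable_pos_utility hU hUc hU1 hU2 hF (c := fun t w => a *: c t w + delv dF 1)).
  by move=> t tT; apply: mwD; [apply: mwZ; [exact: mreal_cst|exact: mc]|exact: mw_cst].
by move=> t w; apply: posv_shift => // i; rewrite mxE mulr_ge0//; exact: oc.
Qed.

(** Shifting by 1 turns [c] into a positive consumption financed from a larger endowment, whose
    value is finite; the bound thus holds for all [c] at once. *)
Lemma growth_integral_bound x : exists2 A : R, 0 <= A & forall c, cons x c ->
  orthant_process c -> (\int[P]_w (growth (c^~ w))%:E <= A%:E)%E.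
Proof.
have [B vB] := lty_ubound (hval (x + cst_cons T dI (delv dF 1))).
exists (`|B - base|) => // c Hc oc.
have po : posv (delv dF 1 : 'rV[R]_dF) by move=> i; rewrite mxE.
have Hc' := cons_shift hF (posv_orthant po) Hc.
set c' := fun t w => c t w + delv dF 1 in Hc'.
have pc' t w : posv (c' t w) by exact: posv_shift.
have base_le w : base <= pos_utility T U (c'^~ w).
  by apply: pos_utility_le => // t i; rewrite [leRHS]mxE lerDr; exact: oc.
have [iV Vx] := pos_consumption_integrable hF hU hUc hU1 hU2 Hc' pc' base_le (hval _).
under eq_integral do rewrite growthE EFinB.
rewrite integralB//; last exact: finite_measure_integrable_cst.
rewrite (integral_real_cst P base).
apply: (@le_trans _ _ (B%:E - base%:E)%E); first exact: (leeB (le_trans Vx vB) (lexx _)).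
by rewrite -EFinB lee_fin ler_norm.
Qed.

(** [growth_double] is iterated from the uniform bound at [2 ^ 0]; the reserve [D] absorbs the
    constants of the later comparison. *)
Lemma growth_scaled_bound x (D eta : R) : 0 < eta -> exists j : nat, forall c, cons x c ->
  orthant_process c ->
  (\int[P]_w (growth (fun t => 2 ^+ j *: c t w)%R)%:E + D%:E < (eta * 2 ^+ j)%:E)%E.
Proof.
move=> eta0; have [A0 A00 HA0] := growth_integral_bound x.
have [gam [C [g0 g1 C0 HC]]] := growth_double.
have [q [A [AA HA Hj]]] := geometric_majorant g0 g1 C0 A00.
have H j c : cons x c -> orthant_process c ->
    (\int[P]_w (growth (fun t => 2 ^+ j *: c t w)%R)%:E <= (q ^+ j * A)%:E)%E.
  move=> Hc oc; have [ac _] := Hc; have mc := adapted_mw ac.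
  have o2 k w t : orthant (2 ^+ k *: c t w).
    by move=> i; rewrite mxE; apply: mulr_ge0; [exact: exprn_ge0|exact: oc].
  have mg k : measurable_fun setT (fun w => (growth (fun t => 2 ^+ k *: c t w))%:E).
    by apply/measurable_EFinP; apply: measurable_growth => //; exact: exprn_ge0.
  elim: j => [|j IH].
    rewrite expr0 mul1r; under eq_integral do under eq_fun do rewrite scale1r.
    by apply: le_trans (HA0 c Hc oc) _; rewrite lee_fin.
  apply: (@le_trans _ _ (\int[P]_w ((1 + gam)%:E * (growth (fun t => 2 ^+ j *: c t w)%R)%:E + C%:E))%E).
    apply: ge0_le_integral => //.
    - by move=> w _; rewrite lee_fin; apply: growth_ge0 => t; exact: o2.
    - by apply: emeasurable_funD => //; apply: emeasurable_funM.
    - move=> w _; rewrite -EFinM -EFinD lee_fin.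
      have := HC (fun t => 2 ^+ j *: c t w) (o2 j w).
      by under [X in growth X <= _ -> _]eq_fun do rewrite scalerA -exprS.
  rewrite ge0_integralD//; last 2 first.
  - move=> w _; rewrite -EFinM lee_fin; apply: mulr_ge0; first exact: addr_ge0.
    by apply: growth_ge0 => t; exact: o2.
  - by apply: emeasurable_funM => //; exact: mg.
  rewrite ge0_integralZl//; last 2 first.
  - by move=> w _; rewrite lee_fin; apply: growth_ge0 => t; exact: o2.
  - by rewrite lee_fin addr_ge0.
  rewrite integral_real_cst.
  apply: (@le_trans _ _ ((1 + gam)%:E * (q ^+ j * A)%:E + C%:E)%E).
    by apply: leeD => //; apply: lee_wpmul2l => //; rewrite lee_fin addr_ge0.
  by rewrite -EFinM -EFinD lee_fin.
have [j Hjj] := Hj D eta eta0; exists j => c Hc oc.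
apply: (@le_lt_trans _ _ ((q ^+ j * A)%:E + D%:E)%E); first exact: (leeD (H j c Hc oc) (lexx _)).
by rewrite -EFinD lte_fin.
Qed.

(** Halving the list reduces averages to the binary mixtures of [cons_conv], whence lengths that are
    powers of two. *)
Lemma cons_average x (cn : nat -> nat -> Omega -> 'rV[R]_dF) : (forall k, cons x (cn k)) ->
  forall j (s : seq nat), size s = (2 ^ j)%N ->
  cons x (fun t w => (2 ^+ j)^-1 *: \sum_(k <- s) cn k t w).
Proof.
move=> Hn; elim=> [|j IH] s.
  case: s => [|k [|]]//= _; have := Hn k.
  rewrite (_ : cn k = fun t w => (2 ^+ 0)^-1 *: \sum_(k0 <- [:: k]) cn k0 t w)//.
  by apply/funext => t; apply/funext => w; rewrite big_seq1 expr0 invr1 scale1r.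
rewrite expnS mul2n -addnn => ss.
have s1 : size (take (2 ^ j) s) = (2 ^ j)%N by rewrite size_takel// ss leq_addr.
have s2 : size (drop (2 ^ j) s) = (2 ^ j)%N by rewrite size_drop ss addnK.
have h01 : 0 <= (2^-1 : R) <= 1 by lra.
have := cons_conv hF hK hR hR1 hR2 h01 (IH _ s1) (IH _ s2).
have -> : 2^-1 *: x + (1 - 2^-1) *: x = x by rewrite -scalerDl addrC subrK scale1r.
congr (cons x _); apply/funext => t; apply/funext => w.
rewrite -[in RHS](cat_take_drop (2 ^ j) s) big_cat /= exprS invfM scalerDr !scalerA.
by congr (_ + _ *: _); congr (_ * _); field.
Qed.

Context (husc : forall t, (t <= T)%N -> usc_on_orthant (U t)).

Lemma utility_sum_usc (x : nat -> nat -> 'rV[R]_dF) (l : nat -> 'rV[R]_dF) :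
  (forall k t, orthant (x k t)) -> (forall t, (t <= T)%N -> vcvg (x^~ t) (l t)) ->
  forall m, (m <= T.+1)%N -> forall a : R, (\sum_(t < m) U t (l t) < a%:E)%E ->
  \forall k \near \oo, (\sum_(t < m) U t (x k t) < a%:E)%E.
Proof.
move=> xo xl; have lo t : (t <= T)%N -> orthant (l t).
  by move=> tT; apply: (orthant_seqclosed (xo^~ t)); exact: xl.
elim=> [_|m IH mT] a.
  by rewrite big_ord0 => a0; apply: nearW => k; rewrite big_ord0.
rewrite big_ord_recr /= => /ereal_lt_split[| |b [d [h1 h2 <-]]].
- elim/big_ind : _ => // [y z|t _]; first by case: y => //; case: z.
  have tT : (t <= T)%N by apply: (leq_trans (ltnW (ltn_ord t))); exact: mT.
  by apply: hU => //; exact: lo.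
- by apply: hU => //; exact: lo.
have := usc_seq (husc mT) (xo^~ m) (xl m mT) h2.
apply: filterS2 (IH (ltnW mT) _ h1) => k k1 k2; rewrite big_ord_recr EFinD /=.
exact: lteD.
Qed.

Lemma measurable_utility c : adaptedL0 P T F (fun _ _ => @orthant R dF) c ->
  measurable_fun setT (V c).
Proof.
by move=> ac; apply: (measurable_total_utility hU hUc hU1 hU2 hF husc (adapted_mw ac)).
Qed.

Lemma consU_integrable x c : consU x c -> P.-integrable setT (V c).
Proof.
move=> Hc; have [[ac _] nV] := Hc; apply: integrable_negpart => //.
  exact: measurable_utility.
by apply: le_lt_trans (hval x); apply: ereal_sup_ubound; exists c.
Qed.

Lemma consU_clip x c : consU x c ->
  consU x (clip c) /\ expected_utility P T U (clip c) = expected_utility P T U c.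
Proof.
move=> [Hc nV]; have [ac _] := Hc; have aE := clip_utility U ac.
have Hc' : cons x (clip c) by exact: (cons_clip hF hK hR hR1 hR2 hNA hdF Hc).
have [ac' _] := Hc'; have m1 := measurable_utility ac; have m2 := measurable_utility ac'.
split; last by apply: ae_eq_integral => //; apply: filterS aE => w h _.
split => //; apply/integrableP; split; first exact: measurable_funeneg.
have /integrableP[_] := nV; congr (_ < _)%E; apply: ae_eq_integral => //.
- by apply: measurableT_comp => //; exact: measurable_funeneg.
- by apply: measurableT_comp => //; exact: measurable_funeneg.
by apply: filterS aE => w h _; rewrite !funenegE h.
Qed.

Lemma consU_midpoint x c c' (a : R) : consU x c -> consU x c' ->
  orthant_process c -> orthant_process c' ->
  (a%:E <= expected_utility P T U c)%E -> (a%:E <= expected_utility P T U c')%E ->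
  consU x (midpoint c c') /\ (a%:E <= expected_utility P T U (midpoint c c'))%E.
Proof.
move=> Hc Hc' oc oc' ac ac'; have h01 : 0 <= (2^-1 : R) <= 1 by lra.
have ic := consU_integrable Hc; have ic' := consU_integrable Hc'.
have Hm : cons x (midpoint c c').
  have := cons_conv hF hK hR hR1 hR2 h01 Hc.1 Hc'.1.
  by have -> : 2^-1 *: x + (1 - 2^-1) *: x = x by rewrite -scalerDl addrC subrK scale1r.
have [am _] := Hm; have mm := measurable_utility am.
have Vm w := total_utility_conv hU hUc w h01 oc oc'.
have HU : consU x (midpoint c c').
  split => //.
  apply: (@le_integrable _ _ _ P _ measurableT _ (fun w => (V c)^\- w + (V c')^\- w)%E).
  - exact: measurable_funeneg.
  - move=> w _; rewrite gee0_abs// gee0_abs ?adde_ge0// !funenegE.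
    apply: (negpart_conv h01 _ _ _ (Vm w)); exact: total_utility_neq_pinfty.
  - by apply: integrableD => //; [exact: Hc.2|exact: Hc'.2].
split => //; have im := consU_integrable HU.
apply: (@le_trans _ _ (\int[P]_w (2^-1%:E * V c w + (1 - 2^-1)%:E * V c' w))%E); last first.
  apply: le_integral => //.
  by apply: integrableD => //; exact: integrableZl.
rewrite integralD//; [|exact: integrableZl|exact: integrableZl].
rewrite !integralZl//.
apply: (@le_trans _ _ (2^-1%:E * a%:E + (1 - 2^-1)%:E * a%:E)%E).
  by rewrite -!EFinM -EFinD lee_fin; lra.
by apply: leeD; apply: lee_wpmul2l => //; rewrite lee_fin; lra.
Qed.

Lemma expected_utility_fin x c : consU x c -> expected_utility P T U c \is a fin_num.
Proof. by move=> Hc; apply: integrable_fin_num => //; exact: consU_integrable Hc. Qed.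

(** Near-maximisers of precision [1 / (n + 1)] form nested sets closed under midpoints.
    [convex_selection] leaves, for each coordinate, convergence or divergence to infinity, and
    [cons_bounded] excludes the latter. *)
Lemma near_maximisers x : consU x !=set0 -> exists (v : R) (cn : nat -> nat -> Omega -> 'rV[R]_dF),
  [/\ val x = v%:E,
      forall j, [/\ consU x (cn j), orthant_process (cn j) &
        ((v - j.+1%:R^-1)%:E <= expected_utility P T U (cn j))%E]
    & forall t i, (t <= T)%N -> \forall w \ae P, cvgn (fun j => cn j t w ord0 i)].
Proof.
move=> [c0 Hc0]; have vub c : consU x c -> (expected_utility P T U c <= val x)%E.
  by move=> Hc; apply: ereal_sup_ubound; exists c.
have vfin : val x \is a fin_num.
  rewrite fin_numE (lt_eqF (hval x)) andbT gt_eqF//; apply: lt_le_trans (vub _ Hc0).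
  by have := expected_utility_fin Hc0; rewrite fin_numElt => /andP[].
pose v := fine (val x); have vE : val x = v%:E by rewrite fineK.
pose S (n : nat) := [set c | [/\ consU x c, orthant_process c &
  ((v - n.+1%:R^-1)%:E <= expected_utility P T U c)%E]].
have [||||cn [Sn cvn]] := @convex_selection _ _ _ P T dF S.
- move=> n; have : ((v - n.+1%:R^-1)%:E < val x)%E.
    by rewrite vE lte_fin ltrBlDr ltrDl invr_gt0.
  move=> /ereal_sup_gt[_ [c Hc <-] /ltW vc]; have [Hc' EE] := consU_clip Hc.
  by exists (clip c); split => //; [exact: clip_orthant|rewrite EE].
- move=> k l kl c [Hc oc vc]; split => //; apply: le_trans vc.
  by rewrite lee_fin lerD2l lerN2 lef_pV2 ?posrE// ler_nat.
- move=> k c c' [Hc oc vc] [Hc' oc' vc'].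
  have [Hm vm] := consU_midpoint Hc Hc' oc oc' vc vc'; split => // t w.
  by apply: orthant_conv => //; apply/andP; split; [rewrite invr_ge0|rewrite invf_le1 ?ler1n].
- move=> k c [[[ac _] _] oc _] t tT; split; last exact: oc.
  by move=> i; apply: (mreal_measurable (filtration_measurable hF tT)); exact: (adapted_mw ac tT).
exists v, cn; split => // t i tT.
have Hn j : cons x (cn j) by have [[]] := Sn j.
apply: filterS2 (cvn t i tT) (cons_bounded hF hK hR hR1 hR2 hNA hdF i tT Hn) => w.
by move=> /exp_half_cvg[//|].
Qed.

(** The limit superior is adapted whether or not the sequence converges; clipping handles the points
    where it leaves the orthant. *)
Definition limit_process (cn : nat -> nat -> Omega -> 'rV[R]_dF) : nat -> Omega -> 'rV[R]_dF :=
  clip (fun t w => \row_i fine (limn_esup (EFin \o (fun j => cn j t w ord0 i)))).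

Lemma limit_processP x cn : (forall j, cons x (cn j)) -> (forall j, orthant_process (cn j)) ->
  (forall t i, (t <= T)%N -> \forall w \ae P, cvgn (fun j => cn j t w ord0 i)) ->
  cons x (limit_process cn) /\
  \forall w \ae P, forall t, (t <= T)%N -> vcvg (fun j => cn j t w) (limit_process cn t w).
Proof.
move=> Hn on cvn.
have cv t : (t <= T)%N -> \forall w \ae P, vcvg (fun j => cn j t w) (limit_process cn t w).
  move=> tT; have : \forall w \ae P, forall i, cvgn (fun j => cn j t w ord0 i).
    by apply: ae_count => i; exact: cvn.
  apply: filterS => w cw.
  have cl : vcvg (fun j => cn j t w)
      (\row_i fine (limn_esup (EFin \o (fun j => cn j t w ord0 i)))).
    by move=> i; have /cvg_ex[l hl] := cw i; rewrite mxE (limsupE hl).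
  rewrite /limit_process clip_eq//.
  by apply: orthant_seqclosed cl => j; exact: on.
split; last first.
  by apply: ae_foralln => t; have [tT|tT] := boolP (t <= T)%N; [|exact: aeW];
    apply: filterS (cv t tT).
apply: (cons_closed hF hK hR hR1 hR2 hNA hdF Hn) => //.
apply: clip_adapted => t tT i.
rewrite (_ : (fun _ => _) = fun w => fine (limn_esup (EFin \o (fun j => cn j t w ord0 i)))).
  by apply: mreal_limsup => j; have [ac _] := Hn j; exact: (adapted_mw ac tT).
by apply/funext => w; rewrite mxE.
Qed.

Definition pos_part_utility c w : R := fine (maxe (V c w) 0).

Lemma pos_part_utilityE c w : (V c)^\+%E w = (pos_part_utility c w)%:E.
Proof.
rewrite funeposE fineK//; have := total_utility_neq_pinfty hU c w.
by case: (V c w) => // [r _|_]; rewrite ?maxNye// -EFin_max.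
Qed.

Lemma pos_part_utility_ge0 c w : 0 <= pos_part_utility c w.
Proof. by apply: fine_ge0; rewrite le_max lexx orbT. Qed.

Lemma measurable_pos_part x c : cons x c -> measurable_fun setT (pos_part_utility c).
Proof.
move=> [ac _]; apply: (measurableT_comp (fine_measurable measurableT)).
by apply: measurable_maxe => //; exact: measurable_utility.
Qed.

Lemma pos_part_le_growth c w : orthant_process c ->
  pos_part_utility c w <= growth (c^~ w) + `|base|.
Proof.
move=> oc; rewrite -lee_fin -pos_part_utilityE funeposE ge_max; apply/andP; split.
  by apply: le_trans (total_utility_le_growth w oc) _; rewrite lee_fin lerD2l ler_norm.
by rewrite lee_fin addr_ge0//; apply: growth_ge0 => t; exact: oc.
Qed.

(* The excess of the positive parts over their limit vanishes in mean: a sum of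
   [2 ^ j] consumptions is [2 ^ j] times a consumption, whose growth has an
   integral that is [o(2 ^ j)]. *)
Lemma pos_part_excess x cn c : (forall j, cons x (cn j)) -> (forall j, orthant_process (cn j)) ->
  cons x c ->
  (\forall w \ae P, forall a : R, (V c w < a%:E)%E -> \forall j \near \oo, (V (cn j) w < a%:E)%E) ->
  forall eta : R, 0 < eta -> \forall j \near \oo,
    (\int[P]_w (Num.max (pos_part_utility (cn j) w - pos_part_utility c w) 0)%:E <= eta%:E)%E.
Proof.
move=> Hn on Hc lim; pose p := pos_part_utility.
pose g j w := Num.max (p (cn j) w - p c w) 0.
have mgj j : measurable_fun setT (g j).
  apply: measurable_maxr => //.
  by apply: measurable_funB; [exact: measurable_pos_part (Hn j)|exact: measurable_pos_part Hc].
apply: (reverse_fatou_max (g := g)) => //.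
- by move=> j w; rewrite le_max lexx orbT.
- apply: filterS lim => w Vw; apply/cvgrPdist_lt => e e0.
  have pe : 0 < p c w + e by rewrite ltr_wpDl// pos_part_utility_ge0.
  have /Vw : (V c w < (p c w + e)%:E)%E.
    apply: (@le_lt_trans _ _ (p c w)%:E); last by rewrite lte_fin ltrDl.
    by rewrite -pos_part_utilityE funeposE le_max lexx.
  apply: filterS => j h; rewrite sub0r normrN ger0_norm ?le_max ?lexx ?orbT//.
  rewrite gt_max e0 andbT ltrBlDl -lte_fin -pos_part_utilityE funeposE gt_max h /=.
  by rewrite lte_fin.
move=> eta eta0; have [j Hj] := growth_scaled_bound x (`|base|) eta0.
exists (2 ^ j)%N => s ss; pose d t w := (2 ^+ j)^-1 *: \sum_(k <- s) cn k t w.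
have Hd : cons x d by exact: cons_average.
have p2 : (0 : R) < 2 ^+ j by rewrite exprn_gt0.
have od : orthant_process d.
  move=> t w i; rewrite mxE summxE; apply: mulr_ge0; first by rewrite invr_ge0 ltW.
  by apply: sumr_ge0 => k _; exact: on.
have [ad _] := Hd.
have mg : measurable_fun setT (fun w => (growth (fun t => 2 ^+ j *: d t w))%:E).
  apply/measurable_EFinP; apply: measurable_growth => //; exact: adapted_mw.
have o2 w t : orthant (2 ^+ j *: d t w).
  by move=> i; rewrite mxE; apply: mulr_ge0; [exact: ltW|exact: od].
have := Hj d Hd od; rewrite natrX; apply: le_lt_trans.
rewrite -[X in (_ <= _ + X)%E](integral_real_cst P) -ge0_integralD//; last first.
  by move=> w _; rewrite lee_fin; exact: growth_ge0.
apply: ge0_le_integral => //.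
- by move=> w _; rewrite lee_fin; exact: bigmax0_ge0.
- apply/measurable_EFinP; apply: measurable_bigmax => k.
  exact: mgj.
- exact: emeasurable_funD.
(* Each [cn k] lies below [2 ^ j] times [d] coordinatewise, so one growth function dominates the
   whole maximum. *)
move=> w _; rewrite -EFinD lee_fin big_seq; apply: bigmax_le.
  by rewrite addr_ge0//; exact: growth_ge0.
move=> k ks; rewrite /g ge_max; apply/andP; split; last by rewrite addr_ge0//; exact: growth_ge0.
apply: (@le_trans _ _ (p (cn k) w)); first by rewrite gerBl pos_part_utility_ge0.
apply: le_trans (pos_part_le_growth w (on k)) _; rewrite lerD2r.
apply: growth_le => [t|t i]; first exact: on.
rewrite scalerA divff ?gt_eqF// scale1r summxE (big_rem k ks) /= lerDl.
by apply: sumr_ge0 => k' _; exact: on.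
Qed.

(** The mean positive parts of the sequence exceed that of the limit by a vanishing amount, and
    Fatou's lemma bounds the mean negative part of the limit; both means are finite, so their
    difference reaches the supremum. *)
Lemma utility_attained x : consU x !=set0 ->
  exists2 c, consU x c & val x = expected_utility P T U c.
Proof.
move=> ne; have [v [cn [vE Hn cvn]]] := near_maximisers ne.
have Cn j : cons x (cn j) by have [[]] := Hn j.
have on j : orthant_process (cn j) by have [] := Hn j.
pose c := limit_process cn; have [Hc cv] := limit_processP Cn on cvn.
have oc : orthant_process c by exact: clip_orthant.
have lim : \forall w \ae P, forall a : R, (V c w < a%:E)%E ->
    \forall j \near \oo, (V (cn j) w < a%:E)%E.
  apply: filterS cv => w cw a; rewrite (total_utilityE T U (c := c)) => [h|t]; last exact: oc.
  have := utility_sum_usc (x := fun j t => cn j t w) (fun j t => on j t w) cw (leqnn _) h.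
  by apply: filterS => j; rewrite (total_utilityE T U (c := cn j)) => // t; exact: on.
pose p := pos_part_utility.
have mp d : cons x d -> measurable_fun setT (fun w => (p d w)%:E).
  by move=> Hd; apply/measurable_EFinP; exact: measurable_pos_part Hd.
have p0 d w : (0 <= (p d w)%:E)%E by rewrite lee_fin pos_part_utility_ge0.
have EE d : expected_utility P T U d =
    (\int[P]_w (p d w)%:E - \int[P]_w (V d)^\- w)%E.
  rewrite /expected_utility integralE; congr (_ - _)%E.
  by apply: eq_integral => w _; exact: pos_part_utilityE.
have mN d : cons x d -> measurable_fun setT (V d)^\-%E.
  by move=> [ad _]; apply: measurable_funeneg; exact: measurable_utility.
have [A A0 HA] := growth_integral_bound x.
have pfin d : cons x d -> orthant_process d -> (\int[P]_w (p d w)%:E)%E \is a fin_num.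
  move=> Hd od; rewrite ge0_fin_numE; last exact: integral_ge0.
  have [ad _] := Hd.
  have mg : measurable_fun setT (fun w => (growth (d^~ w))%:E).
    apply/measurable_EFinP; have := measurable_growth ler01 od (adapted_mw ad).
    by apply: eq_measurable_fun => w _; congr growth; apply/funext => t; rewrite scale1r.
  have g0 w : (0 <= (growth (d^~ w))%:E)%E by rewrite lee_fin; apply: growth_ge0 => t; exact: od.
  apply: (@le_lt_trans _ _ (\int[P]_w ((growth (d^~ w))%:E + `|base|%:E))%E).
    apply: ge0_le_integral => //; [exact: mp|exact: emeasurable_funD|].
    by move=> w _; rewrite -EFinD lee_fin; exact: pos_part_le_growth.
  rewrite ge0_integralD// integral_real_cst.
  by apply: lte_add_pinfty; [exact: le_lt_trans (HA d Hd od) (ltry _)|exact: ltry].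
pose Q := fine (\int[P]_w (p c w)%:E)%E.
have QE : (\int[P]_w (p c w)%:E = Q%:E)%E by rewrite fineK//; exact: pfin.
(* This bound is optimality in disguise: since the mean positive part of [c] is [Q], it says that
   the expected utility is at least [v]. It also makes the negative part integrable. *)
have NQ : (\int[P]_w (V c)^\- w <= (Q - v)%:E)%E.
  apply/lee_addgt0Pr => e e0; have e2 : 0 < e / 2 by rewrite divr_gt0.
  apply: (@le_trans _ _ (\int[P]_w limn_einf (fun j => (V (cn j))^\- w))%E).
    apply: integral_le_ae => //.
    - by move=> w; apply: limn_einf_ge => b b0; apply: nearW => j; apply: le_trans (ltW b0) _.
    - rewrite /limn_einf; apply: measurableT_comp => //; apply: measurable_fun_limn_esup => j.
      by apply: measurableT_comp => //; exact: mN.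
    (* Only the upper limit of the utilities is controlled, which is the direction required for
       negative parts. *)
    apply: filterS lim => w Vw; apply: limn_einf_ge => b; rewrite !funenegE lt_max => /orP[h|h].
      have /Vw : (V c w < (- b)%:E)%E by rewrite EFinN lteNr.
      by apply: filterS => j /ltW hj; rewrite funenegE le_max leeNr -EFinN hj.
    by apply: nearW => j; rewrite funenegE le_max (ltW h) orbT.
  apply: le_trans (fatou _ _ _ _) _ => //; first by move=> j; exact: mN.
  apply: limn_einf_le; have := pos_part_excess Cn on Hc lim e2.
  have : \forall j \near \oo, j.+1%:R^-1 <= e / 2.
    have /cvgrPdist_le /(_ _ e2) := @cvg_harmonic R.
    by apply: filterS => j; rewrite sub0r normrN; apply: le_trans; exact: ler_norm.
  apply: filterS2 => j hj gj; have [HU _ Ej] := Hn j.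
  have fN : (\int[P]_w (V (cn j))^\- w)%E \is a fin_num.
    by apply: integrable_fin_num => //; exact: HU.2.
  have pj : (\int[P]_w (p (cn j) w)%:E <= (Q + e / 2)%:E)%E.
    pose g w := (Num.max (p (cn j) w - p c w) 0)%:E.
    have mg : measurable_fun setT g.
      apply/measurable_EFinP; apply: measurable_maxr => //.
      by apply: measurable_funB; [exact: measurable_pos_part (Cn j)|exact: measurable_pos_part Hc].
    have g0 w : (0 <= g w)%E by rewrite lee_fin le_max lexx orbT.
    rewrite EFinD; apply: le_trans (leeD (lexx Q%:E) gj); rewrite -QE.
    rewrite -(ge0_integralD P measurableT (fun w _ => p0 c w) (mp c Hc) (fun w _ => g0 w) mg).
    apply: ge0_le_integral => //; [exact: mp|by apply: emeasurable_funD; [exact: mp|exact: mg]|].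
    by move=> w _; rewrite -EFinD lee_fin -lerBlDl le_max lexx.
  have [q qE] : exists q : R, (\int[P]_w (p (cn j) w)%:E = q%:E)%E.
    by exists (fine (\int[P]_w (p (cn j) w)%:E)%E); rewrite fineK//; exact: pfin.
  move: hj pj Ej; rewrite EE qE -(fineK fN) -EFinB -EFinD !lee_fin.
  by move: (fine _) (j.+1%:R^-1) => *; lra.
have Nfin : (\int[P]_w (V c)^\- w)%E \is a fin_num.
  by rewrite ge0_fin_numE; [exact: le_lt_trans NQ (ltry _)|exact: integral_ge0].
have HU : consU x c.
  split => //; apply/integrableP; split; first exact: mN.
  under eq_integral do rewrite gee0_abs//.
  exact: le_lt_trans NQ (ltry _).
exists c => //; apply/eqP; rewrite eq_le; apply/andP; split; last first.
  by apply: ereal_sup_ubound; exists c.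
rewrite vE EE QE -(fineK Nfin) -EFinB lee_fin.
by move: NQ; rewrite -(fineK Nfin) lee_fin; lra.
Qed.

End attainment.

Theorem theorem4p1 (R : realType) (disp : measure_display)
    (Omega : measurableType disp) (P : probability Omega R) (T d N : nat)
    (hT : (1 <= T)%N) (hd : (1 <= d)%N) (hN : (1 <= N)%N)
    (F : nat -> set (set Omega)) (hF : filtration P T F)
    (K : nat -> Omega -> set 'rV[R]_(d + N))
    (Rp : nat -> Omega -> 'rV[R]_N -> 'rV[R]_(d + N))
    (hK : cone_process P T F K) (hR : return_process T F Rp)
    (hR1 : R1 P T Rp) (hR2 : R2 P T F K Rp) (hR3 : R3 P T F Rp)
    (hNA : NAr P T F K Rp)
    (U : nat -> 'rV[R]_d -> \bar R)
    (hU : forall t, (t <= T)%N -> forall x, orthant x -> U t x != +oo%E)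
    (hUc : forall t, (t <= T)%N -> concave_on_orthant (U t))
    (hU1 : forall t, (t <= T)%N -> U1 (U t))
    (hU2 : forall t, (t <= T)%N -> U2 (U t))
    (hU3 : forall t, (t <= T)%N -> U3 (U t))
    (hU4 : forall t, (t <= T)%N -> U4 (U t))
    (hu : exists x : 'rV[R]_(d + N),
       [/\ orthant (rsubmx x), \forall w \ae P, (K 0%N w)° x
         & (value P T F U x K Rp < +oo)%E]) :
  (forall x : 'rV[R]_(d + N), orthant (rsubmx x) ->
     (value P T F U x K Rp < +oo)%E) /\
  ((forall t, (t <= T)%N -> usc_on_orthant (U t)) ->
   forall x : 'rV[R]_(d + N), orthant (rsubmx x) ->
     consumptionsU P T F U x K Rp !=set0 ->
     exists2 c, consumptionsU P T F U x K Rp c &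
       value P T F U x K Rp = expected_utility P T U c).

Proof.
have [x0 [_ Kx0 v0]] := hu.
have hval x : (value P T F U x K Rp < +oo)%E.
  exact: (value_finite hF hK hR hR1 hR2 hNA hd hU hUc hU1 hU2 _ Kx0 v0).
split=> [x _|husc x _ ne]; first exact: hval.
exact: (utility_attained hF hK hR hR1 hR2 hNA hd hU hUc hU1 hU2 hU4 hval husc ne).
Qed.
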